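(* Let $C$ be a smooth projective connected complex curve of genus $>1$ with a Poincaré uniformization, i.e. an isomorphism of analytic manifolds $C\to\mathcal H/\Gamma$, where $\mathcal H$ is the Poincaré half-plane and $\Gamma$ is a discrete subgroup of $SL_2(\mathbb R)$. The product $\mu$, defined in terms of Rankin-Cohen brackets, restricts to a product on $A=\bigoplus_{i\ge0}\big(H^0(\mathcal H,K_{\mathcal H}^{\otimes i})\big)^\Gamma$. The restriction of $\mathrm{lift}$ induces an isomorphism between $(A,\mu)$ and $B^{\mathrm{an}}$.
   Context: For a commutative ring $R$ with unit and a derivation $\partial$, $\Psi\mathrm{DO}(R,\partial)$ is the algebra of formal sums $\sum_{i\in\mathbb Z}a_iD_\partial^i$ ($a_i\in R$, $a_i=0$ for $i$ large), with product $(\sum_i a_iD_\partial^i)(\sum_j b_jD_\partial^j)=\sum_k\big(\sum_{i+j\ge k}\binom{i}{i+j-k}a_i\,\partial^{i+j-k}(b_j)\big)D_\partial^k$; $\Psi\mathrm{DO}(R,\partial)_{\le n}$ is the subspace of sums with $a_i=0$ for $i>n$. $\mathrm{Hol}(\mathcal H)$ is the ring of holomorphic functions on $\mathcal H$, with coordinate $\tau$ and derivation $\partial_{\mathcal H}=d/d\tau$ (the generator $D_{\partial_{\mathcal H}}$ is also written $\partial_{\mathcal H}$); $K_{\mathcal H}$ is the sheaf of differentials on $\mathcal H$. $SL_2(\mathbb R)$ acts naturally on $\bigoplus_{i\ge0}H^0(\mathcal H,K_{\mathcal H}^{\otimes i})$ and on $\Psi\mathrm{DO}(\mathrm{Hol}(\mathcal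 H),\partial_{\mathcal H})$: with $\gamma_*f=f\circ\gamma^{-1}$ and $\gamma_*\partial_{\mathcal H}\gamma_*^{-1}=u_\gamma\partial_{\mathcal H}$, $\gamma$ sends $\sum a_i(D_{\partial_{\mathcal H}})^i$ to $\sum\gamma_*(a_i)(u_\gamma D_{\partial_{\mathcal H}})^i$. A superscript $\Gamma$ denotes $\Gamma$-invariants. The isomorphism $C\to\mathcal H/\Gamma$ identifies the graded Poisson algebra $\bigoplus_{i\ge0}H^0(C,K^{\otimes i})$ ($K$ the canonical bundle of $C$) with $A=\bigoplus_{i\ge0}\big(H^0(\mathcal H,K_{\mathcal H}^{\otimes i})\big)^\Gamma$. $B^{\mathrm{an}}=\big(\Psi\mathrm{DO}(\mathrm{Hol}(\mathcal H),\partial_{\mathcal H})\big)^\Gamma$, filtered by $(B^{\mathrm{an}})^i=\big(\Psi\mathrm{DO}(\mathrm{Hol}(\mathcal H),\partial_{\mathcal H})_{\le -i}\big)^\Gamma$, $i\ge0$. $\mathrm{lift}:\bigoplus_{i\ge0}H^0(\mathcal H,K_{\mathcal H}^{\otimes i})\to\Psi\mathrm{DO}(\mathrm{Hol}(\mathcal H),\partial_{\mathcal H})_{\le0}$ is the lifting map of Cohen-Manin-Zagier: a linear $SL_2(\mathbb R)$-equivariant map such that for $\omega=\omega(\tau)(d\tau)^i$, $\mathrm{lift}(\omega)=\omega(\tau)(\partial_{\mathcal H})^{-i}+\sum_{n>0}\ell_{i,n}\,\omega^{(n)}(\tau)(\partial_{\mathcal H})^{-i-n}$, with $\ell_{i,n}$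 explicit rational numbers (the existence of such a map is their theorem). $\mu$ is the product on $\bigoplus_{i\ge0}H^0(\mathcal H,K_{\mathcal H}^{\otimes i})$ obtained by transporting the product of $\Psi\mathrm{DO}(\mathrm{Hol}(\mathcal H),\partial_{\mathcal H})_{\le0}$ by the map $\mathrm{lift}$. Its components $\mu_{ij}^k:H^0(\mathcal H,K_{\mathcal H}^{\otimes i})\otimes H^0(\mathcal H,K_{\mathcal H}^{\otimes j})\to H^0(\mathcal H,K_{\mathcal H}^{\otimes i+j+k})$ are the Rankin-Cohen brackets: $\mu_{ij}^k(\omega(\tau)(d\tau)^i,\omega'(\tau)(d\tau)^j)=\sum_{\alpha,\beta\ge0}a^k_{i,j,\alpha,\beta}\,\omega^{(\alpha)}(\tau)\,\omega'^{(\beta)}(\tau)(d\tau)^{i+j+k}$ for suitable rational numbers $a^k_{i,j,\alpha,\beta}$.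
   Formalization: The direct sums over i≥0 (in A and in the source of lift and μ) are read as degree-completed sums (infinite families of forms), since with literal direct sums lift is not onto B^an and the transported product μ is not defined. *)

(* Defs.v *)
From HB Require Import structures.
From mathcomp Require Import all_boot all_order all_algebra complex.
From mathcomp Require Import all_classical all_reals all_analysis.
From mathcomp Require Import ring.

Set Implicit Arguments.
Unset Strict Implicit.
Unset Printing Implicit Defensive.

Import Order.TTheory GRing.Theory Num.Theory.
Import numFieldNormedType.Exports.

Local Open Scope classical_set_scope.
Local Open Scope complex_scope.
Local Open Scope ring_scope.

(* R[i], with its bundled structure recorded in the type: the norm, topology
   and derivatives that the library puts on every numClosedFieldType then apply
   to it. In particular [derivable f z 1] for [f : Cx R -> Cx R] is complex
   differentiability at z, and [derive1 f] is the complex derivative. *)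
Definition Cx (R : realType) : numClosedFieldType := R[i].

(* binom(i, n) = i (i - 1) ... (i - n + 1) / n! for an integer i; for i = - m.+1
   (that is, i = Negz m) it is (-1)^n binom(m + n, n). *)
Definition binz (i : int) (n : nat) : int :=
  match i with
  | Posz m => 'C(m, n)%:Z
  | Negz m => (-1) ^+ n * 'C(m + n, n)%:Z
  end.

Section PsiDO.
Variables (S : comPzRingType) (d : S -> S).

(* [a : psido S] stands for the formal sum of the [a i * D ^ i], i in Z. It is a
   pseudodifferential operator when it has [order_le a n] for some n. *)
Definition psido := int -> S.

Implicit Types a b : psido.

Definition order_le a (n : int) : Prop := forall i, n < i -> a i = 0.

(* [\sum_(p \in A)] is the sum of a finitely supported family, and 0 when the
   support is infinite. The support is finite for operators of finite order, if
   d 0 = 0. *)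
Definition psido_mul a b : psido := fun k =>
  \sum_(p \in [set p : int * int | k <= p.1 + p.2])
    (binz p.1 (absz (p.1 + p.2 - k)%R))%:~R *
    (a p.1 * iter (absz (p.1 + p.2 - k)%R) d (b p.2)).

Definition psido_mono (c : S) (n : int) : psido :=
  fun k => if k == n then c else 0.

Definition psido_one : psido := psido_mono 1 0.

(* (u D)^i for i in Z, where v is the inverse of u in S, so that D^-1 v is the
   inverse of u D. *)
Definition psido_pow (u v : S) (i : int) : psido :=
  match i with
  | Posz n => iter n (psido_mul (psido_mono u 1)) psido_one
  | Negz n =>
      iter n.+1 (psido_mul (psido_mul (psido_mono 1 (-1)) (psido_mono v 0)))
           psido_one
  end.

End PsiDO.

Section HalfPlane.
Variable R : realType.
Implicit Types (g : 'M[R]_2) (Gamma : set 'M[R]_2).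

Definition halfplane := {z : Cx R | 0 < complex.Im z}.

(* All functions on the half-plane, a commutative ring for the pointwise
   operations; Hol(H) is its subring of the f such that [hol f]. *)
Definition hfun := halfplane -> Cx R.

Definition extend (f : hfun) (w : Cx R) : Cx R := oapp f 0 (insub w).

Definition hol (f : hfun) : Prop :=
  forall z : halfplane, derivable (extend f) (val z) 1.

(* d / dtau; meaningful on holomorphic functions only, on which it is a
   derivation. *)
Definition dtau (f : hfun) : hfun := fun z => derive1 (extend f) (val z).

Definition tau : hfun := fun z => val z.

Definition mobius_fun g (z : Cx R) : Cx R :=
  ((g 0 0)%:C * z + (g 0 1)%:C) / ((g 1 0)%:C * z + (g 1 1)%:C).

(* For g in SL_2(R) the default value of [insubd] is never used, by
   [mobius_fun_gt0] below. *)
Definition mobius g (z : halfplane) : halfplane :=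
  insubd z (mobius_fun g (val z)).

Lemma mobius_fun_gt0 g (z : Cx R) :
  \det g = 1 -> 0 < complex.Im z -> 0 < complex.Im (mobius_fun g z).
Proof.
case: z => x y /=; rewrite (expand_det_row _ 0) !big_ord_recl big_ord0 /cofactor.
rewrite /= !det_mx11 !mxE /= -[bump 0 0]/1%N -[(0 + 1)%N]/1%N -[(0 + 0)%N]/0%N.
rewrite (_ : lift 0 0 = 1 :> 'I_2); last exact: val_inj.
rewrite (_ : lift 1 0 = 0 :> 'I_2); last exact: val_inj.
move: (g 0 0) (g 0 1) (g 1 0) (g 1 1) => a b c e det1 y0.
have e1 : a * e - b * c = 1 by rewrite -det1 expr0 expr1; ring.
have D0 : 0 < (c * x - 0 * y + e) ^+ 2 + (c * y + 0 * x + 0) ^+ 2.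
  rewrite lt_neqAle addr_ge0 ?sqr_ge0// andbT eq_sym paddr_eq0 ?sqr_ge0//.
  rewrite !sqrf_eq0; apply/negP => /andP[/eqP cx /eqP cy].
  have c0 : c = 0.
    by apply: (mulIf (lt0r_neq0 y0)); rewrite mul0r -cy; ring.
  have e0 : e = 0 by rewrite -cx c0; ring.
  by move: e1; rewrite c0 e0 !mulr0 subrr => /eqP; rewrite eq_sym oner_eq0.
move: D0; set D := _ + _ => D0.
rewrite (_ : _ + _ = (a * e - b * c) * y / D); last by ring.
by rewrite e1 mul1r divr_gt0.
Qed.

Definition discrete_subgroup_SL2 Gamma : Prop :=
  [/\ Gamma `<=` [set g | \det g = 1],
      Gamma 1%:M,
      (forall g h, Gamma g -> Gamma h -> Gamma (g *m h)),
      (forall g, Gamma g -> Gamma (invmx g)) &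
      (forall g, Gamma g -> isolated Gamma g)].

Definition push g (f : hfun) : hfun := fun z => f (mobius (invmx g) z).

(* The section omega(tau) (dtau)^i of the i-th power of the sheaf of
   differentials is represented by the function omega; its image under g is
   (omega o g^-1) (d(g^-1 tau))^i. *)
Definition form_act g (i : nat) (w : hfun) : hfun :=
  push g w * dtau (push g tau) ^+ i.

(* The function u_g with g_* o (d/dtau) o g_*^-1 = u_g d/dtau: it is the value
   at the coordinate tau of the left-hand side. *)
Definition u_ g : hfun := push g (dtau (push (invmx g) tau)).

Definition psido_act g (a : psido hfun) : psido hfun := fun k =>
  \sum_(i \in [set: int])
    push g (a i) * psido_pow dtau (u_ g) (fun z => (u_ g z)^-1) i k.

(* A family f stands for the formal sum of the f i (dtau)^i, i >= 0. The sum is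
   not required to be finite: a product has in general infinitely many nonzero
   components, so it only lives in the completion of the direct sum with respect
   to the degree. *)
Definition forms := nat -> hfun.

Definition forms_one : forms := fun i => if i == 0%N then 1 else 0.

Definition hol_forms : set forms := [set f | forall i, hol (f i)].

Definition Aalg Gamma : set forms :=
  [set f | hol_forms f /\
           forall g i, Gamma g -> form_act g i (f i) = f i].

Definition Aalg_ge Gamma (n : nat) : set forms :=
  [set f | Aalg Gamma f /\ forall i, (i < n)%N -> f i = 0].

Definition Ban Gamma : set (psido hfun) :=
  [set a | [/\ exists n : int, order_le a n,
               forall i, hol (a i) &
               forall g, Gamma g -> psido_act g a = a]].

Definition Ban_ge Gamma (n : nat) : set (psido hfun) :=
  [set a | Ban Gamma a /\ order_le a (- n%:Z)].

(* omega (dtau)^i is sent to the sum over n >= 0 of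
   l_(i, n) omega^(n) D^(- i - n). *)
Definition cmz_lift1 (l : nat -> nat -> rat) (i : nat) (w : hfun) : psido hfun :=
  fun k => if k <= - i%:Z
           then (ratr (l i (absz (k + i%:Z)%R)) : Cx R) *: iter (absz (k + i%:Z)%R) dtau w
           else 0.

(* For each k only the i <= - k contribute. *)
Definition cmz_lift (l : nat -> nat -> rat) (f : forms) : psido hfun :=
  fun k => \sum_(i \in [set: nat]) cmz_lift1 l i (f i) k.

Definition cmz_coefficients (l : nat -> nat -> rat) : Prop :=
  (forall i, l i 0%N = 1) /\
  (forall g i w, \det g = 1 -> hol w ->
     cmz_lift1 l i (form_act g i w) = psido_act g (cmz_lift1 l i w)).

(* The product of operators transported by the lifting map, which is a bijection
   from [hol_forms] to the operators of order at most 0 with holomorphic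
   coefficients. *)
Definition mu (l : nat -> nat -> rat) (f h : forms) : forms :=
  xget 0 [set m | hol_forms m /\
                  cmz_lift l m = psido_mul dtau (cmz_lift l f) (cmz_lift l h)].

End HalfPlane.

(* A Hausdorff space with a holomorphic atlas: the chart [rs_chart a] is a
   homeomorphism from the open set [rs_dom a] to an open subset of the complex
   plane, with inverse [rs_param a]. Both are total functions, whose values
   elsewhere are irrelevant. *)
Record riemannSurface (R : realType) := RiemannSurface {
  rs_sort :> topologicalType;
  rs_index : Type;
  rs_dom : rs_index -> set rs_sort;
  rs_chart : rs_index -> rs_sort -> Cx R;
  rs_param : rs_index -> Cx R -> rs_sort;
  rs_hausdorff : hausdorff_space rs_sort;
  rs_cover : forall p, exists a, rs_dom a p;
  rs_dom_open : forall a, open (rs_dom a);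
  rs_image_open : forall a, open (rs_chart a @` rs_dom a);
  rs_chartK : forall a p, rs_dom a p -> rs_param a (rs_chart a p) = p;
  rs_chart_continuous : forall a p, rs_dom a p ->
    {for p, continuous (rs_chart a)};
  rs_param_continuous : forall a p, rs_dom a p ->
    {for rs_chart a p, continuous (rs_param a)};
  rs_transition : forall a b p, rs_dom a p -> rs_dom b p ->
    derivable (rs_chart b \o rs_param a) (rs_chart a p) 1
}.

Section RiemannSurface.
Variables (R : realType) (X : riemannSurface R).

Definition rs_hol (V : set X) (f : X -> Cx R) : Prop :=
  forall a p, V p -> rs_dom a p ->
    derivable (f \o rs_param a) (rs_chart a p) 1.

(* Global holomorphic differentials: on [rs_dom a], w is w a dz_a, where z_a is
   the coordinate [rs_chart a]. *)
Definition differential (w : rs_index X -> X -> Cx R) : Prop :=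
  (forall a, rs_hol (rs_dom a) (w a)) /\
  (forall a b p, rs_dom a p -> rs_dom b p ->
     w a p = w b p * derive1 (rs_chart b \o rs_param a) (rs_chart a p)).

(* The space of global holomorphic differentials has dimension n. *)
Definition has_genus (n : nat) : Prop :=
  exists e : 'I_n -> rs_index X -> X -> Cx R,
    (forall j, differential (e j)) /\
    forall w, differential w ->
      exists! c : 'rV[Cx R]_n, forall a p, rs_dom a p ->
        w a p = \sum_(j < n) c 0 j * e j a p.

(* An isomorphism of X with the analytic manifold H / Gamma, given as the
   composite q of the projection H -> H / Gamma and of the inverse isomorphism:
   q identifies X with the set of orbits, its topology with the quotient
   topology, and its holomorphic functions with the functions on the quotient
   whose pullback to H is holomorphic. *)
Definition uniformization (Gamma : set 'M[R]_2) (q : halfplane R -> X) : Prop :=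
  [/\ forall p, exists z, q z = p,
      forall z z', q z = q z' <-> exists2 g, Gamma g & z' = mobius g z,
      forall V : set X,
        open V <-> open [set w : Cx R | exists2 z, V (q z) & w = val z] &
      forall (V : set X) (f : X -> Cx R), open V ->
        (rs_hol V f <->
         forall z, V (q z) -> derivable (extend (f \o q)) (val z) 1)].

End RiemannSurface.

(* Main.v *)
Require Import Defs.
From HB Require Import structures.
From mathcomp Require Import all_boot all_order all_algebra complex.
From mathcomp Require Import all_classical all_reals all_analysis.
From mathcomp Require Import zify ring lra.
Set Implicit Arguments.
Unset Strict Implicit.
Unset Printing Implicit Defensive.
Import Order.TTheory GRing.Theory Num.Theory.
Import numFieldNormedType.Exports.
Local Open Scope classical_set_scope.
Local Open Scope complex_scope.
Local Open Scope ring_scope.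

(** The coefficient of D^(-n) in the lift of f is f_n plus a combination of
derivatives of the f_i with i < n. The lifting map is therefore triangular with
ones on the diagonal, and it is a bijection from the sequences of holomorphic
functions to the operators of order at most 0 with holomorphic coefficients
([lift_inj], [unliftK]); it matches vanishing of the first n components with
order at most - n ([order_liftP]). Being equivariant on each component, it sends
the sequences of invariant forms onto the invariant operators of order at most 0
([lift_invariant]). As SL_2(R) acts on operators by ring morphisms
([psido_act_mul]), a product of invariant operators is invariant, so the
transported product preserves the invariant forms. What remains is that an
invariant operator has order at most 0.

Let s D^n be the leading term of an invariant operator, with n > 0. Then
s(g z) = s(z) g'(z)^n: s is a section of the (- n)-th power of the canonical
bundle. The genus being greater than 1, there are two linearly independent
differentials on the curve; let O_0 and O_1 be their pullbacks to the half-plane.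
The function s O_0^n is invariant, hence descends to a continuous function on the
compact curve; its modulus has a maximum, so s O_0^n is a constant by the maximum
principle ([invariant_constant]). If the constant is not 0, then O_0 has no zero,
O_1 / O_0 is in turn an invariant function, hence constant, and the differentials
are dependent. If it is 0, then s = 0 or O_0 = 0 by the identity theorem, and
O_0 = 0 would make a local coordinate of the curve locally constant on the
half-plane, so that some point of the curve would be open
([coord_derivative_not_zero]). Hence s = 0 ([invariant_weight_vanishes]).

Multiplicativity of the action is a statement on differential rings. A product
a b is the sum of the a_i (D^i b), and D (a b) = (D a) b ([psido_mul_left_D]). If
gamma is a ring morphism with u D gamma = gamma D, the substitution T sending
a_i D^i to gamma(a_i) (u D)^i satisfies T (D a) = u D (T a)
([expand_left_D]). For fixed b, both i |-> T (D^i b) and i |-> (u D)^i (T b) start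
at T b and are multiplied by u D when i increases; as multiplication by u D is
injective, they agree for all integers i ([recurrence_unique],
[substitution_mul]).

Holomorphic means complex differentiable at every point, so three facts of
complex analysis have to be proved from there: the derivative is holomorphic
([derivable_derive1]), the identity theorem ([zero_half_plane]) and the maximum
principle ([max_half_plane]). All follow from the mean value property
([circle_mean]), which is Goursat's theorem for w |-> f(c + e^w) on a rectangle
whose height is a multiple of 2 pi: the horizontal sides cancel by periodicity,
and the vertical ones give means of f over two circles. The resulting bound of
|f(c)| by its maximum on a circle persists when f is only continuous at finitely
many points, by applying it to f^n times a polynomial vanishing there and letting
n grow ([disc_center_bound_off]). Applied to difference quotients it makes them
Lipschitz ([slope_bound]), which removes singularities
([removable_singularity]) and gives f = f(c) + (z - c) f'(c) + (z - c)^2 h with h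
holomorphic, whence the differentiability of f'. *)

(** * The complex modulus and epsilon-delta forms of limits *)

Section ComplexModulus.
Variable R : realType.
Implicit Types (z w h l : Cx R) (e d : R).

(** The real-valued modulus: the norm of [Cx R] takes its values in [Cx R]
itself, whose order is not total. *)
Definition nrm z : R := Normc.normc z.

Lemma nrmE z : `|z| = (nrm z)%:C.
Proof. by []. Qed.

Lemma nrm_ge0 z : 0 <= nrm z.
Proof. by rewrite -ler0c -nrmE. Qed.

Lemma nrm0 : nrm 0 = 0.
Proof. by apply: complexI; rewrite -nrmE normr0. Qed.

Lemma nrm1 : nrm 1 = 1.
Proof. by apply: complexI; rewrite -nrmE normr1. Qed.

Lemma nrmN z : nrm (- z) = nrm z.
Proof. by apply: complexI; rewrite -!nrmE normrN. Qed.

Lemma nrm_distC z w : nrm (z - w) = nrm (w - z).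
Proof. by rewrite -nrmN opprB. Qed.

Lemma nrmM z w : nrm (z * w) = nrm z * nrm w.
Proof. by apply: complexI; rewrite -!nrmE rmorphM/= -!nrmE normrM. Qed.

Lemma nrmV z : nrm z^-1 = (nrm z)^-1.
Proof. exact: Normc.normcV. Qed.

Lemma nrmX z n : nrm (z ^+ n) = nrm z ^+ n.
Proof. by elim: n => [|n ih]; rewrite ?expr0 ?nrm1// !exprS nrmM ih. Qed.

Lemma nrmD z w : nrm (z + w) <= nrm z + nrm w.
Proof. by rewrite -lecR rmorphD/= -!nrmE ler_normD. Qed.

Lemma nrmB z w : nrm (z - w) <= nrm z + nrm w.
Proof. by rewrite -(nrmN w) nrmD. Qed.

Lemma nrm_dist_le z w v : nrm (z - v) <= nrm (z - w) + nrm (w - v).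
Proof. by have := nrmD (z - w) (w - v); rewrite addrA subrK. Qed.

Lemma nrm_eq0 z : (nrm z == 0) = (z == 0).
Proof. by rewrite -(inj_eq (@complexI R)) -nrmE normr_eq0. Qed.

Lemma nrm_gt0 z : (0 < nrm z) = (z != 0).
Proof. by rewrite lt_neqAle eq_sym nrm_eq0 nrm_ge0 andbT. Qed.

Lemma nrm_real (x : R) : nrm x%:C = `|x|.
Proof. by rewrite /nrm/= expr0n/= addr0 sqrtr_sqr. Qed.

Lemma nrm_Re z : `|complex.Re z| <= nrm z.
Proof. by rewrite -lecR -nrmE normc_ge_Re. Qed.

Lemma nrm_Im z : `|complex.Im z| <= nrm z.
Proof.
case: z => x y; rewrite /nrm/= -sqrtr_sqr ler_sqrt ?addr_ge0 ?sqr_ge0//.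
by rewrite lerDr sqr_ge0.
Qed.

Lemma nrm_ReIm z : nrm z <= `|complex.Re z| + `|complex.Im z|.
Proof.
rewrite [X in nrm X](complexE z) (le_trans (nrmD _ _))// nrmM !nrm_real.
by rewrite /nrm/= expr0n/= add0r expr1n sqrtr1 mul1r.
Qed.

Lemma nbhs_nrmP z (P : set (Cx R)) :
  nbhs z P <-> exists2 e, 0 < e & forall w, nrm (w - z) < e -> P w.
Proof.
split.
  move/nbhs_normP => [e /= e0 H].
  move: (e0); rewrite ltcE /= => /andP[/eqP Ime Ree].
  exists (complex.Re e) => // w hw; apply: H => /=.
  by rewrite distrC nrmE ltcE /= Ime eqxx.
move=> [e e0 H]; apply/nbhs_normP; exists e%:C => /=; first by rewrite ltcR.
by move=> w /=; rewrite distrC nrmE ltcR => /H.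
Qed.

(** Limits with real epsilons, so that estimates live in the totally ordered
field R. *)
Lemma cvg_nrmP (T : Type) (F : set_system T) {FF : Filter F} (f : T -> Cx R) l :
  f @ F --> l <-> forall e, 0 < e -> \forall t \near F, nrm (f t - l) < e.
Proof.
split.
  move=> /cvgrPdist_lt H e e0; have /H : 0 < e%:C by rewrite ltcR.
  by apply: filterS => t /=; rewrite distrC nrmE ltcR.
move=> H; apply/cvgrPdist_lt => e e0.
move: (e0); rewrite ltcE /= => /andP[/eqP Ime Ree].
apply: filterS (H _ Ree) => t /=.
by rewrite distrC nrmE ltcE /= Ime eqxx.
Qed.

Lemma continuous_nrmP (f : Cx R -> Cx R) z :
  {for z, continuous f} <->
  forall e, 0 < e -> exists2 d, 0 < d & forall w, nrm (w - z) < d -> nrm (f w - f z) < e.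
Proof.
split=> [/(@cvg_nrmP _ _ (nbhs_filter z)) H e /H /nbhs_nrmP//|H].
by apply/(@cvg_nrmP _ _ (nbhs_filter z)) => e e0; apply/nbhs_nrmP/H.
Qed.

(** All differentiability estimates below go through this form: it has no
quotient, hence no case h = 0. *)
Lemma is_derive_nrmP (f : Cx R -> Cx R) z l :
  is_derive z 1 f l <->
  forall e, 0 < e -> exists2 d, 0 < d &
    forall h, nrm h < d -> nrm (f (z + h) - f z - l * h) <= e * nrm h.
Proof.
have quot k h : h != 0 ->
    nrm (h^-1 *: ((f \o shift z) (h *: 1) - f z) - k) * nrm h =
    nrm (f (z + h) - f z - k * h).
  move=> h0; rewrite -nrmM.
  have -> : h^-1 *: ((f \o shift z) (h *: 1) - f z) = h^-1 * (f (z + h) - f z).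
    congr (_ * (f _ - _)); rewrite /= addrC; congr (_ + _); exact: mulr1.
  by rewrite mulrBl mulrAC mulVf// mul1r.
split.
  case=> df <- e e0; move: df => /cvg_ex[l' hl'].
  have -> : 'D_1 f z = l' by apply/cvg_lim.
  move/cvg_nrmP: hl' => /(_ _ e0) /nbhs_nrmP[d d0 H].
  exists d => // h hd; have [->|h0] := eqVneq h 0.
    by rewrite addr0 subrr mulr0 subr0 nrm0 mulr0.
  have hn : 0 < nrm h by rewrite nrm_gt0.
  have := H h; rewrite subr0 => /(_ hd h0) /ltW.
  by rewrite -quot// (ler_pM2r hn).
move=> H.
suff K : h^-1 *: ((f \o shift z) (h *: 1) - f z) @[h --> 0^'] --> l.
  by split; [apply/cvg_ex; exists l | apply/cvg_lim].
apply/cvg_nrmP => e e0; have e2 : 0 < e / 2 by rewrite divr_gt0.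
have [d d0 {}H] := H _ e2.
apply/nbhs_nrmP; exists d => // h; rewrite subr0 => hd h0.
have hn : 0 < nrm h by rewrite nrm_gt0.
have := H h hd; rewrite -quot // (ler_pM2r hn) => /le_lt_trans; apply.
by rewrite ltr_pdivrMr// ltr_pMr// ltr1n.
Qed.

End ComplexModulus.

(** * Integrals of complex-valued functions of a real variable *)

Section ComplexCurves.
Variable R : realType.
Implicit Types (g G : R -> Cx R) (a b t : R).

(** Differentiation of a complex-valued function of a real variable is taken
componentwise, as [Cx R] is a normed module over itself and not over R. *)
Definition curve_derive G t (v : Cx R) : Prop :=
  is_derive t 1 (fun s => complex.Re (G s)) (complex.Re v) /\
  is_derive t 1 (fun s => complex.Im (G s)) (complex.Im v).

Definition curve_continuous g : Prop := forall t e, 0 < e ->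
  exists2 d : R, 0 < d & forall s, `|s - t| < d -> nrm (g s - g t) < e.

Definition primitive_on a b g G : Prop :=
  forall t, a <= t -> t <= b -> curve_derive G t (g t).

(** The integral is the increment of a primitive. Additivity and changes of
integrand then reduce to uniqueness of primitives, that is, to the mean value
inequality. *)
Definition curve_int g a b : Cx R :=
  let G := xget 0 [set G | primitive_on a b g G] in G b - G a.

Lemma Re_add (x y : Cx R) : complex.Re (x + y) = complex.Re x + complex.Re y.
Proof. by case: x; case: y. Qed.

Lemma Im_add (x y : Cx R) : complex.Im (x + y) = complex.Im x + complex.Im y.
Proof. by case: x; case: y. Qed.

Lemma Re_opp (x : Cx R) : complex.Re (- x) = - complex.Re x.
Proof. by case: x. Qed.

Lemma Im_opp (x : Cx R) : complex.Im (- x) = - complex.Im x.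
Proof. by case: x. Qed.

Lemma Re_mul (x y : Cx R) :
  complex.Re (x * y) = complex.Re x * complex.Re y - complex.Im x * complex.Im y.
Proof. by case: x; case: y. Qed.

Lemma Im_mul (x y : Cx R) :
  complex.Im (x * y) = complex.Re x * complex.Im y + complex.Im x * complex.Re y.
Proof. by case: x; case: y. Qed.

Lemma complex_ext (x y : Cx R) :
  complex.Re x = complex.Re y -> complex.Im x = complex.Im y -> x = y.
Proof. by case: x => ? ?; case: y => ? ? /= -> ->. Qed.

Lemma curve_deriveD G1 G2 t v1 v2 : curve_derive G1 t v1 -> curve_derive G2 t v2 ->
  curve_derive (fun s => G1 s + G2 s) t (v1 + v2).
Proof.
move=> [r1 i1] [r2 i2]; split.
  rewrite Re_add; under eq_fun do rewrite Re_add; exact: is_deriveD.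
rewrite Im_add; under eq_fun do rewrite Im_add; exact: is_deriveD.
Qed.

Lemma curve_deriveMl (c : Cx R) G t v : curve_derive G t v ->
  curve_derive (fun s => c * G s) t (c * v).
Proof.
move=> [r i]; split.
  rewrite Re_mul; under eq_fun do rewrite Re_mul.
  by apply: is_deriveB; apply: is_deriveZ.
rewrite Im_mul; under eq_fun do rewrite Im_mul.
by apply: is_deriveD; apply: is_deriveZ.
Qed.

Lemma curve_derive_id t : curve_derive (fun s => s%:C) t 1.
Proof. by split=> /=; [exact: is_derive_id | exact: is_derive_cst]. Qed.

(** The real mean value theorem applied to the scalar product of G with its
own increment G b - G a. *)
Lemma curve_mean_value a b g G M : a <= b -> primitive_on a b g G ->
  (forall t, a <= t -> t <= b -> nrm (g t) <= M) ->
  nrm (G b - G a) <= M * (b - a).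
Proof.
move=> ab dG gM; set w := G b - G a.
pose phi s := complex.Re w * complex.Re (G s) + complex.Im w * complex.Im (G s).
pose dphi s := complex.Re w * complex.Re (g s) + complex.Im w * complex.Im (g s).
have dphiP s : a <= s -> s <= b -> is_derive s 1 phi (dphi s).
  move=> sa sb; have [dr di] := dG s sa sb.
  by apply: is_deriveD; apply: is_deriveZ.
have [||c] := @MVT_segment R phi dphi a b ab.
- by move=> s; rewrite in_itv/= => /andP[/ltW sa /ltW sb]; exact: dphiP.
- apply: derivable_within_continuous => s; rewrite in_itv/= => /andP[sa sb].
  by have [] := dphiP s sa sb.
rewrite in_itv/= => /andP[ca cb] E.
have wE : nrm w * nrm w = dphi c * (b - a).
  rewrite -E -expr2; have : (nrm w ^+ 2)%:C = ((complex.Re w) ^+ 2 + (complex.Im w) ^+ 2)%:C.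
    by rewrite add_Re2_Im2 nrmE rmorphXn.
  move=> /complexI ->.
  have Rw : complex.Re w = complex.Re (G b) - complex.Re (G a) by rewrite Re_add Re_opp.
  have Iw : complex.Im w = complex.Im (G b) - complex.Im (G a) by rewrite Im_add Im_opp.
  by rewrite /phi Rw Iw; ring.
have dphiM : dphi c <= nrm w * M.
  have -> : dphi c = complex.Re (conjc w * g c).
    by rewrite /dphi Re_mul; case: (w) => ? ? /=; ring.
  apply: le_trans (ler_norm _) _; apply: le_trans (nrm_Re _) _.
  rewrite nrmM; have -> : nrm (conjc w) = nrm w.
    by rewrite /nrm; case: (w) => ? ? /=; rewrite sqrrN.
  by rewrite ler_wpM2l ?nrm_ge0// gM.
have [w0|w0] := eqVneq w 0.
  by rewrite w0 nrm0 mulr_ge0 ?subr_ge0// (le_trans (nrm_ge0 (g c)))// gM.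
rewrite -(ler_pM2l (_ : 0 < nrm w)) ?nrm_gt0// wE mulrA ler_wpM2r// subr_ge0//.
Qed.

Lemma curve_intE a b g G : a <= b -> primitive_on a b g G ->
  curve_int g a b = G b - G a.
Proof.
move=> ab dG; rewrite /curve_int /=.
have dG' : primitive_on a b g (xget 0 [set G | primitive_on a b g G]).
  by apply: (@xgetPex _ 0 [set G | primitive_on a b g G]); exists G.
move: (xget _ _) dG' => G' dG'.
suff K : nrm (G' b - G' a - (G b - G a)) <= 0.
  apply/eqP; rewrite -subr_eq0 -nrm_eq0 eq_le nrm_ge0 andbT. exact: K.
have -> : G' b - G' a - (G b - G a) = G' b + -1 * G b - (G' a + -1 * G a) by ring.
rewrite -(mul0r (b - a)).
apply: (@curve_mean_value a b (fun=> 0) (fun s => G' s + (-1) * G s) 0 ab) => [t ta tb|t _ _].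
  have -> : 0 = g t + (-1) * g t by rewrite mulN1r subrr.
  by apply: curve_deriveD; [exact: dG' | apply/curve_deriveMl/dG].
by rewrite nrm0.
Qed.

(** The integral is started at a - 1, so that a is interior and the derivative
at a is two-sided. *)
Lemma real_primitive (f : R -> R) a b : continuous f -> a <= b ->
  exists F, forall t, a <= t -> t <= b -> is_derive t 1 F (f t).
Proof.
move=> cf ab.
exists (fun x => \int[lebesgue_measure]_(t in `[a - 1, x]) f t)%R => t ta tb.
have tb1 : t < b + 1 by rewrite (le_lt_trans tb)// ltrDl.
have ta1 : a - 1 < t by rewrite (lt_le_trans _ ta)// ltrBlDr ltrDl.
have [|D E] := continuous_FTC1_closed tb1 _ ta1 (cf t).
  apply: continuous_compact_integrable; first exact: segment_compact.
  exact: continuous_subspaceT.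
by split; [exact: D | rewrite -derive1E E].
Qed.

Lemma curve_primitive g a b : curve_continuous g -> a <= b ->
  exists G, primitive_on a b g G.
Proof.
move=> cg ab.
have cr : continuous (fun s => complex.Re (g s)).
  move=> t; apply/cvgrPdist_lt => e e0; have [d d0 H] := cg t e e0.
  apply/nbhs_ballP; exists d => //= s /=; rewrite /ball/= distrC => /H.
  by apply: le_lt_trans; rewrite distrC -Re_opp -Re_add nrm_Re.
have ci : continuous (fun s => complex.Im (g s)).
  move=> t; apply/cvgrPdist_lt => e e0; have [d d0 H] := cg t e e0.
  apply/nbhs_ballP; exists d => //= s /=; rewrite /ball/= distrC => /H.
  by apply: le_lt_trans; rewrite distrC -Im_opp -Im_add nrm_Im.
have [F hF] := real_primitive cr ab; have [K hK] := real_primitive ci ab.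
by exists (fun s => (F s +i* K s)%C) => t ta tb; split => /=; [exact: hF|exact: hK].
Qed.

Lemma curve_int_bound g a b M : curve_continuous g -> a <= b ->
  (forall t, a <= t -> t <= b -> nrm (g t) <= M) ->
  nrm (curve_int g a b) <= M * (b - a).
Proof.
move=> cg ab gM; have [G hG] := curve_primitive cg ab.
by rewrite (curve_intE ab hG); exact: curve_mean_value hG gM.
Qed.

Lemma curve_int_cat g a b c : curve_continuous g -> a <= b -> b <= c ->
  curve_int g a c = curve_int g a b + curve_int g b c.
Proof.
move=> cg ab bc; have ac := le_trans ab bc.
have [G hG] := curve_primitive cg ac.
have h1 : primitive_on a b g G by move=> t ta tb; apply: hG => //; exact: le_trans bc.
have h2 : primitive_on b c g G by move=> t ta tb; apply: hG => //; exact: le_trans ta.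
by rewrite (curve_intE ac hG) (curve_intE ab h1) (curve_intE bc h2); ring.
Qed.

Lemma curve_intB g1 g2 a b : curve_continuous g1 -> curve_continuous g2 -> a <= b ->
  curve_int (fun s => g1 s - g2 s) a b = curve_int g1 a b - curve_int g2 a b.
Proof.
move=> c1 c2 ab; have [G1 h1] := curve_primitive c1 ab.
have [G2 h2] := curve_primitive c2 ab.
rewrite (curve_intE ab h1) (curve_intE ab h2).
rewrite (@curve_intE _ _ _ (fun s => G1 s + (-1) * G2 s))//; first by ring.
move=> t ta tb; have -> : g1 t - g2 t = g1 t + (-1) * g2 t by rewrite mulN1r.
apply: curve_deriveD; first exact: h1.
by apply: curve_deriveMl; exact: h2.
Qed.

Lemma curve_int_affine (u v : Cx R) a b : a <= b ->
  curve_int (fun s => u + v * s%:C) a b =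
  u * (b - a)%:C + v * ((b ^+ 2 - a ^+ 2) / 2)%:C.
Proof.
move=> ab; rewrite (@curve_intE _ _ _ (fun s => u * s%:C + v * ((s ^+ 2) / 2)%:C))//.
  by rewrite !(rmorphB, rmorphM)/=; ring.
move=> t ta tb; apply: curve_deriveD.
  by rewrite -[X in curve_derive _ _ X]mulr1; apply/curve_deriveMl/curve_derive_id.
apply: curve_deriveMl; split => /=; last exact: is_derive_cst.
rewrite (_ : (fun s : R => s ^+ 2 / 2) = (id * id * cst 2^-1)%R).
  apply: is_derive_eq; rewrite /= /GRing.scale/= mulr0 add0r !mulr1; by field.
by apply/funext => s /=; rewrite expr2.
Qed.

End ComplexCurves.

(** * Goursat's theorem on rectangles *)

Section Goursat.
Variable R : realType.
Implicit Types (h : Cx R -> Cx R) (a b c d x y : R).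

Definition plane_continuous h : Prop := forall z e, 0 < e ->
  exists2 d : R, 0 < d & forall w, nrm (w - z) < d -> nrm (h w - h z) < e.

(** The integral of h dz along the boundary of [a, b] x [c, d]. *)
Definition rect_int h a b c d : Cx R :=
  curve_int (fun x => h (x +i* c)%C) a b - curve_int (fun x => h (x +i* d)%C) a b
  + 'i%C * (curve_int (fun y => h (b +i* y)%C) c d - curve_int (fun y => h (a +i* y)%C) c d).

Lemma nrm_horizontal x x' y : nrm ((x +i* y)%C - (x' +i* y)%C : Cx R) = `|x - x'|.
Proof. by rewrite /nrm /= subrr expr0n/= addr0 sqrtr_sqr. Qed.

Lemma nrm_vertical x y y' : nrm ((x +i* y)%C - (x +i* y')%C : Cx R) = `|y - y'|.
Proof. by rewrite /nrm /= subrr expr0n/= add0r sqrtr_sqr. Qed.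

Lemma horizontal_continuous h y : plane_continuous h ->
  curve_continuous (fun x => h (x +i* y)%C).
Proof.
move=> ch t e e0; have [d d0 H] := ch (t +i* y)%C e e0.
by exists d => // s; rewrite -(nrm_horizontal _ _ y) => /H.
Qed.

Lemma vertical_continuous h x : plane_continuous h ->
  curve_continuous (fun y => h (x +i* y)%C).
Proof.
move=> ch t e e0; have [d d0 H] := ch (x +i* t)%C e e0.
by exists d => // s; rewrite -(nrm_vertical x) => /H.
Qed.

Lemma affine_continuous (u v : Cx R) : plane_continuous (fun z => u + v * z).
Proof.
move=> z e e0; have n1 : 0 < nrm v + 1 by rewrite ltr_wpDl ?nrm_ge0.
exists (e / (nrm v + 1)); first by rewrite divr_gt0.
move=> w; rewrite ltr_pdivlMr// => H.
have -> : u + v * w - (u + v * z) = v * (w - z) by ring.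
rewrite nrmM; apply: le_lt_trans H; rewrite mulrC ler_wpM2l ?nrm_ge0//.
by rewrite lerDl.
Qed.

Lemma plane_continuousB h1 h2 : plane_continuous h1 -> plane_continuous h2 ->
  plane_continuous (fun z => h1 z - h2 z).
Proof.
move=> c1 c2 z e e0; have e2 : 0 < e / 2 by rewrite divr_gt0.
have [d1 d10 H1] := c1 z _ e2; have [d2 d20 H2] := c2 z _ e2.
exists (Num.min d1 d2); first by rewrite lt_min d10.
move=> w; rewrite lt_min => /andP[/H1 k1 /H2 k2].
have -> : h1 w - h2 w - (h1 z - h2 z) = (h1 w - h1 z) - (h2 w - h2 z) by ring.
by rewrite (le_lt_trans (nrmB _ _))// (splitr e) ltrD.
Qed.

Lemma rect_intB h1 h2 a b c d : plane_continuous h1 -> plane_continuous h2 ->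
  a <= b -> c <= d ->
  rect_int (fun z => h1 z - h2 z) a b c d = rect_int h1 a b c d - rect_int h2 a b c d.
Proof.
move=> c1 c2 ab cd; rewrite /rect_int.
do 2![rewrite curve_intB//; try exact: horizontal_continuous].
do 2![rewrite curve_intB//; try exact: vertical_continuous].
ring.
Qed.

Lemma rect_int_affine (u v : Cx R) a b c d : a <= b -> c <= d ->
  rect_int (fun z => u + v * z) a b c d = 0.
Proof.
move=> ab cd; rewrite /rect_int.
have E x y : ((x +i* y)%C : Cx R) = x%:C + 'i%C * y%:C by rewrite [LHS]complexE.
have hor y : (fun x => u + v * (x +i* y)%C) =
    (fun x => (u + v * 'i%C * y%:C) + v * x%:C).
  by apply/funext => x; rewrite E; ring.
have ver x : (fun y => u + v * (x +i* y)%C) =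
    (fun y => (u + v * x%:C) + (v * 'i%C) * y%:C).
  by apply/funext => y; rewrite E; ring.
rewrite !hor !ver !curve_int_affine// !rmorphB/=.
ring.
Qed.

Lemma rect_int_bound h a b c d M : plane_continuous h -> a <= b -> c <= d ->
  (forall x y, a <= x -> x <= b -> c <= y -> y <= d -> nrm (h (x +i* y)%C) <= M) ->
  nrm (rect_int h a b c d) <= 2 * M * ((b - a) + (d - c)).
Proof.
move=> ch ab cd hM; rewrite /rect_int.
have H y : c <= y -> y <= d -> nrm (curve_int (fun x => h (x +i* y)%C) a b) <= M * (b - a).
  by move=> cy yd; apply: curve_int_bound => //; [exact: horizontal_continuous|auto].
have V x : a <= x -> x <= b -> nrm (curve_int (fun y => h (x +i* y)%C) c d) <= M * (d - c).
  by move=> ax xb; apply: curve_int_bound => //; [exact: vertical_continuous|auto].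
apply: le_trans (nrmD _ _) _.
rewrite nrmM (_ : nrm 'i%C = 1) ?mul1r; last first.
  by rewrite /nrm/= expr0n/= add0r expr1n sqrtr1.
have -> : 2 * M * ((b - a) + (d - c)) =
  (M * (b - a) + M * (b - a)) + (M * (d - c) + M * (d - c)) by ring.
by rewrite lerD// (le_trans (nrmB _ _))// lerD// ?H ?V.
Qed.

Lemma rect_int_split h a m b c n d : plane_continuous h ->
  a <= m -> m <= b -> c <= n -> n <= d ->
  rect_int h a b c d = rect_int h a m c n + rect_int h m b c n +
                       rect_int h a m n d + rect_int h m b n d.
Proof.
move=> ch am mb cn nd; rewrite /rect_int.
rewrite !(@curve_int_cat _ (fun x => h (x +i* _)%C) a m b)//; try exact: horizontal_continuous.
rewrite !(@curve_int_cat _ (fun y => h (_ +i* y)%C) c n d)//; try exact: vertical_continuous.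
ring.
Qed.

Local Notation rect := (R * R * R * R)%type.
Local Notation rint h q := (rect_int h q.1.1.1 q.1.1.2 q.1.2 q.2).

Definition half_subrect (q q' : rect) : Prop :=
  [/\ q.1.1.1 <= q'.1.1.1 /\ q'.1.1.2 <= q.1.1.2,
      q.1.2 <= q'.1.2 /\ q'.2 <= q.2,
      q'.1.1.2 - q'.1.1.1 = (q.1.1.2 - q.1.1.1) / 2 &
      q'.2 - q'.1.2 = (q.2 - q.1.2) / 2].

(** One of the four quarters carries at least a quarter of the integral. *)
Lemma rect_bisect h (q : rect) : plane_continuous h ->
  q.1.1.1 <= q.1.1.2 -> q.1.2 <= q.2 ->
  exists2 q' : rect, half_subrect q q' & nrm (rint h q) / 4 <= nrm (rint h q').
Proof.
case: q => [[[a b] c] d] ch /= ab cd.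
set m := (a + b) / 2; set n := (c + d) / 2.
have am : a <= m by rewrite /m; lra.
have mb : m <= b by rewrite /m; lra.
have cn : c <= n by rewrite /n; lra.
have nd : n <= d by rewrite /n; lra.
set D := nrm _.
have := nrmD (rect_int h a m c n + rect_int h m b c n + rect_int h a m n d)
  (rect_int h m b n d).
have := nrmD (rect_int h a m c n + rect_int h m b c n) (rect_int h a m n d).
have := nrmD (rect_int h a m c n) (rect_int h m b c n).
rewrite -(rect_int_split ch am mb cn nd) -/D => s1 s2 s3.
have [k1|k1] := leP (D / 4) (nrm (rect_int h a m c n)).
  by exists (a, m, c, n) => //; split => //=; rewrite /m /n; lra.
have [k2|k2] := leP (D / 4) (nrm (rect_int h m b c n)).
  by exists (m, b, c, n) => //; split => //=; rewrite /m /n; lra.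
have [k3|k3] := leP (D / 4) (nrm (rect_int h a m n d)).
  by exists (a, m, n, d) => //; split => //=; rewrite /m /n; lra.
exists (m, b, n, d); first by split => //=; rewrite /m /n; lra.
by rewrite /=; lra.
Qed.

Lemma nested_intervals (u v : nat -> R) :
  (forall n, u n <= u n.+1) -> (forall n, v n.+1 <= v n) -> (forall n, u n <= v n) ->
  exists x, forall n, u n <= x /\ x <= v n.
Proof.
move=> uS vS uv.
have um n m : (n <= m)%N -> u n <= u m.
  by move=> nm; apply: (homo_leq (@lexx _ R) (@le_trans _ R) uS).
have vm n m : (n <= m)%N -> v m <= v n.
  move=> nm; apply: (homo_leq (r := fun x y => y <= x) (@lexx _ R) _ vS) => //.
  by move=> y x z xy yz; exact: le_trans yz xy.
have uvb n m : u n <= v m.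
  apply: le_trans (um _ _ (leq_maxl n m)) _; apply: le_trans (uv _) _.
  exact/vm/leq_maxr.
exists (sup (range u)) => n; split.
  apply: ub_le_sup; last by exists n.
  by exists (v 0%N) => _ [m _ <-].
by apply: ge_sup; [exists (u 0%N), 0%N | move=> _ [m _ <-]].
Qed.

(** Bisection yields rectangles shrinking to a point z, on which h differs from
its affine approximation at z by o(|w - z|). Affine functions have integral 0,
and the remainder is o of the squared size, while the bisected integrals decrease
at most as the squared size. *)
Lemma goursat h a b c d : plane_continuous h -> a <= b -> c <= d ->
  (forall x y, a <= x -> x <= b -> c <= y -> y <= d -> derivable h (x +i* y)%C 1) ->
  rect_int h a b c d = 0.
Proof.
move=> ch ab cd dh.
have /choice[f fP] : forall q : rect, exists q',
    q.1.1.1 <= q.1.1.2 -> q.1.2 <= q.2 ->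
    half_subrect q q' /\ nrm (rint h q) / 4 <= nrm (rint h q').
  move=> q; case: (leP q.1.1.1 q.1.1.2) => k1; last by exists q.
  case: (leP q.1.2 q.2) => k2; last by exists q.
  by have [q' ? ?] := rect_bisect ch k1 k2; exists q'.
pose s n := iter n f (a, b, c, d).
have sP n : [/\ (s n).1.1.2 - (s n).1.1.1 = (b - a) / 2 ^+ n,
  (s n).2 - (s n).1.2 = (d - c) / 2 ^+ n &
  nrm (rect_int h a b c d) / 4 ^+ n <= nrm (rint h (s n))].
  elim: n => [|n [ih1 ih2 ih3]]; first by rewrite /= !expr0 !divr1.
  have [||[_ _ k1 k2] k3] := fP (s n).
  - by rewrite -subr_ge0 ih1 divr_ge0 ?subr_ge0// exprn_ge0.
  - by rewrite -subr_ge0 ih2 divr_ge0 ?subr_ge0// exprn_ge0.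
  split.
  - by rewrite /= k1 ih1 exprS invfM; ring.
  - by rewrite /= k2 ih2 exprS invfM; ring.
  - apply: le_trans k3; rewrite exprS invfM mulrCA mulrC ler_pM2r// invr_gt0//.
have s1 n : (s n).1.1.1 <= (s n).1.1.2.
  by rewrite -subr_ge0; have [-> _ _] := sP n; rewrite divr_ge0 ?subr_ge0// exprn_ge0.
have s2 n : (s n).1.2 <= (s n).2.
  by rewrite -subr_ge0; have [_ -> _] := sP n; rewrite divr_ge0 ?subr_ge0// exprn_ge0.
have sub n : half_subrect (s n) (s n.+1) by have [] := fP (s n) (s1 n) (s2 n).
have [||x xP] := @nested_intervals (fun n => (s n).1.1.1) (fun n => (s n).1.1.2) _ _ s1.
- by move=> n; have [[]] := sub n.
- by move=> n; have [[]] := sub n.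
have [||y yP] := @nested_intervals (fun n => (s n).1.2) (fun n => (s n).2) _ _ s2.
- by move=> n; have [_ []] := sub n.
- by move=> n; have [_ []] := sub n.
have [/= ax xb] := xP 0%N; have [/= cy yd] := yP 0%N.
set z : Cx R := (x +i* y)%C.
have /derivableP := dh x y ax xb cy yd; rewrite -/z; set l := 'D_1 h z => /is_derive_nrmP hz.
set p := (b - a) + (d - c).
have p0 : 0 <= p by rewrite addr_ge0 ?subr_ge0.
suff H e : 0 < e -> nrm (rect_int h a b c d) <= 2 * e * (p * p).
  apply/eqP; rewrite -nrm_eq0 eq_le nrm_ge0 andbT.
  apply/ler_addgt0Pr => e e0; rewrite add0r.
  have pp : 0 < 2 * (p * p + 1) by rewrite mulr_gt0// ltr_wpDl// mulr_ge0.
  apply: le_trans (H (e / (2 * (p * p + 1))) (divr_gt0 e0 pp)) _.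
  have -> : 2 * (e / (2 * (p * p + 1))) * (p * p) = e * (2 * (p * p) / (2 * (p * p + 1))).
    by ring.
  rewrite ler_piMr ?(ltW e0)// ler_pdivrMr// mul1r ler_pM2l// lerDl//.
move=> e0; have [dl dl0 {}hz] := hz e e0.
have [n np] : exists n, p / 2 ^+ n < dl.
  exists (Num.bound (p / dl)); rewrite ltr_pdivrMr ?exprn_gt0// mulrC -ltr_pdivrMr//.
  apply: lt_le_trans (archi_boundP (divr_ge0 p0 (ltW dl0))) _.
  by rewrite -natrX ler_nat ltnW// ltn_expl.
have [w1 w2 w3] := sP n.
have pow0 : 0 < 2 ^+ n :> R by rewrite exprn_gt0.
have aff := affine_continuous (h z - l * z) l.
have := rect_intB ch aff (s1 n) (s2 n); rewrite rect_int_affine// subr0 => E.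
have bnd := @rect_int_bound _ _ _ _ _ (e * (p / 2 ^+ n)) (plane_continuousB ch aff) (s1 n) (s2 n).
rewrite E w1 w2 in bnd.
have : nrm (rect_int h a b c d) / 4 ^+ n <= 2 * e * (p * p) / 4 ^+ n.
  apply: le_trans w3 _; apply: le_trans (bnd _) _.
    move=> x' y' ax' xb' cy' yd'; have [xa1 xb1] := xP n; have [yc1 yd1] := yP n.
    have wz : nrm ((x' +i* y')%C - z) <= p / 2 ^+ n.
      apply: le_trans (nrm_ReIm _) _; rewrite /=.
      rewrite /p mulrDl -w1 -w2; apply: lerD; rewrite ler_norml; apply/andP; split; lra.
    have := hz ((x' +i* y')%C - z) (le_lt_trans wz np).
    have -> : z + ((x' +i* y')%C - z) = (x' +i* y')%C by rewrite addrC subrK.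
    have -> : h (x' +i* y')%C - h z - l * ((x' +i* y')%C - z) =
      h (x' +i* y')%C - (h z - l * z + l * (x' +i* y')%C) by ring.
    by move=> /le_trans; apply; rewrite ler_wpM2l// ltW.
  have -> : (4 : R) = 2 * 2 by ring.
  rewrite exprMn invfM /p -mulrDl le_eqVlt; apply/orP; left; apply/eqP; ring.
by rewrite ler_pM2r// invr_gt0 exprn_gt0.
Qed.

End Goursat.

(** * The complex exponential *)

Section Exponential.
Variable R : realType.
Implicit Types (z w h : Cx R) (x y e : R).

Lemma is_derive_compC (f g : Cx R -> Cx R) z a b :
  is_derive z 1 g b -> is_derive (g z) 1 f a -> is_derive z 1 (f \o g) (a * b).
Proof.
move=> /is_derive_nrmP dg /is_derive_nrmP df; apply/is_derive_nrmP => e e0.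
have b1 : 0 < nrm b + 1 by rewrite ltr_wpDl ?nrm_ge0.
have a1 : 0 < nrm a + 1 by rewrite ltr_wpDl ?nrm_ge0.
have [|d1 d10 H1] := df (e / 2 / (nrm b + 1)); first by rewrite !divr_gt0.
set e2 := Num.min 1 (e / 2 / (nrm a + 1)).
have [|d2 d20 H2] := dg e2; first by rewrite lt_min ltr01 !divr_gt0.
exists (Num.min d2 (d1 / (nrm b + 1))); first by rewrite lt_min d20 divr_gt0.
move=> h; rewrite lt_min => /andP[/H2 {}H2]; rewrite ltr_pdivlMr// => hd.
set k := g (z + h) - g z.
have hn := nrm_ge0 h.
have kh : nrm k <= nrm h * (nrm b + 1).
  have -> : k = (k - b * h) + b * h by rewrite subrK.
  apply: le_trans (nrmD _ _) _; rewrite nrmM mulrDr mulr1 addrC mulrC lerD2l.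
  by apply: le_trans H2 _; rewrite -[leRHS]mul1r ler_wpM2r// ge_min lexx.
have := H1 k (le_lt_trans kh hd); rewrite [g z + k]addrC subrK => {}H1 /=.
have -> : f (g (z + h)) - f (g z) - a * b * h =
  (f (g (z + h)) - f (g z) - a * k) + a * (k - b * h) by ring.
apply: le_trans (nrmD _ _) _; rewrite (splitr e) mulrDl; apply: lerD.
  apply: le_trans H1 _; rewrite mulrAC ler_pdivrMr// -[leRHS]mulrA ler_wpM2l//.
  by rewrite divr_ge0// ltW.
rewrite nrmM; apply: le_trans (_ : nrm a * (e2 * nrm h) <= _).
  by rewrite ler_wpM2l ?nrm_ge0.
rewrite mulrA ler_wpM2r//; apply: le_trans (_ : nrm a * (e / 2 / (nrm a + 1)) <= _).
  by rewrite ler_wpM2l ?nrm_ge0// ge_min lexx orbT.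
by rewrite mulrCA mulrA -mulrA ler_piMr ?divr_ge0// ?ltW// ltr_pdivrMr// mul1r ltrDl.
Qed.

Lemma is_derive_real (f : R -> R) x l : is_derive x 1 f l ->
  forall e, 0 < e -> exists2 d, 0 < d &
    forall h : R, `|h| < d -> `|f (x + h) - f x - l * h| <= e * `|h|.
Proof.
move=> [df <-] e e0; move: df => /cvg_ex[/= l' hl'].
have -> : 'D_1 f x = l' by apply/cvg_lim.
move/cvgrPdist_lt: hl' => /(_ _ e0) /nbhs_ballP[d /= d0 H].
exists d => // h hd; have [->|h0] := eqVneq h 0.
  by rewrite addr0 subrr mulr0 subr0 normr0 mulr0.
have := H h; rewrite /ball/= sub0r normrN => /(_ hd h0) /ltW.
have hn : 0 < `|h| by rewrite normr_gt0.
rewrite -(ler_pM2r hn) -normrM distrC; congr (_ <= _); congr `|_|.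
have -> : h^-1 *: (f (h *: 1 + x) - f x) = h^-1 * (f (x + h) - f x).
  by congr (_ * (f _ - _)); rewrite addrC; congr (_ + _); exact: mulr1.
by rewrite mulrBl mulrAC mulVf// mul1r.
Qed.

Definition cexp z : Cx R :=
  (expR (complex.Re z) * cos (complex.Im z) +i* (expR (complex.Re z) * sin (complex.Im z)))%C.

Lemma cexpD z w : cexp (z + w) = cexp z * cexp w.
Proof.
rewrite /cexp Re_add Im_add expRD cosD sinD; apply: complex_ext; rewrite ?Re_mul ?Im_mul /=; ring.
Qed.

Lemma nrm_cexp z : nrm (cexp z) = expR (complex.Re z).
Proof.
rewrite /nrm/= !exprMn -mulrDr cos2Dsin2 mulr1 sqrtr_sqr ger0_norm// expR_ge0.
Qed.

(** The real and imaginary parts of e^h - 1 - h are estimated by the derivatives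
at 0 of the real exponential, cosine and sine. *)
Lemma is_derive_cexp0 : is_derive (0 : Cx R) 1 cexp 1.
Proof.
have cexp0 : cexp 0 = 1 by rewrite /cexp /= expR0 cos0 sin0 mulr1 mulr0.
apply/is_derive_nrmP => e e0; rewrite cexp0.
(* The three elementary estimates add up to at most six terms u |h|. *)
set u := Num.min (e / 6) 1.
have u0 : 0 < u by rewrite lt_min divr_gt0//=.
have ue : u <= e / 6 by rewrite ge_min lexx.
have u1 : u <= 1 by rewrite ge_min lexx orbT.
have [d1 d10 H1] := is_derive_real (is_derive_expR (0 : R)) u0.
have [d2 d20 H2] := is_derive_real (is_derive_cos (0 : R)) u0.
have [d3 d30 H3] := is_derive_real (is_derive_sin (0 : R)) u0.
exists (Num.min (u / 2) (Num.min d1 (Num.min d2 d3))).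
  by rewrite !lt_min d10 d20 d30 divr_gt0.
move=> h; rewrite !lt_min => /and4P[hu h1 h2 h3].
rewrite add0r mul1r; case: h hu h1 h2 h3 => a b; set k := nrm _ => hu h1 h2 h3.
have ak : `|a| <= k by have := nrm_Re (a +i* b)%C.
have bk : `|b| <= k by have := nrm_Im (a +i* b)%C.
have := H1 a (le_lt_trans ak h1); rewrite add0r expR0 mul1r => {}H1.
have := H2 b (le_lt_trans bk h2); rewrite add0r cos0 sin0 oppr0 mul0r subr0 => {}H2.
have := H3 b (le_lt_trans bk h3); rewrite add0r cos0 sin0 mul1r subr0 => {}H3.
have uk x : `|x| <= k -> u * `|x| <= u * k by move=> ?; rewrite ler_wpM2l// ltW.
have {}H1 := le_trans H1 (uk _ ak); have {}H2 := le_trans H2 (uk _ bk).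
have {}H3 := le_trans H3 (uk _ bk).
have k0 : 0 <= k by exact: nrm_ge0.
have e1 : `|expR a - 1| <= u.
  have -> : expR a - 1 = (expR a - 1 - a) + a by ring.
  apply: le_trans (ler_normD _ _) _; have : u * k <= k by rewrite ler_piMl.
  lra.
have e2 : `|expR a| <= 2.
  have -> : expR a = (expR a - 1) + 1 by ring.
  apply: le_trans (ler_normD _ _) _; rewrite normr1; lra.
have s1 : `|sin b| <= 2 * k.
  have -> : sin b = (sin b - b) + b by ring.
  apply: le_trans (ler_normD _ _) _; have : u * k <= k by rewrite ler_piMl.
  lra.
apply: le_trans (nrm_ReIm _) _; rewrite !(Re_add, Re_opp, Im_add, Im_opp)/=.
have -> : expR a * cos b - 1 - a = (expR a - 1 - a) + expR a * (cos b - 1) by ring.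
have -> : expR a * sin b - 0 - b = (expR a - 1) * sin b + (sin b - b) by ring.
have t1 := ler_normD (expR a - 1 - a) (expR a * (cos b - 1)).
have t2 := ler_normD ((expR a - 1) * sin b) (sin b - b).
have t3 : `|expR a * (cos b - 1)| <= 2 * (u * k) by rewrite normrM ler_pM.
have t4 : `|(expR a - 1) * sin b| <= u * (2 * k) by rewrite normrM ler_pM.
have : u * k <= e / 6 * k by rewrite ler_wpM2r.
lra.
Qed.

Lemma is_derive_cexp z : is_derive z 1 cexp (cexp z).
Proof.
apply/is_derive_nrmP => e e0.
have n0 : 0 < nrm (cexp z) by rewrite nrm_cexp expR_gt0.
have e1 : 0 < e / nrm (cexp z) by rewrite divr_gt0.
have /is_derive_nrmP/(_ _ e1)[d d0 H] := is_derive_cexp0.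
exists d => // h /H; rewrite add0r mul1r cexpD.
have -> : cexp 0 = 1 by rewrite /cexp /= expR0 cos0 sin0 mulr1 mulr0.
have -> : cexp z * cexp h - cexp z - cexp z * h = cexp z * (cexp h - 1 - h) by ring.
by rewrite nrmM -(ler_pM2l n0) !mulrA [nrm _ * e]mulrC mulfK// gt_eqF.
Qed.

End Exponential.

(** * The mean value property on circles *)

Section MeanValue.
Variable R : realType.
Implicit Types (z w : Cx R) (x y e : R) (f : Cx R -> Cx R).

Lemma plane_continuousP f : plane_continuous f <-> continuous f.
Proof.
split=> H z; first by apply/continuous_nrmP => e; exact: H.
by move=> e; have /continuous_nrmP := H z; exact.
Qed.

Lemma derivable_continuousC f z : derivable f z 1 -> {for z, continuous f}.
Proof. by move=> /(@derivable1_diffP _ _ f z).1/differentiable_continuous. Qed.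

Lemma cos_sin_shift (y : R) : cos (2 * pi + y) = cos y /\ sin (2 * pi + y) = sin y.
Proof.
rewrite cosD sinD (_ : 2 * pi = pi *+ 2) ?mulr_natl// cos2pi.
rewrite (_ : pi *+ 2 = pi + pi) ?mulr2n// sinD sinpi cospi; split; ring.
Qed.

Lemma curve_int_cst (c : Cx R) (a b : R) : a <= b ->
  curve_int (fun=> c) a b = c * (b - a)%:C.
Proof.
move=> ab; have := curve_int_affine c 0 ab; rewrite mul0r addr0 => <-.
by congr curve_int; apply/funext => s; rewrite mul0r addr0.
Qed.

(** A circle around z in logarithmic polar coordinates: radius e^x, angle y. *)
Definition on_circle f z x y := f (z + cexp (x +i* y)%C).

Lemma mul_i_eq0 (w1 w2 : Cx R) : ('i%C : Cx R) * (w1 - w2) = 0 -> w2 = w1.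
Proof.
move=> E; have := congr1 (@complex.Re R) E; have := congr1 (@complex.Im R) E.
rewrite Re_mul Im_mul Re_add Im_add Re_opp Im_opp /= => h1 h2.
by apply: complex_ext => /=; lra.
Qed.

Lemma min_lipschitz (a b L : R) : `|Num.min a L - Num.min b L| <= `|a - b|.
Proof.
have h1 := ler_norm (a - b); have h2 := ler_norm (- (a - b)); rewrite normrN in h2.
by case: (leP a L) => ?; case: (leP b L) => ?; rewrite ler_norml; apply/andP; split; lra.
Qed.

Lemma cexp_periodic x y : cexp (x +i* (2 * pi + y))%C = cexp (x +i* y)%C.
Proof. by rewrite /cexp/=; have [-> ->] := cos_sin_shift y. Qed.

(** The mean over two turns of a circle. Two turns put every angle of [- pi, pi]
in the interior of the interval of integration, where [eq_on_circle] needs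
it. *)
Lemma circle_mean f z L x : (forall w, nrm (w - z) <= expR L -> derivable f w 1) ->
  x < L ->
  exists g, [/\ curve_continuous g, (forall y, g y = on_circle f z x y) &
    curve_int g (- (2 * pi)) (2 * pi) = f z * (2 * pi + 2 * pi)%:C].
Proof.
move=> df xL.
(* Clamping the real part makes the integrand continuous on the whole plane
   without changing it on the rectangles that are used. *)
pose cl w : Cx R := (Num.min (complex.Re w) L +i* complex.Im w)%C.
pose F w := f (z + cexp w).
pose h w := F (cl w).
have ccl : continuous cl.
  move=> w; apply/continuous_nrmP => e e0; exists (e / 2); first by rewrite divr_gt0.
  move=> v vw; apply: le_lt_trans (nrm_ReIm _) _; rewrite !(Re_add,Im_add,Re_opp,Im_opp)/=.
  have m := min_lipschitz (complex.Re v) (complex.Re w) L.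
  have m1 := nrm_Re (v - w); have m2 := nrm_Im (v - w).
  rewrite Re_add Re_opp in m1; rewrite Im_add Im_opp in m2; lra.
have dF w : complex.Re w <= L -> derivable F w 1.
  move=> wL; have dc : is_derive w 1 (fun u => z + cexp u) (0 + cexp w).
    by apply: is_deriveD; exact: is_derive_cexp.
  have /derivableP df' : derivable f (z + cexp w) 1.
    by apply: df; rewrite [z + _]addrC addrK nrm_cexp ler_expR.
  by have [] := is_derive_compC dc df'.
have ch : plane_continuous h.
  apply/plane_continuousP => w; apply: (@continuous_comp _ _ _ cl F); first exact: ccl.
  by apply: derivable_continuousC; apply: dF; rewrite /= ge_min lexx orbT.
have clE (w : Cx R) : complex.Re w < L -> cl w = w.
  by case: w => a b /= aL; rewrite /cl/= min_l// ltW.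
have dh (w : Cx R) : complex.Re w < L -> derivable h w 1.
  move=> wL; apply: near_eq_derivable (dF w (ltW wL)).
  apply/nbhs_nrmP; exists (L - complex.Re w); first by rewrite subr_gt0.
  move=> v vw; rewrite /h clE//.
  have := le_lt_trans (le_trans (ler_norm _) (nrm_Re (v - w))) vw.
  by rewrite Re_add Re_opp; lra.
pose V t := curve_int (fun y => h (t +i* y)%C) (- (2 * pi)) (2 * pi).
have pi0 := pi_gt0 R.
have AA : - (2 * pi) <= 2 * pi :> R by lra.
have VE x1 x2 : x1 <= x2 -> x2 < L -> V x1 = V x2.
  move=> x12 x2L.
  have := goursat ch x12 AA _; rewrite /rect_int => /(_ _)/wrap[|].
    by move=> t y _ tx _ _; apply: dh; exact: le_lt_trans x2L.
  have -> : (fun t => h (t +i* - (2 * pi))%C) = (fun t => h (t +i* (2 * pi))%C).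
    apply/funext => t; rewrite /h /F /cl /= -[in LHS]cexp_periodic subrr.
    by rewrite -[in RHS](addr0 (2 * pi)) cexp_periodic.
  by rewrite subrr add0r => /mul_i_eq0.
exists (fun y => h (x +i* y)%C); split.
- exact: vertical_continuous.
- by move=> y; rewrite /h clE.
rewrite -/(V x); apply/eqP; rewrite -subr_eq0 -nrm_eq0 eq_le nrm_ge0 andbT.
apply/ler_addgt0Pr => e e0; rewrite add0r.
have P0 : 0 < 2 * pi - (- (2 * pi)) :> R by lra.
have cf : {for z, continuous f}.
  by apply/derivable_continuousC/df; rewrite subrr nrm0 expR_ge0.
move/continuous_nrmP: cf => /(_ _ (divr_gt0 e0 P0)) [d d0 Hd].
(* The mean is computed on a circle so small that f is within e of f z. *)
pose x' := Num.min x (ln d - 1).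
have x'x : x' <= x by rewrite ge_min lexx.
have x'd : expR x' < d.
  have : x' < ln d by rewrite (@le_lt_trans _ _ (ln d - 1))// ?ge_min ?lexx ?orbT// ltrBlDr ltrDl.
  by rewrite -ltr_expR lnK// posrE.
rewrite -(VE x' x x'x xL) /V.
rewrite -[X in (_ + X)%:C]opprK -(curve_int_cst (f z) AA).
have cg : curve_continuous (fun y => h (x' +i* y)%C) by exact: vertical_continuous.
have cc : curve_continuous (fun=> f z : Cx R).
  by move=> t u u0; exists 1 => // s _; rewrite subrr nrm0.
rewrite -(curve_intB cg cc AA) -[leRHS](divfK (lt0r_neq0 P0)).
apply: curve_int_bound => // [t u u0|y _ _].
  have [k k0 K] := cg t u u0; exists k => // s /K.
  by rewrite [h _ - f z - _](_ : _ = h (x' +i* s)%C - h (x' +i* t)%C)//; ring.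
rewrite /h clE//=; last exact: le_lt_trans xL.
by apply/ltW/Hd; rewrite [z + _]addrC addrK nrm_cexp.
Qed.

Lemma le_at_circle_center f z L x M :
  (forall w, nrm (w - z) <= expR L -> derivable f w 1) -> x < L ->
  (forall y, nrm (on_circle f z x y) <= M) -> nrm (f z) <= M.
Proof.
move=> df xL fM; have [g [cg gE gI]] := circle_mean df xL.
have pi0 := pi_gt0 R.
have AA : - (2 * pi) <= 2 * pi :> R by lra.
have := curve_int_bound cg AA (M := M); rewrite gI nrmM nrm_real.
rewrite opprK ger0_norm; last lra.
rewrite ler_pM2r; last lra.
by apply => y _ _; rewrite gE.
Qed.

(** Equality case of the mean value property. With c = f z, the real part of
conj(c) (c - f) is nonnegative on the circle and has mean 0, so a primitive of it
is monotone with equal ends, hence constant; together with |f| <= |c| this forces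
f = c. *)
Lemma eq_on_circle f z L x y :
  (forall w, nrm (w - z) <= expR L -> derivable f w 1) -> x < L ->
  (forall y, nrm (on_circle f z x y) <= nrm (f z)) ->
  - (2 * pi) < y -> y < 2 * pi -> on_circle f z x y = f z.
Proof.
move=> df xL fM y1 y2; have [g [cg gE gI]] := circle_mean df xL.
set A := 2 * pi in y1 y2 gI *.
have AA : - A <= A by rewrite ltW// (lt_trans y1).
have [G hG] := curve_primitive cg AA; set c := f z in gI fM *.
rewrite (curve_intE AA hG) in gI.
pose dphi t := complex.Re (conjc c * (c - g t)).
pose K t := conjc c * (c * t%:C + (-1) * G t).
pose phi t := complex.Re (K t).
have dphiP t : - A <= t -> t <= A -> is_derive t 1 phi (dphi t).
  move=> t1 t2; have : curve_derive K t (conjc c * (c * 1 + (-1) * g t)).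
    apply: curve_deriveMl; apply: curve_deriveD; apply: curve_deriveMl.
      exact: curve_derive_id.
    exact: hG.
  by rewrite mulr1 mulN1r => -[].
have nc : complex.Re (conjc c * c) = nrm c ^+ 2.
  have := add_Re2_Im2 c; rewrite nrmE -rmorphXn => /complexI <-.
  by case: (c) => a b /=; ring.
have ReCS t : complex.Re (conjc c * g t) <= nrm c ^+ 2.
  apply: le_trans (ler_norm _) _; apply: le_trans (nrm_Re _) _.
  rewrite nrmM; have -> : nrm (conjc c) = nrm c.
    by rewrite /nrm; case: (c) => ? ? /=; rewrite sqrrN.
  by rewrite expr2 ler_wpM2l ?nrm_ge0// gE.
have dphi0 t : 0 <= dphi t by rewrite /dphi mulrBr Re_add Re_opp subr_ge0 nc.
have phiAA : phi A = phi (- A).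
  apply/eqP; rewrite -subr_eq0 /phi -Re_opp -Re_add /K; apply/eqP.
  have -> : conjc c * (c * A%:C + -1 * G A) - conjc c * (c * (- A)%:C + -1 * G (- A)) =
     conjc c * (c * (A + A)%:C - (G A - G (- A))) by rewrite rmorphN rmorphD/=; ring.
  by rewrite gI subrr mulr0.
have mono s t : - A <= s -> s <= t -> t <= A -> phi s <= phi t.
  move=> s1 st tA.
  have [||u] := @MVT_segment R phi dphi s t st.
  - move=> u; rewrite in_itv/= => /andP[/ltW sa /ltW sb]; apply: dphiP.
      exact: le_trans sa.
    exact: le_trans tA.
  - apply: derivable_within_continuous => u; rewrite in_itv/= => /andP[sa sb].
    by have [] := dphiP u (le_trans s1 sa) (le_trans sb tA).
  by move=> _ E; rewrite -subr_ge0 E mulr_ge0 ?subr_ge0.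
have phic t : - A <= t -> t <= A -> phi t = phi A.
  by move=> t1 t2; apply/eqP; rewrite eq_le mono//= phiAA mono.
have dphiy : dphi y = 0.
  have [dd dE] := dphiP y (ltW y1) (ltW y2).
  rewrite -dE; have -> : 'D_1 phi y = 'D_1 (cst (phi A)) y.
    apply: near_eq_derive; near=> t; apply: phic.
      by apply/ltW; near: t; exact: lt_nbhsr.
    by apply/ltW; near: t; exact: lt_nbhsl.
  by rewrite derive_cst.
have E : complex.Re (conjc c * g y) = nrm c ^+ 2.
  by apply/eqP; move: dphiy; rewrite /dphi mulrBr Re_add Re_opp nc => /eqP; rewrite subr_eq0 eq_sym.
rewrite -gE; apply/eqP; rewrite -subr_eq0 -nrm_eq0 -sqrf_eq0 eq_le sqr_ge0 andbT.
have sq (w : Cx R) : nrm w ^+ 2 = complex.Re w ^+ 2 + complex.Im w ^+ 2.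
  by have := add_Re2_Im2 w; rewrite nrmE -rmorphXn => /complexI <-.
have gc : nrm (g y) ^+ 2 <= nrm c ^+ 2.
  by rewrite gE ler_pXn2r// ?nnegrE ?nrm_ge0.
have -> : nrm (g y - c) ^+ 2 = nrm (g y) ^+ 2 - 2 * complex.Re (conjc c * g y) + nrm c ^+ 2.
  rewrite !sq Re_add Im_add Re_opp Im_opp Re_mul; case: (c) => a b /=; ring.
rewrite E; lra.
Unshelve. all: by end_near.
Qed.

Lemma polar (w : Cx R) : w != 0 ->
  exists x y, [/\ w = cexp (x +i* y)%C, - (2 * pi) < y, y < 2 * pi & expR x = nrm w].
Proof.
move=> w0; have n0 : 0 < nrm w by rewrite nrm_gt0.
have pi0 := pi_gt0 R.
set a := complex.Re w / nrm w; set b := complex.Im w / nrm w.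
have ab : a ^+ 2 + b ^+ 2 = 1.
  rewrite /a /b !exprMn -mulrDl.
  have := add_Re2_Im2 w; rewrite nrmE -rmorphXn => /complexI ->.
  by rewrite exprVn divff// expf_neq0// gt_eqF.
have a1 : -1 <= a <= 1.
  rewrite -ler_norml -(ler_pXn2r (_ : 0 < 2)%N) ?nnegrE// expr1n.
  by rewrite real_normK ?num_real// -ab lerDl sqr_ge0.
have bE : sin (acos a) = `|b|.
  by rewrite sin_acos// -ab [a ^+ 2 + _]addrC addrK sqrtr_sqr.
have c0 := acos_ge0 a1; have cpi := acos_lepi a1.
exists (ln (nrm w)), (if 0 <= b then acos a else - acos a).
rewrite lnK ?posrE//; split => //; last 2 first.
- by case: ifP => _; lra.
- by case: ifP => _; lra.
apply: complex_ext; rewrite /cexp /= lnK ?posrE//.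
  have -> : cos (if 0 <= b then acos a else - acos a) = a.
    by case: ifP => _; rewrite ?cosN acosK// in_itv.
  by rewrite mulrC divfK// gt_eqF.
have -> : sin (if 0 <= b then acos a else - acos a) = b.
  case: leP => b0; rewrite ?sinN bE; first by rewrite ger0_norm.
  by rewrite ltr0_norm// opprK.
by rewrite mulrC divfK// gt_eqF.
Qed.

End MeanValue.

(** * Isolated exceptional points and difference quotients *)

Section LocalTheory.
Variable R : realType.
Implicit Types (z w c v : Cx R) (r rho M : R) (f g : Cx R -> Cx R).

Lemma circle_param z rho w : 0 < rho -> nrm (w - z) = rho ->
  exists y, [/\ w = z + cexp (ln rho +i* y)%C, - (2 * pi) < y & y < 2 * pi].
Proof.
move=> rho0 wz.
have wz0 : w - z != 0 by rewrite -nrm_gt0 wz.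
have [x [y [E y1 y2 xE]]] := polar wz0; exists y; split => //.
have -> : ln rho = x by rewrite -wz -xE expRK.
by rewrite -E addrC subrK.
Qed.

Lemma disc_center_bound f z r rho M : 0 < rho -> rho < r ->
  (forall w, nrm (w - z) < r -> derivable f w 1) ->
  (forall w, nrm (w - z) = rho -> nrm (f w) <= M) -> nrm (f z) <= M.
Proof.
move=> rho0 rr df fM; have r0 : 0 < (rho + r) / 2 by lra.
have [e1 e2] : expR (ln ((rho + r) / 2)) = (rho + r) / 2 /\ expR (ln rho) = rho.
  by rewrite !lnK.
apply: (@le_at_circle_center _ f z (ln ((rho + r) / 2)) (ln rho)).
- by move=> w; rewrite e1 => h; apply: df; lra.
- by rewrite ltr_ln ?posrE//; lra.
by move=> y; apply: fM; rewrite [z + _]addrC addrK nrm_cexp.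
Qed.

Lemma disc_max_constant f z r :
  (forall w, nrm (w - z) < r -> derivable f w 1) ->
  (forall w, nrm (w - z) < r -> nrm (f w) <= nrm (f z)) ->
  forall w, nrm (w - z) < r -> f w = f z.
Proof.
move=> df fM w wr; have [->//|wz] := eqVneq w z.
have rho0 : 0 < nrm (w - z) by rewrite nrm_gt0 subr_eq0.
set rho := nrm (w - z) in wr rho0.
have r0 : 0 < (rho + r) / 2 by lra.
have [e1 e2] : expR (ln ((rho + r) / 2)) = (rho + r) / 2 /\ expR (ln rho) = rho.
  by rewrite !lnK.
have [y [-> y1 y2]] := circle_param rho0 (erefl rho).
apply: (@eq_on_circle _ f z (ln ((rho + r) / 2)) (ln rho)) => //.
- by move=> u; rewrite e1 => h; apply: df; lra.
- by rewrite ltr_ln ?posrE//; lra.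
by move=> t; apply: fM; rewrite [z + _]addrC addrK nrm_cexp/= e2.
Qed.

(** By Bernoulli's inequality, (a / M)^n is unbounded as soon as a > M. *)
Lemma le_of_powers (a M K : R) : 0 <= a -> 0 <= M ->
  (forall n, a ^+ n <= K * M ^+ n) -> a <= M.
Proof.
move=> a0 M0 H; rewrite leNgt; apply/negP => Ma.
have [Mz|Mz] := eqVneq M 0.
  by have := H 1%N; rewrite !expr1 Mz mulr0 leNgt -{1}Mz Ma.
have Mp : 0 < M by rewrite lt_neqAle eq_sym Mz.
set t := a / M - 1.
have t0 : 0 < t by rewrite subr_gt0 ltr_pdivlMr// mul1r.
have aE : a = M * (1 + t) by rewrite /t addrC subrK mulrC divfK.
have bern n : 1 + n%:R * t <= (1 + t) ^+ n.
  elim: n => [|n ih]; first by rewrite mul0r addr0 expr0.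
  rewrite exprS; apply: le_trans (_ : (1 + t) * (1 + n%:R * t) <= _); last first.
    by rewrite ler_wpM2l// addr_ge0// ltW.
  have : 0 <= n%:R * (t * t) by rewrite mulr_ge0// mulr_ge0// ltW.
  by rewrite -natr1; lra.
have Hn n : 1 + n%:R * t <= K.
  apply: le_trans (bern n) _; have := H n.
  by rewrite aE exprMn [K * _]mulrC ler_pM2l// exprn_gt0.
have K1 : 1 <= K by have := Hn 0%N; rewrite mul0r addr0.
have := archi_boundP (divr_ge0 (le_trans ler01 K1) (ltW t0)).
rewrite ltr_pdivrMr// => KB.
by have := Hn (Num.bound (K / t)); lra.
Qed.

(** A factor that vanishes at z makes up for the missing derivative of the
other factor. *)
Lemma derivable_mul_vanishing (p q : Cx R -> Cx R) z : derivable p z 1 -> p z = 0 ->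
  {for z, continuous q} -> derivable (fun w => p w * q w) z 1.
Proof.
move=> /derivableP; set l := 'D_1 p z => /is_derive_nrmP dp pz /continuous_nrmP cq.
suff : is_derive z 1 (fun w => p w * q w) (l * q z) by case.
apply/is_derive_nrmP => e e0.
set Q := nrm (q z) + 1.
have Q0 : 0 < Q by rewrite ltr_wpDl ?nrm_ge0.
have L0 : 0 < nrm l + 1 by rewrite ltr_wpDl ?nrm_ge0.
have [|d1 d10 H1] := dp (e / 2 / Q); first by rewrite !divr_gt0.
have [|d2 d20 H2] := cq (Num.min 1 (e / 2 / (nrm l + 1))).
  by rewrite lt_min ltr01 !divr_gt0.
exists (Num.min d1 d2); first by rewrite lt_min d10.
move=> h; rewrite lt_min => /andP[/H1 {}H1 h2].
have {}H2 := H2 (z + h); rewrite [z + h]addrC addrK in H2; have {}H2 := H2 h2.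
move: H2; rewrite lt_min [h + z]addrC => /andP[k1 k2].
have hn := nrm_ge0 h.
rewrite pz mul0r subr0; rewrite pz subr0 in H1.
have -> : p (z + h) * q (z + h) - l * q z * h =
  (p (z + h) - l * h) * q (z + h) + l * (q (z + h) - q z) * h by ring.
apply: le_trans (nrmD _ _) _; rewrite !nrmM (splitr e) mulrDl; apply: lerD.
  have qQ : nrm (q (z + h)) <= Q.
    have -> : q (z + h) = (q (z + h) - q z) + q z by rewrite subrK.
    by apply: le_trans (nrmD _ _) _; rewrite addrC lerD2l ltW.
  apply: le_trans (ler_pM (nrm_ge0 _) (nrm_ge0 _) H1 qQ) _.
  by rewrite mulrAC divfK// gt_eqF.
rewrite ler_wpM2r//; apply: le_trans (_ : nrm l * (e / 2 / (nrm l + 1)) <= _).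
  by rewrite ler_wpM2l ?nrm_ge0// ltW.
by rewrite mulrCA ler_piMr ?divr_ge0// ?ltW// ltr_pdivrMr// mul1r ltrDl.
Qed.

Lemma continuous_pow f n z : {for z, continuous f} ->
  {for z, continuous (fun w => f w ^+ n)}.
Proof.
move=> cf; elim: n => [|n ih].
  rewrite (_ : (fun w => _) = cst 1); first exact: cst_continuous.
  by apply/funext => w; rewrite expr0.
have -> : (fun w => f w ^+ n.+1) = (fun w => f w * f w ^+ n).
  by apply/funext => w; rewrite exprS.
exact: (continuousM cf ih).
Qed.

Lemma derivable_pow f n z : derivable f z 1 -> derivable (fun w => f w ^+ n) z 1.
Proof.
move=> df; elim: n => [|n ih].
  rewrite (_ : (fun w => _) = cst 1); first exact: derivable_cst.
  by apply/funext => w; rewrite expr0.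
have -> : (fun w => f w ^+ n.+1) = (f * (fun w => f w ^+ n))%R.
  by apply/funext => w; rewrite exprS.
exact: (derivableM df ih).
Qed.

Definition root_prod (E : seq (Cx R)) w : Cx R := \prod_(e <- E) (w - e).

Lemma derivable_root_prod E z : derivable (root_prod E) z 1.
Proof.
elim: E => [|e E ih].
  rewrite (_ : root_prod [::] = cst 1); first exact: derivable_cst.
  by apply/funext => w; rewrite /root_prod big_nil.
rewrite (_ : root_prod (e :: E) = ((id - cst e) * root_prod E)%R).
  apply: derivableM ih; apply: derivableB; [exact: derivable_id|exact: derivable_cst].
by apply/funext => w; rewrite /root_prod big_cons.
Qed.

Lemma root_prod_eq0 E z : (root_prod E z == 0) = (z \in E).
Proof.
rewrite /root_prod; elim: E => [|e E ih]; first by rewrite big_nil oner_eq0.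
by rewrite big_cons mulf_eq0 subr_eq0 ih in_cons.
Qed.

(** With P = [root_prod E], the function P f^n is differentiable everywhere,
so |P(z)| |f(z)|^n is at most a constant times M^n for every n. *)
Lemma disc_center_bound_off (E : seq (Cx R)) f z r rho M : 0 < rho -> rho < r ->
  (forall w, nrm (w - z) < r -> {for w, continuous f}) ->
  (forall w, nrm (w - z) < r -> w \notin E -> derivable f w 1) ->
  z \notin E -> 0 <= M ->
  (forall w, nrm (w - z) = rho -> w \notin E -> nrm (f w) <= M) -> nrm (f z) <= M.
Proof.
move=> rho0 rr cf df zE M0 fM.
set B := \prod_(e <- E) (rho + nrm (z - e)).
have B0 : 0 <= B by apply: prodr_ge0 => e _; rewrite addr_ge0 ?nrm_ge0// ltW.
have PB w : nrm (w - z) = rho -> nrm (root_prod E w) <= B.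
  move=> wz; rewrite /root_prod /B; elim: (E) => [|e s ih]; first by rewrite !big_nil nrm1.
  rewrite !big_cons nrmM ler_pM ?nrm_ge0//.
  by apply: le_trans (nrm_dist_le _ z _) _; rewrite wz.
have P0 : 0 < nrm (root_prod E z) by rewrite nrm_gt0 root_prod_eq0.
apply: (@le_of_powers _ _ (B / nrm (root_prod E z))) => // [|n]; first exact: nrm_ge0.
pose F w := root_prod E w * f w ^+ n.
suff : nrm (F z) <= B * M ^+ n.
  by rewrite /F nrmM nrmX mulrAC ler_pdivlMr// [nrm (f z) ^+ n * _]mulrC.
apply: (@disc_center_bound F z r rho _ rho0 rr) => w wz; rewrite /F.
  have [wE|wE] := boolP (w \in E).
    apply: (@derivable_mul_vanishing (root_prod E) (fun u => f u ^+ n)); first exact: derivable_root_prod.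
      by apply/eqP; rewrite root_prod_eq0.
    by apply: continuous_pow; exact: cf.
  exact: (derivableM (@derivable_root_prod E w) (@derivable_pow f n w (df w wz wE))).
rewrite nrmM nrmX; have [wE|wE] := boolP (w \in E).
  have -> : root_prod E w = 0 by apply/eqP; rewrite root_prod_eq0.
  by rewrite nrm0 mul0r mulr_ge0// exprn_ge0.
rewrite ler_pM ?nrm_ge0 ?exprn_ge0 ?nrm_ge0// ?PB//.
by apply: lerXn2r; rewrite ?nnegrE ?nrm_ge0// fM.
Qed.

(** The difference quotient of f, completed at v so as to be continuous there. *)
Definition slope f v w : Cx R :=
  if w == v then 'D_1 f v else (f w - f v) / (w - v).

Lemma slopeE f v w : f w = f v + (w - v) * slope f v w.
Proof.
rewrite /slope; have [->|wv] := eqVneq w v; first by rewrite subrr mul0r addr0.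
by rewrite mulrC divfK ?subr_eq0// addrC subrK.
Qed.

Lemma slope_near f v w : w != v ->
  \forall u \near w, slope f v u = (f u - f v) * (u - v)^-1.
Proof.
move=> wv; have wv0 : 0 < nrm (w - v) by rewrite nrm_gt0 subr_eq0.
apply/nbhs_nrmP; exists (nrm (w - v)) => // u uw; rewrite /slope ifF//.
by apply/negP => /eqP uv; move: uw; rewrite uv nrm_distC ltxx.
Qed.

Lemma derivable_slope f v w : w != v -> derivable f w 1 -> derivable (slope f v) w 1.
Proof.
move=> wv df.
have dq : derivable ((f - cst (f v)) * (fun u => (u - v)^-1))%R w 1.
  apply: derivableM; first by apply: derivableB; [exact: df|exact: derivable_cst].
  apply: derivableV; first by rewrite subr_eq0.
  by apply: derivableB; [exact: derivable_id|exact: derivable_cst].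
apply: near_eq_derivable dq; apply: filterS (slope_near f wv) => u ->.
by [].
Qed.

Lemma continuous_slope f v w : w != v -> {for w, continuous f} ->
  {for w, continuous (slope f v)}.
Proof.
move=> wv cf.
have cq : {for w, continuous (fun u => (f u - f v) * (u - v)^-1)}.
  have c1 : (f u - f v) @[u --> w] --> f w - f v by exact: (cvgB cf (cvg_cst _)).
  have c2 : (u - v) @[u --> w] --> w - v by exact: (cvgB cvg_id (cvg_cst _)).
  have wv0 : w - v != 0 by rewrite subr_eq0.
  exact: (cvgM c1 (cvgV wv0 c2)).
have sn := slope_near f wv.
apply/(@cvg_nrmP _ _ _ (nbhs_filter w)) => e e0.
move/(@cvg_nrmP _ _ _ (nbhs_filter w)) : cq => /(_ _ e0) cq.
by rewrite (nbhs_singleton sn); apply: filterS2 sn cq => u ->.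
Qed.

Lemma continuous_slope_base f v : derivable f v 1 -> {for v, continuous (slope f v)}.
Proof.
move=> /derivableP/is_derive_nrmP df; apply/continuous_nrmP => e e0.
have e2 : 0 < e / 2 by rewrite divr_gt0.
have [d d0 H] := df _ e2; exists d => // w /H; rewrite [v + _]addrC subrK.
rewrite {2}/slope eqxx (slopeE f v w).
have -> : f v + (w - v) * slope f v w - f v - 'D_1 f v * (w - v) =
  (slope f v w - 'D_1 f v) * (w - v) by ring.
rewrite nrmM; have [->|wv] := eqVneq w v; first by rewrite /slope eqxx subrr nrm0.
rewrite ler_pM2r ?nrm_gt0 ?subr_eq0// => /le_lt_trans; apply.
by rewrite ltr_pdivrMr// ltr_pMr// ltr1n.
Qed.

Lemma continuous_slopeT f v w : {for w, continuous f} -> derivable f v 1 ->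
  {for w, continuous (slope f v)}.
Proof.
move=> cf df; have [->|wv] := eqVneq w v; first exact: continuous_slope_base.
exact: continuous_slope.
Qed.

(** On the circle of radius 5 rho / 2 around z, which stays at distance at least
rho / 2 from v, the quotient is bounded by 2 M / (rho / 2); the maximum principle
carries this bound to z, for the quotient is continuous at v. *)
Lemma slope_bound (E : seq (Cx R)) g c rho M v z : 0 < rho -> 0 <= M ->
  (forall w, nrm (w - c) < 4 * rho -> {for w, continuous g}) ->
  (forall w, nrm (w - c) < 4 * rho -> w \notin E -> derivable g w 1) ->
  (forall w, nrm (w - c) < 4 * rho -> w \notin E -> nrm (g w) <= M) ->
  nrm (v - c) < rho -> nrm (z - c) < rho -> v \notin E -> z \notin E -> z != v ->
  nrm (slope g v z) <= 4 * M / rho.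
Proof.
move=> rho0 M0 cg dg gM vc zc vE zE zv.
have inB w : nrm (w - z) < 3 * rho -> nrm (w - c) < 4 * rho.
  by move=> h; apply: le_lt_trans (nrm_dist_le _ z _) _; lra.
have vB : nrm (v - c) < 4 * rho by lra.
have dgv := dg v vB vE.
apply: (@disc_center_bound_off (v :: E) _ z (3 * rho) (5 / 2 * rho)); try lra.
- by move=> w /inB wB; exact: (continuous_slopeT (cg w wB) dgv).
- move=> w /inB wB; rewrite in_cons negb_or => /andP[wv wE].
  exact: (derivable_slope wv (dg w wB wE)).
- by rewrite in_cons negb_or zv.
- by rewrite divr_ge0 ?mulr_ge0// ltW.
move=> w wz; rewrite in_cons negb_or => /andP[wv wE].
have wB : nrm (w - c) < 4 * rho by apply: inB; rewrite wz; lra.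
rewrite /slope (negbTE wv) nrmM nrmV.
have k1 : nrm (g w - g v) <= 2 * M.
  apply: le_trans (nrmB _ _) _; have := gM w wB wE; have := gM v vB vE; lra.
have k2 : rho / 2 <= nrm (w - v).
  have := nrm_dist_le w v z; have := nrm_dist_le v c z.
  rewrite wz [nrm (c - z)]nrm_distC; lra.
have r2 : 0 < rho / 2 by lra.
apply: le_trans (ler_pM (nrm_ge0 _) _ k1 (_ : _ <= (rho / 2)^-1)) _.
- by rewrite invr_ge0 nrm_ge0.
- by rewrite lef_pV2 ?posrE//; exact: lt_le_trans k2.
by rewrite invfM invrK; lra.
Qed.

End LocalTheory.

(** * Holomorphic functions have holomorphic derivatives *)

Section Regularity.
Variable R : realType.
Implicit Types (z w c v : Cx R) (r rho M : R) (f g : Cx R -> Cx R).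

(** The function t |-> phi t + K t is nondecreasing, so that its infimum is the
limit at 0. *)
Lemma lipschitz_limit (phi : R -> R) (s K : R) : 0 < s -> 0 <= K ->
  (forall t u, 0 < t -> t < s -> 0 < u -> u < s -> `|phi t - phi u| <= K * `|t - u|) ->
  exists l, forall t, 0 < t -> t < s -> `|phi t - l| <= K * t.
Proof.
move=> s0 K0 H.
(* The slope of psi lies between 0 and 2 K. *)
pose psi t := phi t + K * t.
have mono t u : 0 < t -> t <= u -> u < s -> psi t <= psi u.
  move=> t0 tu us; have := H u t (lt_le_trans t0 tu) us t0 (le_lt_trans tu us).
  rewrite (ger0_norm (_ : 0 <= u - t)) ?subr_ge0// ler_norml => /andP[h _].
  by rewrite /psi; lra.
have lowb t u : 0 < t -> t < s -> 0 < u -> u < s -> phi t - K * t <= psi u.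
  move=> t0 ts u0 us; rewrite /psi; have [tu|/ltW ut] := leP t u.
    have := mono t u t0 tu us; have : 0 <= K * t by rewrite mulr_ge0// ltW.
    rewrite /psi; lra.
  have := H t u t0 ts u0 us; rewrite (ger0_norm (_ : 0 <= t - u)) ?subr_ge0// ler_norml => /andP[_ h].
  have : 0 <= K * u by rewrite mulr_ge0// ltW.
  lra.
set S := [set psi t | t in [set t | 0 < t < s]].
exists (inf S) => t t0 ts.
have h1 : inf S <= psi t.
  apply: ge_inf; last by exists t => //=; rewrite t0.
  by exists (phi t - K * t) => _ [u /= /andP[u0 us] <-]; exact: lowb.
have h2 : phi t - K * t <= inf S.
  apply: lb_le_inf; first by exists (psi t); exists t => //=; rewrite t0.
  by move=> _ [u /= /andP[u0 us] <-]; exact: lowb.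
by rewrite ler_norml; apply/andP; split; rewrite /psi in h1; lra.
Qed.

Lemma bounded_near g c r : 0 < r -> {for c, continuous g} ->
  exists rho, [/\ 0 < rho, 4 * rho <= r & forall w, nrm (w - c) < 4 * rho ->
    nrm (g w) <= nrm (g c) + 1].
Proof.
move=> r0 /continuous_nrmP/(_ _ ltr01)[d d0 H].
exists (Num.min d r / 4); rewrite divr_gt0 ?lt_min ?d0//; split => //.
  by rewrite mulrC divfK// ge_min lexx orbT.
move=> w; rewrite mulrC divfK// lt_min => /andP[/H h _].
have -> : g w = (g w - g c) + g c by rewrite subrK.
by apply: le_trans (nrmD _ _) _; rewrite addrC lerD2l ltW.
Qed.

Lemma cvg_slope g c z : z != c -> {for c, continuous g} ->
  slope g v z @[v --> c^'] --> slope g c z.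
Proof.
move=> zc cg.
have cg' : g v @[v --> c^'] --> g c by apply: cvg_within_filter; exact: cg.
have ci : v @[v --> c^'] --> c by exact: cvg_within.
have c1 : (g z - g v) @[v --> c^'] --> g z - g c.
  exact: (cvgB (cvg_cst _) cg').
have c2 : (z - v) @[v --> c^'] --> z - c.
  exact: (cvgB (cvg_cst _) ci).
have zc0 : z - c != 0 by rewrite subr_eq0.
have c3 : (g z - g v) / (z - v) @[v --> c^'] --> (g z - g c) / (z - c).
  exact: (cvgM c1 (cvgV zc0 c2)).
rewrite {2}/slope (negbTE zc).
apply/(@cvg_nrmP _ _ _ (dnbhs_filter c)) => e e0.
have {}c3 := (@cvg_nrmP _ _ _ (dnbhs_filter c) _ _).1 c3 _ e0.
have nz : \forall v \near c^', z != v.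
  have n0 : 0 < nrm (z - c) by rewrite nrm_gt0.
  apply/nbhs_nrmP; exists (nrm (z - c)) => // v vc _.
  by apply/negP => /eqP zv; move: vc; rewrite -zv ltxx.
by apply: filterS2 nz c3 => v zv; rewrite /slope (negbTE zv).
Qed.

(** The quotients [slope g v], for v near c, are bounded by [slope_bound], hence
themselves have bounded quotients: they are Lipschitz with a constant independent
of v. Letting v tend to c, [slope g c] is Lipschitz off c, and has a limit at
c. *)
Lemma removable_singularity g c r : 0 < r ->
  (forall w, nrm (w - c) < r -> {for w, continuous g}) ->
  (forall w, nrm (w - c) < r -> w != c -> derivable g w 1) ->
  derivable g c 1.
Proof.
move=> r0 cg dg.
have cB : nrm (c - c) < r by rewrite subrr nrm0.
have [rho [rho0 rho4 gM]] := bounded_near r0 (cg c cB).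
(* K bounds the quotients of g, and K2 those of the quotients. *)
set M := nrm (g c) + 1 in gM.
have M0 : 0 <= M by rewrite addr_ge0 ?nrm_ge0.
set K := 4 * M / rho.
have K0 : 0 <= K by rewrite divr_ge0 ?mulr_ge0// ltW.
have inr w : nrm (w - c) < 4 * rho -> nrm (w - c) < r by move=> h; lra.
have cg4 w : nrm (w - c) < 4 * rho -> {for w, continuous g} by move=> /inr; exact: cg.
have dg4 w : nrm (w - c) < 4 * rho -> w \notin [:: c] -> derivable g w 1.
  by move=> /inr h; rewrite inE; exact: dg.
have FM v w : nrm (v - c) < rho -> nrm (w - c) < rho -> v != c -> w != c -> w != v ->
    nrm (slope g v w) <= K.
  move=> vc wc v0 w0 wv; have cE u : u != c -> u \notin [:: c] by rewrite inE.
  by apply: (slope_bound rho0 M0 cg4 dg4 _ vc wc (cE v v0) (cE w w0) wv) => u uc _; exact: gM.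
set s := rho / 4.
have s0 : 0 < s by rewrite divr_gt0.
have s4 : 4 * s = rho by rewrite mulrC divfK.
set K2 := 4 * K / s.
have K20 : 0 <= K2 by apply: divr_ge0 (ltW s0); exact: mulr_ge0.
have FK v z w : nrm (v - c) < rho -> v != c -> nrm (z - c) < s -> nrm (w - c) < s ->
    z != c -> w != c -> z != v -> w != v ->
    nrm (slope g v z - slope g v w) <= K2 * nrm (z - w).
  move=> vc v0 zc wc z0 w0 zv wv.
  have [->|zw] := eqVneq z w; first by rewrite !subrr nrm0 mulr0.
  have vB : nrm (v - c) < 4 * rho by lra.
  have vE : v \notin [:: c] by rewrite inE.
  have dgv := dg4 v vB vE.
  have := @slope_bound _ [:: v; c] (slope g v) c s K w z s0 K0.
  rewrite s4 => /(_ _ _ _ wc zc).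
  rewrite !inE !negb_or wv w0 zv z0 zw => H.
  have {}H : nrm (slope (slope g v) w z) <= 4 * K / s.
    apply: H; [move=> u uc|move=> u uc|move=> u uc|by []|by []|by []].
    - have uc4 : nrm (u - c) < 4 * rho by lra.
      exact: (continuous_slopeT (cg4 u uc4) dgv).
    - have uc4 : nrm (u - c) < 4 * rho by lra.
      rewrite !inE negb_or => /andP[uv u0].
      have uE : u \notin [:: c] by rewrite inE.
      exact: (derivable_slope uv (dg4 u uc4 uE)).
    - by rewrite !inE negb_or => /andP[uv u0]; exact: FM.
  rewrite (slopeE (slope g v) w z).
  have -> : forall x y t : Cx R, x + y * t - x = y * t by move=> x y t; ring.
  by rewrite nrmM mulrC ler_wpM2r ?nrm_ge0.
have kK z w : nrm (z - c) < s -> nrm (w - c) < s -> z != c -> w != c ->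
    nrm (slope g c z - slope g c w) <= K2 * nrm (z - w).
  move=> zc wc z0 w0; apply/ler_addgt0Pr => e e0.
  have e2 : 0 < e / 2 by rewrite divr_gt0.
  have n1 := (@cvg_nrmP _ _ _ (dnbhs_filter c) _ _).1 (cvg_slope z0 (cg c cB)) _ e2.
  have n2 := (@cvg_nrmP _ _ _ (dnbhs_filter c) _ _).1 (cvg_slope w0 (cg c cB)) _ e2.
  (* A point v close to c, different from z, w and c, at which both quotients are
     within e / 2 of their limits. *)
  have n3 : \forall v \near c^', [/\ nrm (v - c) < rho, v != c, z != v & w != v].
    have m0 : 0 < Num.min rho (Num.min (nrm (z - c)) (nrm (w - c))).
      by rewrite !lt_min rho0 !nrm_gt0 !subr_eq0 z0.
    apply/nbhs_nrmP; exists (Num.min rho (Num.min (nrm (z - c)) (nrm (w - c)))) => //.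
    move=> v; rewrite !lt_min => /and3P[h1 h2 h3] v0; split => //.
      by apply/negP => /eqP zv; move: h2; rewrite -zv ltxx.
    by apply/negP => /eqP zv; move: h3; rewrite -zv ltxx.
  have [v [[k1 k2 k3 k4] [k5 k6]]] := @filter_ex _ _ (Proper_dnbhs_numFieldType c) _
    (filterI n3 (filterI n1 n2)).
  have -> : slope g c z - slope g c w = (slope g v z - slope g v w)
    - (slope g v z - slope g c z) + (slope g v w - slope g c w) by ring.
  apply: le_trans (nrmD _ _) _; apply: le_trans (lerD (nrmB _ _) (lexx _)) _.
  have := FK v z w k1 k2 zc wc z0 w0 k3 k4; lra.
pose k t := slope g c (c + t%:C).
have kE (t : R) : nrm (c + t%:C - c) = `|t| by rewrite [c + _]addrC addrK nrm_real.
have kn (t : R) : 0 < t -> c + t%:C != c.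
  by move=> t0; rewrite -subr_eq0 -nrm_eq0 kE normr_eq0 gt_eqF.
have kL t u : 0 < t -> t < s -> 0 < u -> u < s -> nrm (k t - k u) <= K2 * `|t - u|.
  move=> t0 ts u0 us.
  have a1 : nrm (c + t%:C - c) < s by rewrite kE gtr0_norm.
  have a2 : nrm (c + u%:C - c) < s by rewrite kE gtr0_norm.
  apply: le_trans (kK _ _ a1 a2 (kn t t0) (kn u u0)) _.
  have -> : c + t%:C - (c + u%:C) = (t - u)%:C by rewrite rmorphB/=; ring.
  by rewrite nrm_real.
have [|l1 H1] := @lipschitz_limit (fun t => complex.Re (k t)) s K2 s0 K20.
  move=> t u t0 ts u0 us; apply: le_trans (kL _ _ t0 ts u0 us).
  by rewrite -Re_opp -Re_add nrm_Re.
have [|l2 H2] := @lipschitz_limit (fun t => complex.Im (k t)) s K2 s0 K20.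
  move=> t u t0 ts u0 us; apply: le_trans (kL _ _ t0 ts u0 us).
  by rewrite -Im_opp -Im_add nrm_Im.
set l : Cx R := (l1 +i* l2)%C.
suff : is_derive c 1 g l by case.
apply/is_derive_nrmP => e e0.
have K1 : 0 < 4 * K2 + 1 by move: K20; clear; lra.
exists (Num.min s (e / (4 * K2 + 1))); first by rewrite lt_min s0 divr_gt0.
move=> h; rewrite lt_min => /andP[hs he]; rewrite ltr_pdivlMr// in he.
have [->|h0] := eqVneq h 0; first by rewrite addr0 mulr0 !subrr nrm0 mulr0.
have hn : 0 < nrm h by rewrite nrm_gt0.
have hc : c + h != c by rewrite -subr_eq0 [c + _]addrC addrK.
rewrite (slopeE g c (c + h)).
have -> : g c + (c + h - c) * slope g c (c + h) - g c - l * h =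
  (slope g c (c + h) - l) * h by ring.
rewrite nrmM ler_pM2r//; apply: le_trans _ (ltW he).
have -> : slope g c (c + h) - l = (slope g c (c + h) - k (nrm h)) + (k (nrm h) - l).
  by ring.
apply: le_trans (nrmD _ _) _.
have t1 : nrm (slope g c (c + h) - k (nrm h)) <= K2 * (2 * nrm h).
  have a1 : nrm (c + h - c) < s by rewrite [c + _]addrC addrK.
  have a2 : nrm (c + (nrm h)%:C - c) < s by rewrite kE gtr0_norm.
  apply: le_trans (kK _ _ a1 a2 hc (kn _ hn)) _.
  apply: ler_wpM2l => //.
  have -> : c + h - (c + (nrm h)%:C) = h - (nrm h)%:C by ring.
  by apply: le_trans (nrmB _ _) _; rewrite nrm_real gtr0_norm//; lra.
have t2 : nrm (k (nrm h) - l) <= 2 * (K2 * nrm h).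
  apply: le_trans (nrm_ReIm _) _; rewrite Re_add Im_add Re_opp Im_opp /=.
  by have := H1 _ hn hs; have := H2 _ hn hs; lra.
lra.
Qed.

Lemma derivable_slope_disc f c r : 0 < r ->
  (forall w, nrm (w - c) < r -> derivable f w 1) ->
  forall w, nrm (w - c) < r -> derivable (slope f c) w 1.
Proof.
move=> r0 df w wr; have cB : nrm (c - c) < r by rewrite subrr nrm0.
have [->|wc] := eqVneq w c; last exact: (derivable_slope wc (df w wr)).
apply: (@removable_singularity _ c r r0) => u ur.
  exact: (continuous_slopeT (derivable_continuousC (df u ur)) (df c cB)).
by move=> uc; exact: (derivable_slope uc (df u ur)).
Qed.

Lemma derive1C f z l : is_derive z 1 f l -> derive1 f z = l.
Proof. by case=> _ <-; rewrite derive1E. Qed.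

Lemma is_derive_derive1 f z : derivable f z 1 -> is_derive z 1 f (derive1 f z).
Proof. by move=> df; split; [exact: df | rewrite derive1E]. Qed.

Lemma is_deriveMC f g z a b : is_derive z 1 f a -> is_derive z 1 g b ->
  is_derive z 1 (fun w => f w * g w) (a * g z + f z * b).
Proof.
move=> df dg; have H := is_deriveM df dg.
have -> : a * g z + f z * b = f z *: b + g z *: a by rewrite addrC [a * _]mulrC.
exact: H.
Qed.

Lemma is_deriveDC f g z a b : is_derive z 1 f a -> is_derive z 1 g b ->
  is_derive z 1 (fun w => f w + g w) (a + b).
Proof. by move=> df dg; exact: (is_deriveD df dg). Qed.

Lemma is_derive_subC z c : is_derive z 1 (fun w => w - c) 1.
Proof.
have := is_deriveDC (is_derive_id z 1) (is_derive_cst (- c) z 1).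
by rewrite addr0.
Qed.

(** Two applications of [derivable_slope_disc] give
f = f(c) + (z - c) b + (z - c)^2 h with h differentiable, so that
f' = b + 2 (z - c) h + (z - c)^2 h'; as h' is bounded near c, the derivative of f'
at c is 2 h(c). *)
Lemma derivable_derive1 f c r : 0 < r ->
  (forall w, nrm (w - c) < r -> derivable f w 1) -> derivable (derive1 f) c 1.
Proof.
move=> r0 df; pose g := slope f c; pose h := slope g c.
have dg := derivable_slope_disc r0 df.
have dh : forall w, nrm (w - c) < r -> derivable h w 1 := derivable_slope_disc r0 dg.
have cB : nrm (c - c) < r by rewrite subrr nrm0.
have fE w : f w = f c + (w - c) * g c + (w - c) * (w - c) * h w.
  by rewrite (slopeE f c w) -/g (slopeE g c w) -/h; ring.
clearbody h; move: (g c) fE => b fE; clear g dg.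
have dfE w : nrm (w - c) < r ->
    derive1 f w = b + 2 * (w - c) * h w + (w - c) * (w - c) * derive1 h w.
  move=> wr; apply: derive1C.
  have fE' : f = fun u => (f c + (u - c) * b) + (u - c) * (u - c) * h u.
    by apply/funext => u; rewrite (fE u).
  have d1 := is_derive_subC w c.
  have d2 := is_deriveMC d1 (is_derive_cst (b) w 1).
  have d3 := is_deriveDC (is_derive_cst (f c) w 1) d2.
  have d4 := is_deriveMC (is_deriveMC d1 d1) (is_derive_derive1 (dh w wr)).
  have d5 := is_deriveDC d3 d4.
  rewrite fE'; move: d5; rewrite /cst.
  by congr is_derive; ring.
have [rho [rho0 rho4 hM]] := bounded_near r0 (derivable_continuousC (dh c cB)).
set M := nrm (h c) + 1 in hM.
have M0 : 0 <= M by rewrite addr_ge0 ?nrm_ge0.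
set K := 4 * M / rho.
have K0 : 0 <= K by rewrite divr_ge0 ?mulr_ge0// ltW.
have inr w : nrm (w - c) < 4 * rho -> nrm (w - c) < r by move=> u; lra.
have hK v w : nrm (v - c) < rho -> nrm (w - c) < rho -> w != v -> nrm (slope h v w) <= K.
  move=> vc wc wv; apply: (slope_bound (E := [::]) rho0 M0 _ _ _ vc wc _ _ wv); [| | |by []|by []].
  - by move=> u /inr uc; exact: (derivable_continuousC (dh u uc)).
  - by move=> u /inr uc _; exact: dh.
  - by move=> u uc _; exact: hM.
have hL v w : nrm (v - c) < rho -> nrm (w - c) < rho -> nrm (h w - h v) <= K * nrm (w - v).
  move=> vc wc; have [->|wv] := eqVneq w v; first by rewrite !subrr nrm0 mulr0.
  rewrite (slopeE h v w).
  have -> : forall x y t : Cx R, x + y * t - x = y * t by move=> x y t; ring.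
  by rewrite nrmM mulrC ler_wpM2r ?nrm_ge0// hK.
have dhK w : nrm (w - c) < rho -> nrm (derive1 h w) <= K.
  move=> wc; apply/ler_addgt0Pr => e e0.
  have wr : nrm (w - c) < r by apply: inr; lra.
  have /is_derive_nrmP/(_ _ e0)[d d0 H] := is_derive_derive1 (dh w wr).
  set t : R := Num.min d (rho - nrm (w - c)) / 2.
  have m0 : 0 < Num.min d (rho - nrm (w - c)) by rewrite lt_min d0 subr_gt0.
  have t0 : 0 < t by rewrite divr_gt0.
  have : t < Num.min d (rho - nrm (w - c)) by rewrite ltr_pdivrMr// ltr_pMr// ltr1n.
  rewrite lt_min => /andP[td tr].
  have nt : nrm (t%:C : Cx R) = t by rewrite nrm_real gtr0_norm.
  have := H t%:C; rewrite nt => /(_ td) {}H.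
  have wt : nrm (w + t%:C - c) < rho.
    have -> : w + t%:C - c = (w - c) + t%:C by ring.
    by apply: le_lt_trans (nrmD _ _) _; rewrite nt; lra.
  have := hL w (w + t%:C) wc wt.
  have -> : w + t%:C - w = t%:C by ring.
  rewrite nt => L.
  rewrite -(ler_pM2r t0) -{1}nt -nrmM.
  have -> : derive1 h w * t%:C = (h (w + t%:C) - h w) -
     (h (w + t%:C) - h w - derive1 h w * t%:C) by ring.
  apply: le_trans (nrmB _ _) _; lra.
suff : is_derive c 1 (derive1 f) (2 * h c) by case.
apply/is_derive_nrmP => e e0.
have K1 : 0 < 3 * K + 1 by move: K0; clear; lra.
exists (Num.min rho (e / (3 * K + 1))); first by rewrite lt_min rho0 divr_gt0.
move=> u; rewrite lt_min ltr_pdivlMr// => /andP[us ue].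
have uc : nrm (c + u - c) < rho by rewrite [c + u]addrC addrK.
have cc : nrm (c - c) < rho by rewrite subrr nrm0.
have ur : nrm (c + u - c) < r by apply: inr; lra.
have -> : derive1 f (c + u) - derive1 f c - 2 * h c * u =
   (2 * (h (c + u) - h c) + u * derive1 h (c + u)) * u.
  rewrite (dfE _ ur) (dfE _ cB).
  by move: (derive1 h (c + u)) (derive1 h c) (h (c + u)) (h c) => p1 p2 p3 p4; ring.
rewrite nrmM ler_wpM2r ?nrm_ge0//; apply: le_trans (nrmD _ _) _.
rewrite !nrmM (_ : nrm 2 = 2); last by rewrite (_ : 2 = 2%:C) ?nrm_real ?rmorph_nat// ger0_norm.
have := hL c (c + u) cc uc; rewrite [c + u - c](_ : _ = u); last by ring.
have : nrm u * nrm (derive1 h (c + u)) <= nrm u * K by rewrite ler_wpM2l ?nrm_ge0// dhK.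
have := nrm_ge0 u; lra.
Qed.

End Regularity.

(** * Identity theorem and maximum principle on the half-plane *)

Section Identity.
Variable R : realType.
Implicit Types (z w c v : Cx R) (r rho M : R) (f g : Cx R -> Cx R).

Lemma real_is_derive (f : R -> R) x l :
  (forall e, 0 < e -> exists2 d, 0 < d &
    forall h : R, `|h| < d -> `|f (x + h) - f x - l * h| <= e * `|h|) ->
  is_derive x 1 f l.
Proof.
move=> H.
suff K : h^-1 *: ((f \o shift x) (h *: 1) - f x) @[h --> 0^'] --> l.
  by split; [apply/cvg_ex; exists l | apply/cvg_lim].
apply/cvgrPdist_lt => e e0; have e2 : 0 < e / 2 by rewrite divr_gt0.
have [d d0 {}H] := H _ e2; apply/nbhs_ballP; exists d => //= h.
rewrite /ball/= sub0r normrN => hd h0.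
have hn : 0 < `|h| by rewrite normr_gt0.
have -> : h^-1 *: (f (h *: 1 + x) - f x) = h^-1 * (f (x + h) - f x).
  by congr (_ * (f _ - _)); rewrite addrC; congr (_ + _); exact: mulr1.
rewrite distrC -(ltr_pM2r hn) -normrM mulrBl mulrAC mulVf// mul1r.
by apply: le_lt_trans (H h hd) _; rewrite ltr_pM2r// ltr_pdivrMr// ltr_pMr// ltr1n.
Qed.

Lemma curve_derive_line f z k (t : R) l : is_derive (z + t%:C * k) 1 f l ->
  curve_derive (fun s => f (z + s%:C * k)) t (l * k).
Proof.
move=> /is_derive_nrmP H.
have K1 : 0 < nrm k + 1 by rewrite ltr_wpDl ?nrm_ge0.
have {}H e : 0 < e -> exists2 d, 0 < d & forall h : R, `|h| < d ->
    nrm (f (z + (t + h)%:C * k) - f (z + t%:C * k) - l * k * h%:C) <= e * `|h|.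
  move=> e0; have [|d d0 {}H] := H (e / (nrm k + 1)); first by rewrite divr_gt0.
  exists (d / (nrm k + 1)); first by rewrite divr_gt0.
  move=> h; rewrite ltr_pdivlMr// => hd; have hk : nrm (h%:C * k) = `|h| * nrm k.
    by rewrite nrmM nrm_real.
  have hk1 : nrm (h%:C * k) <= `|h| * (nrm k + 1) by rewrite hk ler_wpM2l// lerDl.
  have := H _ (le_lt_trans hk1 hd).
  have -> : z + (t + h)%:C * k = z + t%:C * k + h%:C * k by rewrite rmorphD/=; ring.
  have -> : l * k * h%:C = l * (h%:C * k) by ring.
  move=> /le_trans; apply.
  by rewrite mulrAC ler_pdivrMr// -mulrA ler_wpM2l// ltW.
split; apply: real_is_derive => e e0; have [d d0 {}H] := H e e0; exists d => // h hd.
  apply: le_trans (H h hd); apply: le_trans (nrm_Re _).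
  by rewrite !(Re_add, Re_opp, Re_mul (l * k))/= mulr0 subr0.
apply: le_trans (H h hd); apply: le_trans (nrm_Im _).
by rewrite !(Im_add, Im_opp, Im_mul (l * k))/= mulr0 add0r.
Qed.

Lemma derivable_inv_sub v w : w != v -> derivable (fun u => (u - v)^-1) w 1.
Proof.
move=> wv; apply: derivableV; first by rewrite subr_eq0.
by apply: derivableB; [exact: derivable_id|exact: derivable_cst].
Qed.

Lemma derive0_constant f c r : (forall w, nrm (w - c) < r -> is_derive w 1 f 0) ->
  forall w, nrm (w - c) < r -> f w = f c.
Proof.
move=> df w wr; pose k := w - c.
have H t : 0 <= t -> t <= 1 -> curve_derive (fun s => f (c + s%:C * k)) t 0.
  move=> t0 t1; rewrite -[X in curve_derive _ _ X](mul0r k).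
  apply/curve_derive_line/df; rewrite [c + _]addrC addrK nrmM nrm_real ger0_norm//.
  by apply: le_lt_trans wr; rewrite ler_piMl ?nrm_ge0.
have := @curve_mean_value _ 0 1 (fun=> 0) _ 0 ler01 H.
rewrite mul0r => /(_ _)/wrap[]; first by move=> t _ _; rewrite nrm0.
rewrite mul1r mul0r addr0 /k [c + _]addrC subrK => h.
by apply/eqP; rewrite -subr_eq0 -nrm_eq0 eq_le h nrm_ge0.
Qed.

(** As f vanishes near z1, the quotient f / (w - z1)^n is differentiable on the
whole disc. The maximum principle gives |f(z)| <= M (|z - z1| / 4 r)^n for all n,
where |z - z1| < 2 r. *)
Lemma zero_spreads f c r M z1 : 0 < r ->
  (forall w, nrm (w - c) < 8 * r -> derivable f w 1) ->
  (forall w, nrm (w - c) < 8 * r -> nrm (f w) <= M) ->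
  nrm (z1 - c) < r -> (\forall w \near z1, f w = 0) ->
  forall z, nrm (z - c) < r -> f z = 0.
Proof.
move=> r0 df fM z1c z1f z zc.
have [->|zz1] := eqVneq z z1; first exact: (nbhs_singleton z1f).
have inB w : nrm (w - z) < 7 * r -> nrm (w - c) < 8 * r.
  by move=> h; apply: le_lt_trans (nrm_dist_le _ z _) _; lra.
have zz0 : 0 < nrm (z - z1) by rewrite nrm_gt0 subr_eq0.
have zz4 : nrm (z - z1) < 2 * r.
  by have := nrm_dist_le z c z1; rewrite [nrm (c - z1)]nrm_distC; lra.
have M0 : 0 <= M by apply: le_trans (nrm_ge0 (f z)) (fM _ _); lra.
suff H : nrm (f z) <= 0 by apply/eqP; rewrite -nrm_eq0 eq_le H nrm_ge0.
have key n : nrm (f z) * ((nrm (z - z1))^-1) ^+ n <= M * ((4 * r)^-1) ^+ n.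
  pose F w := f w * (w - z1)^-1 ^+ n.
  have -> : nrm (f z) * ((nrm (z - z1))^-1) ^+ n = nrm (F z) by rewrite /F nrmM nrmX nrmV.
  apply: (@disc_center_bound _ F z (7 * r) (6 * r)); try lra.
    move=> w /inB wB; have [->|wz] := eqVneq w z1.
      have d0 : derivable (cst 0 : Cx R -> Cx R) z1 1 by exact: derivable_cst.
      apply: near_eq_derivable d0; apply: filterS z1f => u uf.
      by rewrite /F uf mul0r.
    exact: (derivableM (df w wB) (@derivable_pow _ _ n w (derivable_inv_sub wz))).
  move=> w wz; rewrite /F nrmM nrmX nrmV; apply: ler_pM; rewrite ?nrm_ge0//.
  - by rewrite exprn_ge0// invr_ge0 nrm_ge0.
  - by apply/fM/inB; lra.
  have wz1 : 4 * r <= nrm (w - z1).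
    have := nrm_dist_le w z1 z; rewrite [nrm (z1 - z)]nrm_distC; lra.
  apply: lerXn2r; rewrite ?nnegrE ?invr_ge0 ?nrm_ge0//; first by lra.
  by rewrite lef_pV2 ?posrE//; lra.
have K n : nrm (f z) * 2 ^+ n <= M.
  have := key n; rewrite exprVn ler_pdivrMr ?exprn_gt0// -mulrA -exprMn => /le_trans h.
  have {}h : nrm (f z) <= M * (2^-1) ^+ n.
    apply: h; apply: ler_wpM2l => //; apply: lerXn2r; rewrite ?nnegrE.
    - by rewrite mulr_ge0 ?nrm_ge0// invr_ge0; lra.
    - by rewrite invr_ge0.
    by rewrite mulrC ler_pdivrMr; lra.
  rewrite -ler_pdivlMr ?exprn_gt0//; apply: le_trans h _.
  by rewrite exprVn.
rewrite leNgt; apply/negP => f0.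
have : 2 <= 1 :> R.
  apply: (@le_of_powers _ _ _ (M / nrm (f z))) => // n.
  by rewrite expr1n mulr1 ler_pdivlMr// mulrC.
by rewrite leNgt ltr1n.
Qed.

(** Along the segment from z1 to z2, let T be the supremum of the parameters
near whose point f vanishes. By [zero_spreads] around the point of parameter T, f
also vanishes near the points slightly beyond it, so T = 1. *)
Lemma zero_half_plane f z1 :
  (forall w, 0 < complex.Im w -> derivable f w 1) -> 0 < complex.Im z1 ->
  (\forall w \near z1, f w = 0) -> forall z, 0 < complex.Im z -> f z = 0.
Proof.
move=> df z1H z1f z2 z2H.
pose p (t : R) : Cx R := z1 + t%:C * (z2 - z1).
have pH t : 0 <= t -> t <= 1 -> 0 < complex.Im (p t).
  move=> t0 t1; rewrite /p Im_add Im_mul Im_add Im_opp/= mul0r addr0.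
  set a := complex.Im z1 in z1H *; set b := complex.Im z2 in z2H *.
  have [->|tn] := eqVneq t 0; first by rewrite mul0r addr0.
  have tp : 0 < t by rewrite lt_neqAle eq_sym tn.
  have h1 : 0 < t * b by rewrite mulr_gt0.
  have h2 : 0 <= (1 - t) * a by apply: mulr_ge0 (ltW z1H); lra.
  lra.
have pd s t : nrm (p s - p t) = `|s - t| * nrm (z2 - z1).
  have -> : p s - p t = (s - t)%:C * (z2 - z1) by rewrite /p rmorphB/=; ring.
  by rewrite nrmM nrm_real.
pose S := [set t : R | [/\ 0 <= t, t <= 1 & \forall w \near p t, f w = 0]].
have S0 : S 0 by split; [exact: lexx|exact: ler01|rewrite /p mul0r addr0; exact: z1f].
have Sub : has_ubound S by exists 1 => t [].
have Ssup : has_sup S by split; [exists 0 | exact: Sub].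
set T := sup S.
have T0 : 0 <= T := ub_le_sup Sub S0.
have T1 : T <= 1 by apply: ge_sup => [|t []//]; exists 0.
have TH := pH T T0 T1.
have imB w : nrm (w - p T) < complex.Im (p T) -> 0 < complex.Im w.
  move=> h; have := le_trans (ler_norm _) (nrm_Im (- (w - p T))).
  rewrite nrmN Im_opp Im_add Im_opp; lra.
have [rho [rho0 rho4 fM]] := bounded_near TH (derivable_continuousC (df _ TH)).
(* The disc of radius 8 r = 4 rho, on which f is bounded, lies in the half-plane. *)
pose r := rho / 2.
have r0 : 0 < r by rewrite divr_gt0.
have r8 : 8 * r = 4 * rho by rewrite /r; lra.
have L0 : 0 < nrm (z2 - z1) + 1 by rewrite ltr_wpDl ?nrm_ge0.
have e0 : 0 < r / (nrm (z2 - z1) + 1) by rewrite divr_gt0.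
have small s : `|s - T| < r / (nrm (z2 - z1) + 1) -> nrm (p s - p T) < r.
  rewrite ltr_pdivlMr// pd => h; apply: le_lt_trans h.
  by rewrite ler_wpM2l// lerDl.
have [t St tT] := sup_adherent e0 Ssup; have [t0 t1 tf] := St.
rewrite -/T in tT.
have tT' : t <= T := ub_le_sup Sub St.
have Z z : nrm (z - p T) < r -> f z = 0.
  apply: (@zero_spreads f (p T) r _ (p t) r0 _ _ _ tf).
  - by rewrite r8 => w h; apply/df/imB; lra.
  - by rewrite r8; exact: fM.
  - by apply: small; rewrite ltr_norml; apply/andP; split; lra.
have nearZ s : `|s - T| < r / (nrm (z2 - z1) + 1) -> \forall w \near p s, f w = 0.
  move=> /small h; apply/nbhs_nrmP; exists (r - nrm (p s - p T)); first by rewrite subr_gt0.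
  by move=> w wh; apply: Z; apply: le_lt_trans (nrm_dist_le _ (p s) _) _; lra.
have [T1'|T1'] := ltP T 1; last first.
  have TE : T = 1 by apply/eqP; rewrite eq_le T1.
  have -> : z2 = p T by rewrite TE /p mul1r addrC subrK.
  by apply: Z; rewrite subrr nrm0.
pose u := Num.min 1 (T + r / (nrm (z2 - z1) + 1) / 2).
have uT : T < u by rewrite lt_min T1'/= ltrDl divr_gt0.
have uS : S u.
  split; [by rewrite ltW// (le_lt_trans T0)|by rewrite ge_min lexx|].
  apply: nearZ; rewrite gtr0_norm ?subr_gt0//.
  have : u <= T + r / (nrm (z2 - z1) + 1) / 2 by rewrite ge_min lexx orbT.
  move: e0; set e := r / _; lra.
by have := ub_le_sup Sub uS; rewrite leNgt uT.
Qed.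

Lemma mul_eq0_half_plane f g z0 :
  (forall w, 0 < complex.Im w -> derivable f w 1) ->
  (forall w, 0 < complex.Im w -> derivable g w 1) ->
  (forall w, 0 < complex.Im w -> f w * g w = 0) ->
  0 < complex.Im z0 -> f z0 != 0 -> forall w, 0 < complex.Im w -> g w = 0.
Proof.
move=> df dg fg z0H f0.
apply: (@zero_half_plane g z0 dg z0H).
have n0 : 0 < nrm (f z0) by rewrite nrm_gt0.
have /continuous_nrmP/(_ _ n0)[d d0 H] := derivable_continuousC (df _ z0H).
apply/nbhs_nrmP; exists (Num.min d (complex.Im z0)); first by rewrite lt_min d0.
move=> w; rewrite lt_min => /andP[/H h wH].
have wI : 0 < complex.Im w.
  have := le_trans (ler_norm _) (nrm_Im (- (w - z0))).
  rewrite nrmN Im_opp Im_add Im_opp; lra.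
have := fg w wI => /eqP; rewrite mulf_eq0 => /orP[/eqP fw|/eqP//].
by move: h; rewrite fw sub0r nrmN ltxx.
Qed.

(** By [disc_max_constant] f is constant on a disc around z0, and the identity
theorem applies to f - f(z0). *)
Lemma max_half_plane f z0 :
  (forall w, 0 < complex.Im w -> derivable f w 1) -> 0 < complex.Im z0 ->
  (forall w, 0 < complex.Im w -> nrm (f w) <= nrm (f z0)) ->
  forall w, 0 < complex.Im w -> f w = f z0.
Proof.
move=> df z0H fM w wH; apply/eqP; rewrite -subr_eq0; apply/eqP.
have imB u : nrm (u - z0) < complex.Im z0 -> 0 < complex.Im u.
  move=> h; have := le_trans (ler_norm _) (nrm_Im (- (u - z0))).
  rewrite nrmN Im_opp Im_add Im_opp; lra.
have df' (u : Cx R) : 0 < complex.Im u -> derivable (fun u => f u - f z0) u 1.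
  move=> uH.
  by have [] := is_deriveDC (is_derive_derive1 (df u uH)) (is_derive_cst (- f z0) u 1).
apply: (zero_half_plane df' z0H _ wH).
apply/nbhs_nrmP; exists (complex.Im z0); first exact: z0H.
move=> u uB; rewrite (@disc_max_constant _ f z0 (complex.Im z0) _ _ u uB) ?subrr//.
- by move=> v /imB; exact: df.
- by move=> v /imB; exact: fM.
Qed.

End Identity.

(** * Finitely supported sums over integers *)

Section FiniteSums.
Variable V : nmodType.

Lemma sum_iota (m : nat) (f : nat -> V) : \sum_(s <- iota 0 m) f s = \sum_(s < m) f s.
Proof. by rewrite -(big_mkord xpredT f) /index_iota subn0. Qed.

Lemma fsum_window (lo : int) (m : nat) (f : int -> V) :
  (forall i, i < lo -> f i = 0) -> (forall i, lo + m%:Z <= i -> f i = 0) ->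
  \sum_(i \in [set: int]) f i = \sum_(s < m) f (lo + s%:Z).
Proof.
move=> flo fhi.
rewrite (@fsbigE _ 0 +%R _ _ [seq lo + s%:Z | s <- iota 0 m] f) //.
- under eq_bigl do rewrite in_setT.
  by rewrite big_map sum_iota.
- by rewrite map_inj_uniq ?iota_uniq// => x y /addrI[].
move=> i _ ir; have [/flo//|lo_i] := ltP i lo; apply: fhi.
rewrite leNgt; apply: contra ir => i_hi; apply/mapP.
exists (absz (i - lo)%R); last by lia.
by rewrite mem_iota; lia.
Qed.

Lemma fsum_nat_window (m : nat) (f : nat -> V) : (forall n, (m <= n)%N -> f n = 0) ->
  \sum_(n \in [set: nat]) f n = \sum_(n < m) f n.
Proof.
move=> fm; rewrite (@fsbigE _ 0 +%R _ _ (iota 0 m) f) //.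
- under eq_bigl do rewrite in_setT.
  by rewrite sum_iota.
- by rewrite iota_uniq.
by move=> n _; rewrite mem_iota add0n /= -leqNgt => /fm.
Qed.

End FiniteSums.

Lemma binz_pascal (i : int) (n : nat) : binz (i + 1) n.+1 = binz i n.+1 + binz i n.
Proof.
case: i => [m|[|m]].
- by rewrite (_ : Posz m + 1 = m.+1%:Z) /=; [rewrite binS PoszD|lia].
- by rewrite /= !add0n !binn bin0n /= exprS; ring.
have -> : Negz m.+1 + 1 = Negz m by lia.
rewrite /=.
rewrite !addSn !addnS (binS (m + n).+1) PoszD exprS; ring.
Qed.

Lemma binz0 i : binz i 0 = 1.
Proof. by case: i => m /=; rewrite ?addn0 bin0 ?expr0. Qed.

(** * Pseudodifferential operators over a differential ring *)

Section DifferentialRing.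
Variables (S : comPzRingType) (d : {additive S -> S}).
Hypothesis dM : forall x y, d (x * y) = d x * y + x * d y.
Implicit Types (a b x : psido S) (i k M N : int) (u v : S).

Definition bounded_order a := exists N, order_le a N.

(** Left multiplication by D. *)
Definition left_D x : psido S := fun k => x (k - 1) + d (x k).

Definition left_uD u x : psido S := fun k => u * left_D x k.

(** Left multiplication by D^i, written out. For i < 0 it is the expansion of the
inverse of [left_D]. *)
Definition left_power i x : psido S := fun k =>
  \sum_(n \in [set: nat]) (binz i n)%:~R * iter n d (x (k - i + n%:Z)).

(** The sum of the gamma(a_i) P_i. It covers both the product of operators, with
P_i = D^i b, and the substitution of u D for D, with P_i = (u D)^i. *)
Definition expand (gamma : S -> S) (P : int -> psido S) a : psido S := fun k =>
  \sum_(i \in [set: int]) gamma (a i) * P i k.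

Lemma iter_d0 n : iter n d 0 = 0.
Proof. by elim: n => //= n ->; rewrite raddf0. Qed.

Lemma d_intmul (z : int) y : d (z%:~R * y) = z%:~R * d y.
Proof. by rewrite !mulrzl raddfMz. Qed.

Lemma d1 : d 1 = 0.
Proof. by apply: (addrI (d 1)); rewrite addr0 -{3}[1]mulr1 dM mul1r mulr1. Qed.

Lemma left_power_window x N i k (m : nat) : order_le x N -> N - k + i < m%:Z ->
  left_power i x k = \sum_(n < m) (binz i n)%:~R * iter n d (x (k - i + n%:Z)).
Proof.
move=> xN mN; apply: fsum_nat_window => n mn.
by rewrite xN ?iter_d0 ?mulr0//; lia.
Qed.

Lemma order_left_power x N i : order_le x N -> order_le (left_power i x) (i + N).
Proof.
by move=> xN k kN; rewrite (left_power_window (m := 0) xN) ?big_ord0//; lia.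
Qed.

Lemma left_power0 x : bounded_order x -> left_power 0 x = x.
Proof.
move=> [N xN]; apply/funext => k.
rewrite (left_power_window (m := (absz (N - k)%R).+1) xN); last lia.
rewrite big_ord_recl -[nat_of_ord ord0]/0%N binz0 mul1r subr0 addr0 big1 ?addr0// => n _.
by rewrite /= /bump /= mul0r.
Qed.

(** Pascal's rule for the coefficients [binz]. *)
Lemma left_powerS x i : bounded_order x ->
  left_power (i + 1) x = left_D (left_power i x).
Proof.
move=> [N xN]; apply/funext => k; rewrite /left_D.
have [m mN] : exists m : nat, N - k + i < m%:Z by exists (absz (N - k + i)%R).+1; lia.
rewrite (left_power_window (m := m.+1) xN); last lia.
rewrite (left_power_window (m := m.+1) xN); last lia.
rewrite (left_power_window (m := m) xN); last lia.
rewrite raddf_sum !big_ord_recl -[nat_of_ord ord0]/0%N !binz0 -[RHS]addrA; congr (_ + _).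
  by rewrite !mul1r /=; congr (x _); lia.
rewrite -big_split /=; apply: eq_bigr => n _.
rewrite /bump /= add1n binz_pascal rmorphD mulrDl /= d_intmul.
by congr (_ * d (iter n d (x _)) + _ * d (iter n d (x _))); lia.
Qed.

(** The coefficients of D x determine those of x downwards from its order. *)
Lemma left_D_inj x y : bounded_order x -> bounded_order y ->
  left_D x = left_D y -> x = y.
Proof.
move=> [N xN] [N' yN] E.
have H n k : N - n%:Z < k -> N' - n%:Z < k -> x k = y k.
  elim: n k => [|n ih] k k1 k2; first by rewrite xN ?yN//; lia.
  have := congr1 (@^~ (k + 1)) E; rewrite /left_D.
  by rewrite (ih (k + 1)) ?addrK => [/addIr//||]; lia.
by apply/funext => k; apply: (H ((absz (N - k)%R).+1 + (absz (N' - k)%R).+1)%N); lia.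
Qed.

(** For operators of bounded order, each coefficient of [expand] is a finite sum
over any window of integers that is large enough. *)
Lemma expand_window gamma P a k M N (lo : int) (m : nat) :
  gamma 0 = 0 -> order_le a M -> (forall i, order_le (P i) (i + N)) ->
  lo <= k - N -> M < lo + m%:Z ->
  expand gamma P a k = \sum_(s < m) gamma (a (lo + s%:Z)) * P (lo + s%:Z) k.
Proof.
move=> g0 aM PN lok mM; apply: fsum_window => i ilo.
  by rewrite PN ?mulr0//; lia.
by rewrite aM ?g0 ?mul0r//; lia.
Qed.

Lemma order_expand gamma P a M N : gamma 0 = 0 -> order_le a M ->
  (forall i, order_le (P i) (i + N)) -> order_le (expand gamma P a) (M + N).
Proof.
move=> g0 aM PN k kMN.
rewrite (expand_window (lo := k - N) (m := 0) g0 aM PN) ?big_ord0//; lia.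
Qed.

(** Leibniz' rule turns D (gamma(a_i) P_i) into gamma(a_i) (D P_i) plus
D(gamma(a_i)) P_i; reindexing the first sum gives the coefficients of D a. *)
Lemma expand_left_D (gamma : {additive S -> S}) u P a N :
  (forall y, u * d (gamma y) = gamma (d y)) ->
  (forall i, order_le (P i) (i + N)) -> (forall i, P (i + 1) = left_uD u (P i)) ->
  bounded_order a -> expand gamma P (left_D a) = left_uD u (expand gamma P a).
Proof.
move=> ug PN PS [M aM]; apply/funext => k; have g0 := raddf0 gamma.
have LaM : order_le (left_D a) (M + 1).
  by move=> i iM; rewrite /left_D !aM ?raddf0 ?addr0//; lia.
have [m0 m0P] : exists m0 : nat, M + N - k + 3 < m0%:Z.
  by exists (absz (M + N - k + 3)%R).+1; lia.
(* The window extends one step beyond the supports on both sides, so that the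
   shift of the summation index loses no term. *)
pose lo := k - N - 1; pose m := m0.+1.
rewrite (expand_window (lo := lo) (m := m) g0 LaM PN); [|rewrite /lo; lia|rewrite /lo /m; lia].
rewrite /left_uD /left_D.
rewrite (expand_window (lo := lo) (m := m) g0 aM PN); [|rewrite /lo; lia|rewrite /lo /m; lia].
rewrite (expand_window (lo := lo) (m := m) g0 aM PN); [|rewrite /lo; lia|rewrite /lo /m; lia].
rewrite raddf_sum -big_split /= mulr_sumr.
transitivity (\sum_(s < m) (gamma (a (lo + s%:Z - 1)) * P (lo + s%:Z) k
   + gamma (d (a (lo + s%:Z))) * P (lo + s%:Z) k)).
  by apply: eq_bigr => s _; rewrite raddfD mulrDl.
transitivity (\sum_(s < m) (gamma (a (lo + s%:Z)) * P (lo + s%:Z + 1) k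
   + gamma (d (a (lo + s%:Z))) * P (lo + s%:Z) k)); last first.
  by apply: eq_bigr => s _; rewrite dM PS /left_uD /left_D -ug; ring.
rewrite !big_split /=; congr (_ + _).
rewrite big_ord_recl [in RHS]big_ord_recr /=.
rewrite PN ?mulr0 ?add0r; last by rewrite /lo; lia.
rewrite [a (lo + _)]aM ?g0 ?mul0r ?addr0; last by rewrite /lo /m; lia.
by apply: eq_bigr => s _; rewrite /bump /=; congr (gamma (a _) * P _ _); lia.
Qed.

(** Exchange of two sums. *)
Lemma expand_expand (gamma gamma' : {additive S -> S}) P P' a N N' :
  (forall x y : S, gamma (x * y) = gamma x * gamma y) -> bounded_order a ->
  (forall i, order_le (P i) (i + N)) -> (forall i, order_le (P' i) (i + N')) ->
  expand gamma P (expand gamma' P' a) =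
  expand (gamma \o gamma') (fun i => expand gamma P (P' i)) a.
Proof.
move=> gM [M aM] PN PN'; apply/funext => k.
have g0 := raddf0 gamma; have g0' := raddf0 gamma'.
have aE := order_expand g0' aM PN'.
have g00 : (gamma \o gamma') 0 = 0 by rewrite /= g0' g0.
have PE i : order_le (expand gamma P (P' i)) (i + (N + N')).
  by move=> j ji; apply: (order_expand g0 (PN' i) PN); lia.
pose lo := k - N; pose lo' := k - N - N'.
pose m := (absz (M + N + N' - k)%R).+1.
rewrite (expand_window (lo := lo) (m := m) g0 aE PN); [|rewrite /lo; lia|rewrite /lo /m; lia].
rewrite (expand_window (lo := lo') (m := m) g00 aM PE); [|rewrite /lo'; lia|rewrite /lo' /m; lia].
transitivity (\sum_(s < m) \sum_(t < m)
   gamma (gamma' (a (lo' + t%:Z))) * gamma (P' (lo' + t%:Z) (lo + s%:Z)) * P (lo + s%:Z) k).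
  apply: eq_bigr => s _.
  rewrite (expand_window (lo := lo') (m := m) g0' aM PN'); [|rewrite /lo' /lo; lia|rewrite /lo' /m; lia].
  by rewrite raddf_sum mulr_suml; apply: eq_bigr => t _; rewrite gM.
rewrite exchange_big; apply: eq_bigr => t _ /=.
rewrite (expand_window (lo := lo) (m := m) g0 (PN' _) PN); [|rewrite /lo; lia|]; last first.
  by case: t => t /= tm; rewrite /lo' /lo; lia.
by rewrite mulr_sumr; apply: eq_bigr => s _; rewrite mulrA.
Qed.

(** The pairs (i, j) of the definition are enumerated by i and by the number
i + j - k of derivations. *)
Lemma psido_mul_expand a b : bounded_order a -> bounded_order b ->
  psido_mul d a b = expand idfun (fun i => left_power i b) a.
Proof.
move=> [M aM] [N bN]; apply/funext => k.
have [m mP] : exists m : nat, M + N - k < m%:Z by exists (absz (M + N - k)%R).+1; lia.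
pose lo := k - N.
rewrite (expand_window (M := M) (N := N) (lo := lo) (m := m)) ?/lo //; last 2 first.
- by move=> i; exact: order_left_power.
- by lia.
rewrite -/lo /psido_mul.
pose r := [seq (lo + s%:Z, k - (lo + s%:Z) + n%:Z) | s <- iota 0 m, n <- iota 0 m].
have rP p : p \in r -> exists s n : nat, [/\ (s < m)%N, (n < m)%N &
    p = (lo + s%:Z, k - (lo + s%:Z) + n%:Z)].
  by move=> /allpairsP[[s n] /= [hs hn ->]]; exists s, n; rewrite !mem_iota in hs hn; split.
rewrite (@fsbigE _ 0 +%R _ _ r).
- transitivity (\sum_(p <- r) (binz p.1 (absz (p.1 + p.2 - k)%R))%:~R *
    (a p.1 * iter (absz (p.1 + p.2 - k)%R) d (b p.2))).
    rewrite big_seq_cond [RHS]big_seq; apply: eq_bigl => p.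
    have [pr|//] := boolP (p \in r); rewrite /= mem_set//=.
    by have [s [n [_ _ ->]]] := rP p pr; rewrite /=; lia.
  rewrite /r big_allpairs_dep sum_iota; apply: eq_bigr => s _.
  rewrite sum_iota (left_power_window (m := m) bN); last first.
    by case: s => s /= sm; rewrite /lo; lia.
  rewrite mulr_sumr; apply: eq_bigr => n _ /=.
  have -> : absz (lo + s%:Z + (k - (lo + s%:Z) + n%:Z) - k)%R = n by lia.
  by rewrite mulrCA.
- rewrite allpairs_uniq ?iota_uniq// => -[s n] [s' n'] _ _ /= [/addrI[->]].
  by move=> /addrI[->].
- by move=> p /rP[s [n [_ _ ->]]] /=; lia.
move=> [i j] /= kij; have [iM|/aM->] := leP i M; last by rewrite mul0r mulr0.
have [jN|/bN->] := leP j N; last by rewrite iter_d0 !mulr0.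
move=> /allpairsP[]; exists (absz (i - lo)%R, absz (i + j - k)%R) => /=.
by rewrite !mem_iota /lo; split; [lia|lia|congr pair; lia].
Qed.

End DifferentialRing.

(** * Substituting a multiple of the derivation for the derivation *)

Section Substitution.
Variables (S : comPzRingType) (d : {additive S -> S}).
Hypothesis dM : forall x y, d (x * y) = d x * y + x * d y.
Implicit Types (a b x y : psido S) (i k M N : int).

Lemma order_bounded x N : order_le x N -> bounded_order x.
Proof. by exists N. Qed.

Lemma order_mono (c : S) n : order_le (psido_mono c n) n.
Proof. by move=> i ni; rewrite /psido_mono gt_eqF. Qed.

Lemma order_left_D x N : order_le x N -> order_le (left_D d x) (N + 1).
Proof. by move=> xN i iN; rewrite /left_D !xN ?raddf0 ?addr0//; lia. Qed.

Lemma order_left_uD (u : S) x N : order_le x N -> order_le (left_uD d u x) (N + 1).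
Proof. by move=> xN i iN; rewrite /left_uD (order_left_D xN)// mulr0. Qed.

Lemma left_uD1 x : left_uD d 1 x = left_D d x.
Proof. by apply/funext => k; rewrite /left_uD mul1r. Qed.

Lemma expand_mono (gamma : S -> S) (P : int -> psido S) (c : S) n k : gamma 0 = 0 ->
  expand gamma P (psido_mono c n) k = gamma c * P n k.
Proof.
move=> g0; rewrite /expand (fsum_window (lo := n) (m := 1)).
- by rewrite big_ord1 addr0 /psido_mono eqxx.
- by move=> i ni; rewrite /psido_mono lt_eqF// g0 mul0r.
- by move=> i ni; rewrite /psido_mono gt_eqF ?g0 ?mul0r//; lia.
Qed.

Lemma psido_mul_mono (c : S) n x k : bounded_order x ->
  psido_mul d (psido_mono c n) x k = c * left_power d n x k.
Proof.
move=> xB; rewrite (psido_mul_expand d (order_bounded (@order_mono c n)) xB).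
by rewrite expand_mono.
Qed.

Lemma order_psido_mul a b M N : order_le a M -> order_le b N ->
  order_le (psido_mul d a b) (M + N).
Proof.
move=> aM bN; rewrite (psido_mul_expand d (order_bounded aM) (order_bounded bN)).
by apply: order_expand => // i; exact: order_left_power.
Qed.

Lemma psido_mul1 x : bounded_order x -> psido_mul d (psido_one S) x = x.
Proof.
by move=> xB; apply/funext => k; rewrite psido_mul_mono// mul1r left_power0.
Qed.

Lemma psido_mul_D u x : bounded_order x ->
  psido_mul d (psido_mono u 1) x = left_uD d u x.
Proof.
move=> xB; apply/funext => k; rewrite psido_mul_mono// /left_uD.
by rewrite -[1]add0r left_powerS// left_power0.
Qed.

Lemma psido_mul_left_D a b : bounded_order a -> bounded_order b ->
  psido_mul d (left_D d a) b = left_D d (psido_mul d a b).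
Proof.
move=> [M aM] [N bN]; have aB := order_bounded aM; have bB := order_bounded bN.
rewrite (psido_mul_expand d (order_bounded (order_left_D aM)) bB).
rewrite (psido_mul_expand d aB bB) -[RHS]left_uD1.
apply: (@expand_left_D S d dM idfun 1 _ a N) => //.
- by move=> y; rewrite mul1r.
- by move=> i; exact: order_left_power.
- by move=> i; rewrite left_uD1 left_powerS.
Qed.

Lemma psido_mul_scale (c : S) a b : bounded_order a -> bounded_order b ->
  psido_mul d (fun k => c * a k) b = fun k => c * psido_mul d a b k.
Proof.
move=> [M aM] [N bN]; have aB := order_bounded aM; have bB := order_bounded bN.
have caM : order_le (fun k => c * a k) M by move=> i iM; rewrite aM ?mulr0.
rewrite (psido_mul_expand d (order_bounded caM) bB) (psido_mul_expand d aB bB).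
apply/funext => k.
have LP i : order_le (left_power d i b) (i + N) by exact: order_left_power.
have [m mP] : exists m : nat, M + N - k < m%:Z by exists (absz (M + N - k)%R).+1; lia.
rewrite (expand_window (lo := k - N) (m := m) _ caM LP)//; last lia.
rewrite (expand_window (lo := k - N) (m := m) _ aM LP)//; last lia.
by rewrite mulr_sumr; apply: eq_bigr => s _; rewrite /= mulrA.
Qed.

Lemma psido_mul_left_uD u a b : bounded_order a -> bounded_order b ->
  psido_mul d (left_uD d u a) b = left_uD d u (psido_mul d a b).
Proof.
move=> [M aM] bB; have aB := order_bounded aM.
by rewrite psido_mul_scale ?psido_mul_left_D//; exact: order_bounded (order_left_D aM).
Qed.

Variables (u v : S).
Hypothesis uv : u * v = 1.

Let P := psido_pow d u v.

Lemma left_uD_inj x y : bounded_order x -> bounded_order y ->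
  left_uD d u x = left_uD d u y -> x = y.
Proof.
move=> xB yB E; apply: (@left_D_inj S d _ _ xB yB); apply/funext => k.
have := congr1 (fun f => v * f k) E; rewrite /left_uD /= !mulrA [v * u]mulrC uv.
by rewrite !mul1r.
Qed.

(** Going down uses that multiplication by u D is injective. *)
Lemma recurrence_unique (Q Q' : int -> psido S) :
  (forall i, bounded_order (Q i)) -> (forall i, bounded_order (Q' i)) ->
  (forall i, Q (i + 1) = left_uD d u (Q i)) ->
  (forall i, Q' (i + 1) = left_uD d u (Q' i)) -> Q 0 = Q' 0 -> Q = Q'.
Proof.
move=> QB QB' QS QS' Q0; apply/funext => -[n|n].
  elim: n => // n ih; have -> : Posz n.+1 = Posz n + 1 by lia.
  by rewrite QS ih QS'.
elim: n => [|n ih]; apply: left_uD_inj; rewrite // -QS -QS'.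
  by have -> : Negz 0 + 1 = 0 by lia.
by have -> : Negz n.+1 + 1 = Negz n by lia.
Qed.

Let W := psido_mul d (psido_mono 1 (-1)) (psido_mono v 0).

Lemma order_inverse_factor : order_le W (-1).
Proof.
by rewrite -[X in order_le _ X]addr0; apply: order_psido_mul; exact: order_mono.
Qed.

(** The operator D^(-1) v is a right inverse of u D, as D D^(-1) v = v. *)
Lemma inverse_factorK x : bounded_order x -> left_uD d u (psido_mul d W x) = x.
Proof.
move=> xB; have WB := order_bounded order_inverse_factor.
have LW : left_D d W = psido_mono v 0.
  have B1 := order_bounded (@order_mono 1 (-1)).
  have B2 := order_bounded (@order_mono v 0).
  rewrite -(psido_mul_left_D B1 B2).
  have -> : left_D d (psido_mono 1 (-1)) = psido_one S.
    apply/funext => k; rewrite /left_D /psido_one /psido_mono.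
    have -> : (k - 1 == -1) = (k == 0) by lia.
    by case: (k == -1); rewrite ?(d1 dM) ?raddf0 addr0.
  by rewrite psido_mul1.
apply/funext => k; rewrite /left_uD -psido_mul_left_D// LW psido_mul_mono//.
by rewrite left_power0// mulrA uv mul1r.
Qed.

Lemma order_psido_pow i : order_le (P i) i.
Proof.
case: i => n.
  elim: n => [|n ih]; first exact: order_mono.
  have -> : P n.+1 = psido_mul d (psido_mono u 1) (P n) by [].
  rewrite psido_mul_D; last exact: order_bounded ih.
  have -> : Posz n.+1 = Posz n + 1 by lia.
  exact: order_left_uD.
elim: n => [|n ih].
  rewrite -[X in order_le _ X]addr0; apply: order_psido_mul; last exact: order_mono.
  exact: order_inverse_factor.
rewrite [X in order_le _ X](_ : _ = -1 + Negz n); last by lia.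
exact: (order_psido_mul order_inverse_factor ih).
Qed.

Lemma psido_pow_bounded i : bounded_order (P i).
Proof. exact: order_bounded (@order_psido_pow i). Qed.

Lemma psido_powS i : P (i + 1) = left_uD d u (P i).
Proof.
case: i => n.
  have -> : Posz n + 1 = Posz n.+1 by lia.
  by rewrite -psido_mul_D//; exact: psido_pow_bounded (Posz n).
case: n => [|n].
  have -> : Negz 0 + 1 = 0 by lia.
  by rewrite [RHS]inverse_factorK//; exact: order_bounded (@order_mono 1 0).
have -> : Negz n.+1 + 1 = Negz n by lia.
by rewrite [RHS]inverse_factorK//; exact: psido_pow_bounded (Negz n).
Qed.

Variable gamma : {rmorphism S -> S}.
Hypothesis gammaD : forall y : S, u * d (gamma y) = gamma (d y).

Let T := expand gamma P.

Lemma order_substitution a N : order_le a N -> order_le (T a) N.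
Proof.
move=> aN; rewrite -[N]addr0; apply: order_expand => //; first exact: rmorph0.
by move=> i; rewrite addr0; exact: order_psido_pow.
Qed.

(** Both sides are sums of gamma(a_i) Q_i, with Q_i = T (D^i b) on the left and
Q_i = (u D)^i (T b) on the right. *)
Lemma substitution_mul a b : bounded_order a -> bounded_order b ->
  T (psido_mul d a b) = psido_mul d (T a) (T b).
Proof.
move=> [M aM] [N bN]; have aB := order_bounded aM; have bB := order_bounded bN.
have TaB := order_bounded (order_substitution aM).
have TbN := order_substitution bN; have TbB := order_bounded TbN.
have P0 i : order_le (P i) (i + 0) by rewrite addr0; exact: order_psido_pow.
have LP c K i : order_le c K -> order_le (left_power d i c) (i + K).
  by move=> cK; exact: order_left_power.
have EQ := @expand_expand S gamma idfun P (fun i => left_power d i b) a 0 N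
  (rmorphM gamma) aB P0 (fun i => LP b N i bN).
have EQ' := @expand_expand S idfun gamma (fun i => left_power d i (T b)) P a N 0
  (fun _ _ => erefl) aB (fun i => LP (T b) N i TbN) P0.
rewrite (psido_mul_expand d TaB TbB) (psido_mul_expand d aB bB) /T EQ -/T EQ'.
apply: (congr1 (fun F => expand gamma F a)).
apply: recurrence_unique.
- move=> i; exists (i + N); apply: order_substitution; exact: order_left_power.
- move=> i; rewrite -(psido_mul_expand d (psido_pow_bounded i) TbB).
  exact: (order_bounded (order_psido_mul (@order_psido_pow i) TbN)).
- move=> i; rewrite left_powerS//.
  apply: (expand_left_D dM gammaD P0 psido_powS).
  exact: (order_bounded (LP b N i bN)).
- move=> i; rewrite -!(psido_mul_expand d (psido_pow_bounded _) TbB).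
  by rewrite psido_powS psido_mul_left_uD//; exact: psido_pow_bounded.
rewrite left_power0// -(psido_mul_expand d (psido_pow_bounded _) TbB).
by rewrite psido_mul1.
Qed.

End Substitution.

(** * The differential ring of holomorphic functions on the half-plane *)

Section Holomorphic.
Variable R : realType.
Local Notation H := (halfplane R).
Implicit Types (f h : hfun R) (z : H) (w l : Cx R).

Lemma extend_val f z : extend f (val z) = f z.
Proof. by rewrite /extend valK. Qed.

Lemma extendE f w (wH : 0 < complex.Im w) : extend f w = f (exist _ w wH).
Proof. by rewrite -(extend_val f (exist _ w wH)). Qed.

Lemma im_gt0_near z : \forall w \near val z, 0 < complex.Im w.
Proof.
apply/nbhs_nrmP; exists (complex.Im (val z)); first exact: (valP z).
move=> w h; have := le_trans (ler_norm _) (nrm_Im (- (w - val z))).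
rewrite nrmN Im_opp Im_add Im_opp; lra.
Qed.

(** A function on the half-plane is differentiated through any function of a
complex variable that agrees with it there. *)
Lemma is_derive_extend f (F : Cx R -> Cx R) z l : (forall z', f z' = F (val z')) ->
  is_derive (val z) 1 F l -> is_derive (val z) 1 (extend f) l.
Proof.
move=> fF dF; apply: near_eq_is_derive dF.
apply: filterS (im_gt0_near z) => w wH; by rewrite (extendE f wH) fF.
Qed.

Lemma dtauE f z l : is_derive (val z) 1 (extend f) l -> dtau f z = l.
Proof. by move=> h; rewrite /dtau (derive1C h). Qed.

Lemma is_derive_dtau f z : hol f -> is_derive (val z) 1 (extend f) (dtau f z).
Proof. by move=> hf; exact: (is_derive_derive1 (hf z)). Qed.

Lemma hol_derivable f w : hol f -> 0 < complex.Im w -> derivable (extend f) w 1.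
Proof. by move=> hf wH; exact: (hf (exist _ w wH)). Qed.

Lemma extendD f h : extend (f + h) = (fun w => extend f w + extend h w).
Proof. by apply/funext => w; rewrite /extend; case: insub => //=; rewrite addr0. Qed.

Lemma extendM f h : extend (f * h) = (fun w => extend f w * extend h w).
Proof. by apply/funext => w; rewrite /extend; case: insub => //=; rewrite mulr0. Qed.

Lemma is_derive_hcst (c : Cx R) z : is_derive (val z) 1 (extend (fun=> c)) 0.
Proof. by apply: (@is_derive_extend _ (cst c)) => //; exact: is_derive_cst. Qed.

Lemma is_derive_hD f h z : hol f -> hol h ->
  is_derive (val z) 1 (extend (f + h)) (dtau f z + dtau h z).
Proof.
move=> hf hh; rewrite extendD.
exact: (is_deriveDC (is_derive_dtau z hf) (is_derive_dtau z hh)).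
Qed.

Lemma is_derive_hM f h z : hol f -> hol h ->
  is_derive (val z) 1 (extend (f * h)) (dtau f z * h z + f z * dtau h z).
Proof.
move=> hf hh; rewrite extendM.
have := is_deriveMC (is_derive_dtau z hf) (is_derive_dtau z hh).
by rewrite !extend_val.
Qed.

Lemma hol_of f (l : H -> Cx R) :
  (forall z, is_derive (val z) 1 (extend f) (l z)) -> hol f.
Proof. by move=> h z; have [] := h z. Qed.

Lemma hol_cst (c : Cx R) : hol (fun=> c).
Proof. by apply: hol_of => z; exact: is_derive_hcst. Qed.

Lemma dtau_cst (c : Cx R) : dtau (fun=> c) = 0.
Proof. by apply/funext => z; rewrite (dtauE (is_derive_hcst c z)). Qed.

Lemma hol_add f h : hol f -> hol h -> hol (f + h).
Proof. by move=> hf hh; apply: hol_of => z; exact: is_derive_hD. Qed.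

Lemma hol_mul f h : hol f -> hol h -> hol (f * h).
Proof. by move=> hf hh; apply: hol_of => z; exact: is_derive_hM. Qed.

Lemma dtauD f h : hol f -> hol h -> dtau (f + h) = dtau f + dtau h.
Proof. by move=> hf hh; apply/funext => z; rewrite (dtauE (is_derive_hD z hf hh)). Qed.

Lemma dtauM f h : hol f -> hol h -> dtau (f * h) = dtau f * h + f * dtau h.
Proof. by move=> hf hh; apply/funext => z; rewrite (dtauE (is_derive_hM z hf hh)). Qed.

Lemma hol_exp f n : hol f -> hol (f ^+ n).
Proof.
move=> hf; elim: n => [|n ih]; first by rewrite expr0; exact: hol_cst.
by rewrite exprS; exact: hol_mul.
Qed.

Lemma hol_opp f : hol f -> hol (- f).
Proof. by move=> hf; rewrite -mulN1r; exact: (hol_mul (@hol_cst (-1)) hf). Qed.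

Lemma hol_tau : hol (@tau R).
Proof.
apply: hol_of => z; exact: (@is_derive_extend _ id).
Qed.

Lemma dtau_tau : dtau (@tau R) = 1.
Proof.
apply/funext => z; apply: dtauE; exact: (@is_derive_extend _ id).
Qed.

Lemma hol_dtau f : hol f -> hol (dtau f).
Proof.
move=> hf z.
have z0 := valP z; have [r r0 rH] := (nbhs_nrmP _ _).1 (im_gt0_near z).
have df w : nrm (w - val z) < r -> derivable (extend f) w 1.
  by move=> /rH wH; exact: hol_derivable.
have dd := derivable_derive1 r0 df.
have [] := @is_derive_extend (dtau f) (derive1 (extend f)) z _ (fun=> erefl)
  (is_derive_derive1 dd).
by [].
Qed.

Lemma hol_iter_dtau f n : hol f -> hol (iter n (@dtau R) f).
Proof. by move=> hf; elim: n => [|n ih]; [exact: hf | exact: (hol_dtau ih)]. Qed.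

Definition is_hol : {pred H -> Cx R} := fun f => `[< hol f >].

Lemma is_holP f : reflect (hol f) (f \in is_hol).
Proof. exact: asboolP. Qed.

Lemma is_hol_subring : subring_closed is_hol.
Proof.
split; first by apply/is_holP; exact: hol_cst.
  by move=> f h /is_holP hf /is_holP hh; apply/is_holP; exact: hol_add (hol_opp hh).
by move=> f h /is_holP hf /is_holP hh; apply/is_holP; exact: hol_mul.
Qed.

HB.instance Definition _ := GRing.isSubringClosed.Build (H -> Cx R) is_hol is_hol_subring.

(** On all functions [dtau] is not a derivation; this subring is where the theory
of differential rings applies. *)
Definition holfun := {f : H -> Cx R | f \in is_hol}.
HB.instance Definition _ := SubChoice.on holfun.
HB.instance Definition _ := GRing.SubChoice_isSubComPzRing.Build (H -> Cx R) is_hol holfun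
  (GRing.subringClosedP is_hol).

Lemma holfunP (f : holfun) : hol (val f : hfun R).
Proof. exact/is_holP/(valP f). Qed.

Definition to_hol f (hf : hol f) : holfun := exist _ f (introT (is_holP f) hf).

Definition dtau_hol (f : holfun) : holfun := to_hol (hol_dtau (@holfunP f)).

Lemma dtau_hol_additive : zmod_morphism dtau_hol.
Proof.
move=> f h; apply: val_inj => /=.
have hN : hol (- val h : hfun R) by exact: (hol_opp (@holfunP h)).
rewrite (dtauD (@holfunP f) hN); congr (_ + _).
have -> : - val h = (fun=> -1) * (val h : hfun R) by rewrite -[LHS]mulN1r.
rewrite (dtauM (@hol_cst (-1)) (@holfunP h)).
by rewrite dtau_cst mul0r add0r -[RHS]mulN1r.
Qed.

HB.instance Definition _ := GRing.isZmodMorphism.Build holfun holfun dtau_hol dtau_hol_additive.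

Lemma dtau_hol_mul (f h : holfun) : dtau_hol (f * h) = dtau_hol f * h + f * dtau_hol h.
Proof. by apply: val_inj; rewrite /= (dtauM (@holfunP f) (@holfunP h)). Qed.

End Holomorphic.

(** * Operators and injective ring morphisms *)

Section Transfer.
Variables (S S' : comPzRingType) (iota : {rmorphism S -> S'}).
Hypothesis iota_inj : injective iota.
Variables (d : S -> S) (d' : S' -> S').
Hypothesis dd' : forall x, iota (d x) = d' (iota x).

(** Injectivity keeps the supports, hence also the finiteness that decides
whether the sum is taken as 0. *)
Lemma iota_fsum (I : choiceType) (A : set I) (F : I -> S) :
  iota (\sum_(i \in A) F i) = \sum_(i \in A) iota (F i).
Proof.
have SE : A `&` F @^-1` [set~ 0] = A `&` (fun i => iota (F i)) @^-1` [set~ 0].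
  apply/seteqP; split => i /= [Ai Fi]; split => //; apply: contra_not Fi.
    by move=> E; apply: iota_inj; rewrite E rmorph0.
  by move=> ->; rewrite rmorph0.
have E : finite_support 0 A F = finite_support 0 A (fun i => iota (F i)).
  by rewrite /finite_support !unlock SE.
by rewrite rmorph_sum /= E.
Qed.

Lemma iota_iter n x : iota (iter n d x) = iter n d' (iota x).
Proof. by elim: n => //= n <-. Qed.

Lemma iota_psido_mul (a b : psido S) :
  iota \o psido_mul d a b = psido_mul d' (iota \o a) (iota \o b).
Proof.
apply/funext => k; rewrite /psido_mul /= iota_fsum; apply: eq_fsbigr => p _.
by rewrite !rmorphM /= rmorph_int iota_iter.
Qed.

Lemma iota_psido_mono c n : iota \o psido_mono c n = psido_mono (iota c) n.
Proof. by apply/funext => k /=; rewrite /psido_mono; case: ifP; rewrite ?rmorph0. Qed.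

Lemma iota_psido_pow u v i : iota \o psido_pow d u v i = psido_pow d' (iota u) (iota v) i.
Proof.
have E1 : iota \o psido_one S = psido_one S' by rewrite /psido_one iota_psido_mono rmorph1.
have EW : iota \o psido_mul d (psido_mono 1 (-1)) (psido_mono v 0) =
    psido_mul d' (psido_mono 1 (-1)) (psido_mono (iota v) 0).
  by rewrite iota_psido_mul !iota_psido_mono rmorph1.
case: i => n /=; elim: n => [|n ih].
- exact: E1.
- by rewrite /= iota_psido_mul iota_psido_mono ih.
- by rewrite /= iota_psido_mul EW E1.
- by rewrite iterS iota_psido_mul EW ih -iterS.
Qed.

End Transfer.

(** * Moebius transformations *)

Section Moebius.
Variable R : realType.
Local Notation H := (halfplane R).
Implicit Types (f h : hfun R) (z : H) (w l : Cx R) (g : 'M[R]_2).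

Lemma det22 g : \det g = g 0 0 * g 1 1 - g 0 1 * g 1 0.
Proof.
rewrite (expand_det_row _ 0) !big_ord_recl big_ord0 /cofactor.
rewrite /= !det_mx11 !mxE /= -[bump 0 0]/1%N -[(0 + 1)%N]/1%N -[(0 + 0)%N]/0%N.
rewrite (_ : lift 0 0 = 1 :> 'I_2); last exact: val_inj.
rewrite (_ : lift 1 0 = 0 :> 'I_2); last exact: val_inj.
by rewrite expr0 expr1; ring.
Qed.

Lemma mulmx22 g g' (i j : 'I_2) : (g *m g') i j = g i 0 * g' 0 j + g i 1 * g' 1 j.
Proof.
rewrite mxE !big_ord_recl big_ord0 addr0; congr (_ * _ + g _ _ * g' _ _); exact: val_inj.
Qed.

Definition mobius_den g w : Cx R := (g 1 0)%:C * w + (g 1 1)%:C.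

Lemma mobius_den_neq0 g w : \det g = 1 -> 0 < complex.Im w -> mobius_den g w != 0.
Proof.
move=> dg wH; apply/negP => /eqP E.
have := congr1 (@complex.Im R) E; have := congr1 (@complex.Re R) E.
rewrite /mobius_den Re_add Im_add Re_mul Im_mul /= !mul0r subr0 !addr0 => h1 h2.
have c0 : g 1 0 = 0 by apply/eqP; move/eqP: h2; rewrite mulf_eq0 (gt_eqF wH) orbF.
have d0 : g 1 1 = 0 by move: h1; rewrite c0 mul0r add0r.
by move: dg; rewrite det22 c0 d0 !mulr0 subrr => /eqP; rewrite eq_sym oner_eq0.
Qed.

Lemma mobius_val g z : \det g = 1 -> val (mobius g z) = mobius_fun g (val z).
Proof. by move=> dg; rewrite /mobius insubdK//; exact: (mobius_fun_gt0 dg (valP z)). Qed.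

Lemma mobius1 z : mobius 1%:M z = z.
Proof.
apply: val_inj; rewrite mobius_val ?det1// /mobius_fun !mxE /=.
by rewrite mul1r mul0r addr0 add0r divr1.
Qed.

Lemma mobius_mul g g' z : \det g = 1 -> \det g' = 1 ->
  mobius (g *m g') z = mobius g (mobius g' z).
Proof.
move=> dg dg'; apply: val_inj; rewrite !mobius_val ?det_mulmx ?dg ?dg' ?mulr1//.
have n1 := mobius_den_neq0 dg' (valP z).
have n2 := mobius_den_neq0 dg (mobius_fun_gt0 dg' (valP z)).
move: n1 n2; rewrite /mobius_fun /mobius_den !mulmx22 !rmorphD !rmorphM /=.
move: (val z) (g 0 0)%:C (g 0 1)%:C (g 1 0)%:C (g 1 1)%:C.
move: (g' 0 0)%:C (g' 0 1)%:C (g' 1 0)%:C (g' 1 1)%:C.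
move=> a' b' c' d' w a b c d n1 n2.
have n3 : (c * a' + d * c') * w + (c * b' + d * d') != 0.
  have -> : (c * a' + d * c') * w + (c * b' + d * d') =
    (c * ((a' * w + b') / (c' * w + d')) + d) * (c' * w + d') by field.
  by rewrite mulf_neq0.
apply: (mulIf n3); rewrite divfK//; apply: (mulIf n2); rewrite mulrAC divfK//.
by field.
Qed.

Lemma det_invmx g : \det g = 1 -> \det (invmx g) = 1.
Proof. by move=> dg; rewrite det_inv dg invr1. Qed.

Lemma unitmx_det1 g : \det g = 1 -> g \in unitmx.
Proof. by move=> dg; rewrite unitmxE dg unitr1. Qed.

Lemma mobiusK g z : \det g = 1 -> mobius g (mobius (invmx g) z) = z.
Proof.
by move=> dg; rewrite -mobius_mul ?det_invmx// mulmxV ?unitmx_det1// mobius1.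
Qed.

Lemma mobiusVK g z : \det g = 1 -> mobius (invmx g) (mobius g z) = z.
Proof.
by move=> dg; rewrite -mobius_mul ?det_invmx// mulVmx ?unitmx_det1// mobius1.
Qed.

Lemma is_derive_invC (p : Cx R -> Cx R) w l : p w != 0 -> is_derive w 1 p l ->
  is_derive w 1 (fun x => (p x)^-1) (- l * (p w)^-1 ^+ 2).
Proof.
move=> pw [dp <-]; split; first exact: derivableV.
by rewrite deriveV// mulNr mulrC -exprVn scaleNr.
Qed.

Lemma is_derive_mobius g w : \det g = 1 -> 0 < complex.Im w ->
  is_derive w 1 (mobius_fun g) ((mobius_den g w)^-1 ^+ 2).
Proof.
move=> dg wH; have n0 := mobius_den_neq0 dg wH.
have aff (a b : Cx R) : is_derive w 1 (fun x => a * x + b) a.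
  have := is_deriveDC (is_deriveMC (is_derive_cst a w 1) (is_derive_id w 1)) (is_derive_cst b w 1).
  by rewrite mul0r add0r mulr1 addr0.
have := is_deriveMC (aff (g 0 0)%:C (g 0 1)%:C)
  (is_derive_invC n0 (aff (g 1 0)%:C (g 1 1)%:C)).
congr is_derive.
have : (g 0 0)%:C * (g 1 1)%:C - (g 0 1)%:C * (g 1 0)%:C = 1 :> Cx R.
  by rewrite -!rmorphM -rmorphB -det22 dg.
move: n0; rewrite /mobius_den.
move: (g 0 0)%:C (g 0 1)%:C (g 1 0)%:C (g 1 1)%:C => a b c d n0 E.
have -> : a / (c * w + d) + (a * w + b) * (- c * (c * w + d)^-1 ^+ 2) =
   (a * d - b * c) * (c * w + d)^-1 ^+ 2 by field.
by rewrite E mul1r.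
Qed.

(** The derivative of [mobius g], that is, (c z + d)^(-2). *)
Definition jac g : hfun R := fun z => (mobius_den g (val z))^-1 ^+ 2.

Lemma is_derive_push g f z : \det g = 1 -> hol f ->
  is_derive (val z) 1 (extend (push g f)) (dtau f (mobius (invmx g) z) * jac (invmx g) z).
Proof.
move=> dg hf; have dgi := det_invmx dg.
apply: (@is_derive_extend _ _ (extend f \o mobius_fun (invmx g))).
  by move=> z'; rewrite /push /= -mobius_val// extend_val.
have dm := is_derive_mobius dgi (valP z).
apply: (is_derive_compC dm).
rewrite -(mobius_val z dgi); exact: (is_derive_dtau _ hf).
Qed.

Lemma hol_push g f : \det g = 1 -> hol f -> hol (push g f).
Proof. by move=> dg hf; apply: hol_of => z; exact: (is_derive_push z dg hf). Qed.

Lemma dtau_push g f : \det g = 1 -> hol f ->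
  dtau (push g f) = push g (dtau f) * jac (invmx g).
Proof.
by move=> dg hf; apply/funext => z; rewrite (dtauE (is_derive_push z dg hf)).
Qed.

Lemma pushK g f : \det g = 1 -> push g (push (invmx g) f) = f.
Proof.
move=> dg; apply/funext => z; rewrite /push invmxK; congr f.
exact: mobiusK.
Qed.

Lemma dtau_push_tau g : \det g = 1 -> dtau (push g (@tau R)) = jac (invmx g).
Proof.
by move=> dg; rewrite (dtau_push dg (@hol_tau R)) dtau_tau; exact: mul1r.
Qed.

(** The derivative of g o g^(-1) is 1. *)
Lemma u_jac g : \det g = 1 -> u_ g * jac (invmx g) = 1.
Proof.
move=> dg; have dgi := det_invmx dg.
by rewrite /u_ -(dtau_push dg (hol_push dgi (@hol_tau R))) pushK// dtau_tau.
Qed.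

Lemma hol_u g : \det g = 1 -> hol (u_ g).
Proof.
move=> dg; apply: (hol_push dg).
exact: (hol_dtau (hol_push (det_invmx dg) (@hol_tau R))).
Qed.

Lemma hol_jac g : \det g = 1 -> hol (jac (invmx g)).
Proof.
move=> dg; rewrite -(dtau_push_tau dg).
exact: (hol_dtau (hol_push dg (@hol_tau R))).
Qed.

Lemma u_inv g : \det g = 1 -> (fun z => (u_ g z)^-1) = jac (invmx g).
Proof.
move=> dg; apply/funext => z; have := congr1 (@^~ z) (u_jac dg).
rewrite -[(u_ g * _) z]/(u_ g z * jac (invmx g) z) -[(1 : hfun R) z]/(1 : Cx R) => E.
have u0 : u_ g z != 0.
  by apply/negP => /eqP u0; move/eqP: E; rewrite u0 mul0r eq_sym oner_eq0.
by apply: (mulfI u0); rewrite divff.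
Qed.

End Moebius.

(** * Operators with holomorphic coefficients *)

Section Values.
Variable R : realType.

Definition hval (f : holfun R) : hfun R := val f.

Lemma hval_additive : zmod_morphism hval. Proof. by []. Qed.
Lemma hval_multiplicative : monoid_morphism hval. Proof. by []. Qed.

HB.instance Definition _ := GRing.isZmodMorphism.Build (holfun R) (hfun R) hval hval_additive.
HB.instance Definition _ :=
  GRing.isMonoidMorphism.Build (holfun R) (hfun R) hval hval_multiplicative.

Lemma hval_inj : injective hval.
Proof. exact: val_inj. Qed.

Lemma hval_fsum (I : choiceType) (A : set I) (F : I -> holfun R) :
  hval (\sum_(i \in A) F i) = \sum_(i \in A) hval (F i).
Proof. exact: (iota_fsum (iota := hval) hval_inj). Qed.

Lemma hval_mul a b :
  hval \o psido_mul (@dtau_hol R) a b = psido_mul (@dtau R) (hval \o a) (hval \o b).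
Proof. exact: (iota_psido_mul (iota := hval) hval_inj (fun _ => erefl)). Qed.

Lemma hval_pow u v i :
  hval \o psido_pow (@dtau_hol R) u v i = psido_pow (@dtau R) (hval u) (hval v) i.
Proof. exact: (iota_psido_pow (iota := hval) hval_inj (fun _ => erefl)). Qed.

Lemma lift_hol (a : psido (hfun R)) : (forall i, hol (a i)) ->
  exists b : psido (holfun R), a = hval \o b.
Proof.
by move=> ha; exists (fun i => to_hol (ha i)); apply/funext => i.
Qed.

Lemma order_hval (b : psido (holfun R)) N : order_le (hval \o b) N <-> order_le b N.
Proof.
split=> h i iN; first by apply: hval_inj; exact: h.
by rewrite /= h.
Qed.

End Values.
Arguments hval {R} f.

(** * The action on operators is multiplicative *)

Section Action.
Variables (R : realType) (g : 'M[R]_2).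
Hypothesis dg : \det g = 1.
Local Notation Hol := (holfun R).

Definition push_hol (f : Hol) : Hol := to_hol (hol_push dg (@holfunP R f)).

Lemma push_hol_additive : zmod_morphism push_hol.
Proof. by move=> f h; apply: val_inj. Qed.

Lemma push_hol_multiplicative : monoid_morphism push_hol.
Proof. by split=> [|f h]; apply: val_inj. Qed.

HB.instance Definition _ := GRing.isZmodMorphism.Build Hol Hol push_hol push_hol_additive.
HB.instance Definition _ :=
  GRing.isMonoidMorphism.Build Hol Hol push_hol push_hol_multiplicative.

Definition u_hol : Hol := to_hol (hol_u dg).
Definition v_hol : Hol := to_hol (hol_jac dg).

Lemma u_v_hol : u_hol * v_hol = 1.
Proof. by apply: val_inj; exact: (u_jac dg). Qed.

Lemma push_hol_dtau (f : Hol) : u_hol * dtau_hol (push_hol f) = push_hol (dtau_hol f).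
Proof.
apply: val_inj.
have -> : val (u_hol * dtau_hol (push_hol f)) = u_ g * dtau (push g (val f)) by [].
have -> : val (push_hol (dtau_hol f)) = push g (dtau (val f)) by [].
rewrite (dtau_push dg (@holfunP R f)).
by move: (push g (dtau _)) (u_jac dg) => p E; rewrite mulrCA E mulr1.
Qed.

Lemma psido_act_hol (a : psido Hol) : psido_act g (hval \o a) =
  hval \o expand push_hol (psido_pow (@dtau_hol R) u_hol v_hol) a.
Proof.
apply/funext => k; rewrite /psido_act /expand /= hval_fsum.
apply: eq_fsbigr => i _; rewrite (u_inv dg).
by have <- := hval_pow u_hol v_hol i.
Qed.

Lemma psido_act_mul a b M N : (forall i, hol (a i)) -> (forall i, hol (b i)) ->
  order_le a M -> order_le b N ->
  psido_act g (psido_mul (@dtau R) a b) =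
  psido_mul (@dtau R) (psido_act g a) (psido_act g b).
Proof.
move=> /lift_hol[a' ->] /lift_hol[b' ->] /order_hval aM /order_hval bN.
rewrite -hval_mul !psido_act_hol -hval_mul; congr (hval \o _).
apply: (substitution_mul (@dtau_hol_mul R) u_v_hol push_hol_dtau).
  exact: order_bounded aM.
exact: order_bounded bN.
Qed.

Lemma order_pow i : order_le (psido_pow (@dtau R) (u_ g) (fun z => (u_ g z)^-1) i) i.
Proof.
rewrite (u_inv dg) -[u_ g]/(hval u_hol) -[jac _]/(hval v_hol) -hval_pow.
apply/order_hval; exact: order_psido_pow.
Qed.

Lemma pow_lead (n : nat) :
  psido_pow (@dtau R) (u_ g) (fun z => (u_ g z)^-1) n n = u_ g ^+ n.
Proof.
have K : psido_pow (@dtau_hol R) u_hol v_hol (Posz n) (Posz n) = u_hol ^+ n.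
  elim: n => [|n ih]; first by [].
  have -> : Posz n.+1 = Posz n + 1 by lia.
  rewrite (psido_powS (@dtau_hol_mul R) u_v_hol) /left_uD /left_D addrK ih.
  rewrite (@order_psido_pow _ (@dtau_hol R) u_hol v_hol n); last by lia.
  by rewrite raddf0 addr0 exprS.
rewrite (u_inv dg) -[u_ g]/(hval u_hol) -[jac _]/(hval v_hol) -hval_pow -rmorphXn -K.
by [].
Qed.

Lemma push0 : push g (0 : hfun R) = 0. Proof. by []. Qed.

(** The leading coefficient is a section of the power - n of the canonical bundle:
u_g D has leading coefficient u_g. *)
Lemma act_lead a (n : nat) : order_le a n -> psido_act g a n = push g (a n) * u_ g ^+ n.
Proof.
move=> an; rewrite -pow_lead.
have P0 i : order_le (psido_pow (@dtau R) (u_ g) (fun z => (u_ g z)^-1) i) (i + 0).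
  by rewrite addr0; exact: order_pow.
rewrite /psido_act -[LHS]/(expand (push g) _ a n).
rewrite (expand_window (lo := n) (m := 1) push0 an P0); [|lia|lia].
by rewrite big_ord1 addr0.
Qed.

End Action.

(** * The lifting map *)

Section Lifting.
Variables (R : realType) (l : nat -> nat -> rat).
Hypothesis lP : cmz_coefficients R l.
Local Notation H := (halfplane R).
Implicit Types (f h : forms R) (w : hfun R) (k : int) (g : 'M[R]_2).

Lemma scale_hmul (c : Cx R) w : c *: w = (fun=> c) * w.
Proof. by []. Qed.

Lemma hol_scale (c : Cx R) w : hol w -> hol (c *: w).
Proof. by move=> hw; rewrite scale_hmul; exact: (hol_mul (@hol_cst R c) hw). Qed.

Lemma dtau_scale (c : Cx R) w : hol w -> dtau (c *: w) = c *: dtau w.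
Proof.
by move=> hw; rewrite scale_hmul (dtauM (@hol_cst R c) hw) dtau_cst mul0r add0r.
Qed.

Lemma iter_dtau_linear n (c : Cx R) w w' : hol w -> hol w' ->
  iter n (@dtau R) (c *: w + w') = c *: iter n (@dtau R) w + iter n (@dtau R) w'.
Proof.
move=> hw hw'; elim: n => //= n ->.
have h1 := @hol_iter_dtau R w n hw; have h2 := @hol_iter_dtau R w' n hw'.
by rewrite (dtauD (@hol_scale c _ h1) h2) dtau_scale.
Qed.

Lemma iter_dtau0 n : iter n (@dtau R) 0 = 0.
Proof. by elim: n => //= n ->; exact: (@dtau_cst R 0). Qed.

Lemma hol0 : hol (0 : hfun R).
Proof. exact: (@hol_cst R 0). Qed.

Lemma hol_bigsum (m : nat) (F : 'I_m -> hfun R) : (forall i, hol (F i)) ->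
  hol (\sum_(i < m) F i).
Proof.
move=> hF; apply: (big_ind (@hol R)); first exact: hol0.
  by move=> x y hx hy; exact: (hol_add hx hy).
by move=> i _; exact: hF.
Qed.

Lemma order_lift1 i w : order_le (cmz_lift1 l i w) (- i%:Z).
Proof. by move=> k ik; rewrite /cmz_lift1 leNgt ik. Qed.

Lemma hol_lift1 i w k : hol w -> hol (cmz_lift1 l i w k).
Proof.
move=> hw; rewrite /cmz_lift1; case: ifP => _; last exact: hol0.
exact: (hol_scale (@hol_iter_dtau R w _ hw)).
Qed.

Lemma lift1_0 i k : cmz_lift1 l i (0 : hfun R) k = 0.
Proof. by rewrite /cmz_lift1 iter_dtau0 scaler0 if_same. Qed.

Lemma lift_window f k (m : nat) : - k < m%:Z ->
  cmz_lift l f k = \sum_(i < m) cmz_lift1 l i (f i) k.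
Proof.
move=> km; apply: fsum_nat_window => i mi; apply: order_lift1; lia.
Qed.

(** Triangularity of the lifting map: the diagonal term has coefficient
l_(n, 0) = 1. *)
Lemma lift_coef f (n : nat) : cmz_lift l f (- n%:Z) =
  f n + \sum_(i < n) (ratr (l i (n - i)%N) : Cx R) *: iter (n - i)%N (@dtau R) (f i).
Proof.
rewrite (@lift_window _ _ (n.+1)); last by lia.
rewrite big_ord_recr /= addrC; congr (_ + _).
  rewrite /cmz_lift1 lexx addNr /=; have [-> _] := lP.
  by rewrite rmorph1 scale1r.
apply: eq_bigr => i _; rewrite /cmz_lift1.
have ile := ltn_ord i.
have -> : (- n%:Z <= - i%:Z) by lia.
by have -> : absz (- n%:Z + i%:Z)%R = (n - i)%N by lia.
Qed.

Lemma order_lift f : order_le (cmz_lift l f) 0.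
Proof. by move=> k k0; rewrite (@lift_window _ _ (0)) ?big_ord0//; lia. Qed.

Lemma hol_lift f : hol_forms f -> forall k, hol (cmz_lift l f k).
Proof.
move=> hf k; rewrite (@lift_window _ _ (absz k).+1); last by lia.
by apply: hol_bigsum => i; apply: hol_lift1; exact: hf.
Qed.

(** Equivariance extends from single forms to sequences because each coefficient
involves finitely many of them. *)
Lemma act_lift g f : \det g = 1 -> hol_forms f ->
  psido_act g (cmz_lift l f) = cmz_lift l (fun i => form_act g i (f i)).
Proof.
move=> dg hf; apply/funext => k; pose m := (absz k).+1.
have P0 i : order_le (psido_pow (@dtau R) (u_ g) (fun z => (u_ g z)^-1) i) (i + 0).
  by rewrite addr0; exact: order_pow.
have pD : {morph (push g : hfun R -> hfun R) : x y / x + y} by [].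
have act1 a : order_le a 0 -> psido_act g a k = \sum_(s < m) push g (a (k + s%:Z)) *
    psido_pow (@dtau R) (u_ g) (fun z => (u_ g z)^-1) (k + s%:Z) k.
  move=> a0; rewrite /psido_act -[LHS]/(expand (push g) _ a k).
  by rewrite (expand_window (lo := k) (m := m) (push0 g) a0 P0)//; rewrite /m; lia.
rewrite (act1 _ (@order_lift f)) (@lift_window _ _ (m)); last by rewrite /m; lia.
transitivity (\sum_(t < m) psido_act g (cmz_lift1 l t (f t)) k); last first.
  by apply: eq_bigr => t _; have [_ <-] := lP; rewrite //; exact: hf.
transitivity (\sum_(s < m) \sum_(t < m) push g (cmz_lift1 l t (f t) (k + s%:Z)) *
    psido_pow (@dtau R) (u_ g) (fun z => (u_ g z)^-1) (k + s%:Z) k).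
  apply: eq_bigr => s _; rewrite (@lift_window _ _ (m)); last by rewrite /m; lia.
  by rewrite (big_morph _ pD (push0 g)) mulr_suml.
rewrite exchange_big; apply: eq_bigr => t _; rewrite act1//.
by move=> j j0; apply: order_lift1; lia.
Qed.

Lemma lift_linear (c : Cx R) f h : hol_forms f -> hol_forms h ->
  cmz_lift l (c *: f + h) = c *: cmz_lift l f + cmz_lift l h.
Proof.
move=> hf hh; apply/funext => k; pose m := (absz k).+1.
have km : - k < m%:Z by rewrite /m; lia.
rewrite -[RHS]/(c *: cmz_lift l f k + cmz_lift l h k) !(@lift_window _ _ _ km).
rewrite scaler_sumr -big_split /=; apply: eq_bigr => i _.
rewrite /cmz_lift1; case: ifP => _; last by rewrite scaler0 addr0.
rewrite -[(c *: f + h) i]/(c *: f i + h i) iter_dtau_linear//; try exact: hf; try exact: hh.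
by rewrite scalerDr !scalerA [_ * c]mulrC.
Qed.

Lemma lift_inj f h : cmz_lift l f = cmz_lift l h -> f = h.
Proof.
move=> E; apply/funext => n; have [m] := ubnP n.
elim: m n => // m ih n nm.
have := congr1 (@^~ (- n%:Z)) E; rewrite !lift_coef.
rewrite (eq_bigr (fun i : 'I_n =>
  (ratr (l i (n - i)%N) : Cx R) *: iter (n - i)%N (@dtau R) (h i))); first by move/addIr.
by move=> i _; rewrite ih// (leq_trans (ltn_ord i)).
Qed.

(** The system of [lift_coef] is solved from the top; the list holds the first n
components. *)
Fixpoint unlift_seq (x : psido (hfun R)) (n : nat) : seq (hfun R) :=
  if n is n'.+1 then
    let s := unlift_seq x n' in
    rcons s (x (- n'%:Z) - \sum_(i < n')
      (ratr (l i (n' - i)%N) : Cx R) *: iter (n' - i)%N (@dtau R) (nth 0 s i))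
  else [::].

Definition unlift x : forms R := fun n => nth 0 (unlift_seq x n.+1) n.

Lemma size_unlift_seq x n : size (unlift_seq x n) = n.
Proof. by elim: n => //= n ih; rewrite size_rcons ih. Qed.

Lemma nth_unlift_seq x n i : (i < n)%N -> nth 0 (unlift_seq x n) i = unlift x i.
Proof.
elim: n => // n ih; rewrite ltnS leq_eqVlt => /orP[/eqP->//|h].
by rewrite [unlift_seq x n.+1]/= nth_rcons size_unlift_seq h ih.
Qed.

Lemma unliftE x n : unlift x n = x (- n%:Z) - \sum_(i < n)
  (ratr (l i (n - i)%N) : Cx R) *: iter (n - i)%N (@dtau R) (unlift x i).
Proof.
rewrite [LHS]/unlift [unlift_seq x n.+1]/= nth_rcons size_unlift_seq ltnn eqxx.
by congr (_ - _); apply: eq_bigr => i _; rewrite nth_unlift_seq.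
Qed.

Lemma hol_unlift x : (forall i, hol (x i)) -> hol_forms (unlift x).
Proof.
move=> hx n; have [m] := ubnP n; elim: m n => // m ih n nm.
rewrite unliftE; apply: hol_add; first exact: hx.
apply: hol_opp; apply: hol_bigsum => i; apply: hol_scale; apply: hol_iter_dtau.
by apply: ih; rewrite (leq_trans (ltn_ord i)).
Qed.

Lemma unliftK x : order_le x 0 -> cmz_lift l (unlift x) = x.
Proof.
move=> x0; apply/funext => k; have [k0|k0] := ltP 0 k.
  by rewrite order_lift// x0.
have -> : k = - (absz k)%:Z by lia.
by rewrite lift_coef unliftE subrK.
Qed.

(** If the first components of f vanish up to i, the coefficient of D^(-i) is
f_i. *)
Lemma order_liftP f n : order_le (cmz_lift l f) (- n%:Z) <-> forall i, (i < n)%N -> f i = 0.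
Proof.
split=> [h i|h k nk].
  have [m] := ubnP i; elim: m i => // m ih i im ni.
  have := h (- i%:Z); rewrite lift_coef big1 ?addr0; first by apply; lia.
  move=> j _; have ji := ltn_ord j.
  by rewrite (ih j (leq_trans ji im) (ltn_trans ji ni)) iter_dtau0 scaler0.
rewrite (@lift_window _ _ (absz k).+1); last by lia.
apply: big1 => i _; have [kn|kn] := ltnP i n; first by rewrite h// lift1_0.
by apply: order_lift1; lia.
Qed.

Lemma lift_one : cmz_lift l (@forms_one R) = psido_one (hfun R).
Proof.
apply/funext => k; have [k0|k0] := ltP 0 k.
  by rewrite order_lift// /psido_one /psido_mono gt_eqF.
have -> : k = - (absz k)%:Z by lia.
move: (absz k) => n; rewrite lift_coef /psido_one /psido_mono.
have -> : (- n%:Z == 0) = (n == 0%N) by lia.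
case: n => [|n]; first by rewrite big_ord0 addr0.
rewrite /= add0r big_ord_recl /= big1 ?addr0 => [|i _].
  rewrite -iterS iterSr (_ : dtau 1 = 0); last exact: (@dtau_cst R 1).
  by rewrite iter_dtau0 scaler0.
by rewrite iter_dtau0 scaler0.
Qed.

(** The product of two lifts is an operator of order at most 0 with holomorphic
coefficients, hence a lift. *)
Lemma mu_lift f h : hol_forms f -> hol_forms h ->
  hol_forms (mu l f h) /\
  cmz_lift l (mu l f h) = psido_mul (@dtau R) (cmz_lift l f) (cmz_lift l h).
Proof.
move=> hf hh.
pose x := psido_mul (@dtau R) (cmz_lift l f) (cmz_lift l h).
have [a fa] := lift_hol (hol_lift hf); have [b hb] := lift_hol (hol_lift hh).
have xE : x = hval \o psido_mul (@dtau_hol R) a b by rewrite hval_mul -fa -hb.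
have hx i : hol (x i) by rewrite xE; exact: holfunP.
have ox : order_le x 0.
  have oa : order_le a 0 by apply/order_hval; rewrite -fa; exact: order_lift.
  have ob : order_le b 0 by apply/order_hval; rewrite -hb; exact: order_lift.
  rewrite xE; apply/order_hval.
  by have := @order_psido_mul _ (@dtau_hol R) a b 0 0 oa ob; rewrite addr0.
rewrite /mu; apply: (@xgetPex _ 0 [set m | hol_forms m /\ cmz_lift l m = x]).
by exists (unlift x); split; [exact: hol_unlift | exact: unliftK].
Qed.

Variable Gamma : set 'M[R]_2.
Hypothesis Gdet : Gamma `<=` [set g | \det g = 1].

(** Injectivity turns the equality of the lifts of f and of its image under g
into an equality of sequences. *)
Lemma lift_invariant f : hol_forms f ->
  Aalg Gamma f <-> forall g, Gamma g -> psido_act g (cmz_lift l f) = cmz_lift l f.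
Proof.
move=> hf; split=> [[_ fG] g Gg|h].
  rewrite act_lift//; last exact: Gdet.
  by congr (cmz_lift l _); apply/funext => i; exact: fG.
split=> // g i Gg; have := h g Gg; rewrite act_lift//; last exact: Gdet.
by move=> /lift_inj => /(congr1 (@^~ i)).
Qed.

Lemma lift_Ban f : Aalg Gamma f -> Ban Gamma (cmz_lift l f).
Proof.
move=> Af; have hf := Af.1; split.
- by exists 0; exact: order_lift.
- exact: hol_lift.
- exact: (lift_invariant hf).1.
Qed.

Lemma mu_Aalg f h : Aalg Gamma f -> Aalg Gamma h -> Aalg Gamma (mu l f h).
Proof.
move=> Af Ah; have hf := Af.1; have hh := Ah.1.
have [hm mE] := mu_lift hf hh; apply/(lift_invariant hm) => g Gg.
have dg : \det g = 1 by exact: Gdet.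
rewrite mE (psido_act_mul dg (hol_lift hf) (hol_lift hh) (@order_lift f) (@order_lift h)).
by rewrite ((lift_invariant hf).1 Af g Gg) ((lift_invariant hh).1 Ah g Gg).
Qed.

Lemma lift_onto a : Ban Gamma a -> order_le a 0 ->
  exists2 f, Aalg Gamma f & cmz_lift l f = a.
Proof.
move=> [_ ha aG] a0; have hu := hol_unlift ha; exists (unlift a); last exact: unliftK.
by apply/(lift_invariant hu) => g Gg; rewrite unliftK//; exact: aG.
Qed.

End Lifting.

(** * Differentials of the curve pulled back to the half-plane *)

Section Surface.
Variables (R : realType) (C : riemannSurface R) (Gamma : set 'M[R]_2).
Variable q : halfplane R -> C.
Hypothesis Cc : compact [set: C].
Hypothesis Gdet : Gamma `<=` [set g | \det g = 1].
Hypothesis qU : uniformization Gamma q.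
Local Notation H := (halfplane R).
Implicit Types (z : H) (p : C) (a b : rs_index C) (f : hfun R).

Let q_onto p : exists z, q z = p.
Proof. by have [h _ _ _] := qU. Qed.

Let q_orbit z z' : q z = q z' <-> exists2 g, Gamma g & z' = mobius g z.
Proof. by have [_ h _ _] := qU. Qed.

Let q_open (V : set C) : open V <-> open [set w : Cx R | exists2 z, V (q z) & w = val z].
Proof. by have [_ _ h _] := qU. Qed.

Let q_hol (V : set C) (f : C -> Cx R) : open V -> (rs_hol V f <->
  forall z, V (q z) -> derivable (extend (f \o q)) (val z) 1).
Proof. by have [_ _ _ h] := qU; exact: h. Qed.

Definition Gamma_invariant f := forall g z, Gamma g -> f (mobius g z) = f z.

(** The modulus of f descends to a continuous function on the compact curve and
so has a maximum. *)
Lemma invariant_constant f : hol f -> Gamma_invariant f -> forall z z', f z = f z'.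
Proof.
move=> hf If.
have /choice[s sP] := q_onto.
pose phi p : R := nrm (f (s p)).
have phiq z : phi (q z) = nrm (f z).
  have /q_orbit[g Gg E] : q z = q (s (q z)) by rewrite sP.
  by rewrite /phi E If.
have cphi : continuous phi.
  apply/continuousP => O oO; apply/q_open.
  rewrite openE => _ [z Oz ->].
  have cf : {for val z, continuous (extend f)} := derivable_continuousC (hf z).
  have Oz' : O (nrm (f z)) by rewrite -phiq.
  have /nbhs_ballP[e /= e0 eO] : nbhs (nrm (f z)) O by exact: open_nbhs_nbhs.
  move/continuous_nrmP: cf => /(_ e e0)[d d0 H1].
  have near1 : \forall w \near val z, nrm (w - val z) < d.
    by apply/nbhs_nrmP; exists d.
  apply: filterS2 near1 (im_gt0_near z) => w /H1 h wH.
  exists (exist _ w wH) => //; rewrite /preimage/= phiq; apply: eO.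
  rewrite /ball/= -(extendE f wH) -(extend_val f z).
  have t1 := nrm_dist_le (extend f w) (extend f (val z)) 0.
  have t2 := nrm_dist_le (extend f (val z)) (extend f w) 0.
  rewrite !subr0 in t1 t2; rewrite nrm_distC in t2.
  rewrite nrm_distC in h; rewrite nrm_distC in t1; rewrite nrm_distC in t2.
  rewrite ltr_norml; apply/andP; split; lra.
have i0 : 0 < complex.Im ('i%C : Cx R) by rewrite /= ltr01.
(* Any point would do to show that the curve is not empty. *)
pose z0 : H := exist _ ('i%C : Cx R) i0.
have [| |c _ cM] := @compact_EVT_max C R phi setT _ Cc _.
- by exists (q z0).
- exact: continuous_subspaceT.
have [zc zcE] := q_onto c.
have K : forall w, 0 < complex.Im w -> extend f w = extend f (val zc).
  apply: max_half_plane; [|exact: (valP zc)|].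
    by move=> w wH; exact: hol_derivable.
  move=> w wH; rewrite (extendE f wH) extend_val -!phiq zcE.
  by apply: cM; rewrite inE.
by move=> z z'; rewrite -(extend_val f z) -(extend_val f z') !K//; [exact: (valP z')|exact: (valP z)].
Qed.

(** The pullback to the half-plane of a coordinate of the curve; only its values
over the domain of the chart are meaningful. *)
Definition local_coord a : hfun R := rs_chart a \o q.

Lemma derivable_coord a z : rs_dom a (q z) -> derivable (extend (local_coord a)) (val z) 1.
Proof.
have /q_hol-/(_ (rs_chart a)) : open (rs_dom a) by exact: rs_dom_open.
by move=> [h _]; apply: h => b p pa pb; exact: rs_transition.
Qed.

Lemma near_dom a z : rs_dom a (q z) ->
  \forall w \near val z, exists2 z', rs_dom a (q z') & w = val z'.
Proof.
move=> az; have /q_open oD : open (rs_dom a) by exact: rs_dom_open.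
by move: oD; rewrite openE; apply; exists z.
Qed.

Lemma is_derive_coord a z : rs_dom a (q z) ->
  is_derive (val z) 1 (extend (local_coord a)) (dtau (local_coord a) z).
Proof. by move=> az; exact: (is_derive_derive1 (derivable_coord az)). Qed.

Lemma dtau_coord_change a b z : rs_dom a (q z) -> rs_dom b (q z) ->
  dtau (local_coord a) z =
  derive1 (rs_chart a \o rs_param b) (rs_chart b (q z)) * dtau (local_coord b) z.
Proof.
move=> az bz; apply: dtauE.
have dt := is_derive_derive1 (rs_transition bz az).
have db := is_derive_coord bz.
have E : rs_chart b (q z) = extend (local_coord b) (val z) by rewrite extend_val.
rewrite E in dt *.
have := is_derive_compC db dt; apply: near_eq_is_derive.
apply: filterS (near_dom bz) => _ [z' bz' ->] /=.
by rewrite !extend_val /local_coord /= rs_chartK.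
Qed.

Lemma dtau_coord_invariant a g z : Gamma g -> rs_dom a (q z) ->
  dtau (local_coord a) z = dtau (local_coord a) (mobius g z) * jac g z.
Proof.
move=> Gg az; have dg : \det g = 1 by exact: Gdet.
have qg z' : q (mobius g z') = q z' by apply/esym/q_orbit; exists g.
apply: dtauE; have dm := is_derive_mobius dg (valP z).
apply: (@is_derive_extend _ _ (extend (local_coord a) \o mobius_fun g)).
  by move=> z'; rewrite /= -mobius_val// extend_val /local_coord /= qg.
apply: (is_derive_compC dm); rewrite -(mobius_val z dg).
by apply: is_derive_coord; rewrite qg.
Qed.

Variable chart_at : C -> rs_index C.
Hypothesis chart_atP : forall p, rs_dom (chart_at p) p.
Implicit Type w : rs_index C -> C -> Cx R.

(** The function O such that O dtau is the pullback of the differential w along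
q, computed in a chart chosen at each point. *)
Definition pullback w : hfun R := fun z =>
  w (chart_at (q z)) (q z) * dtau (local_coord (chart_at (q z))) z.

(** Independence of the chart is the compatibility condition on w combined with
the chain rule. *)
Lemma pullbackE w a z : differential w -> rs_dom a (q z) ->
  pullback w z = w a (q z) * dtau (local_coord a) z.
Proof.
move=> [_ wc] az; have bz := chart_atP (q z).
by rewrite /pullback (wc _ _ _ bz az) (dtau_coord_change az bz) mulrA.
Qed.

Lemma hol_pullback w : differential w -> hol (pullback w).
Proof.
move=> dw z; set a := chart_at (q z); have az : rs_dom a (q z) by exact: chart_atP.
have [wh _] := dw.
have oD : open (rs_dom a) by exact: rs_dom_open.
have dwa := (q_hol (w a) oD).1 (wh a) z az.
have [r r0 rD] := (nbhs_nrmP _ _).1 (near_dom az).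
have dc : derivable (derive1 (extend (local_coord a))) (val z) 1.
  apply: (derivable_derive1 r0) => u /rD[z' az' ->]; exact: derivable_coord.
have := is_deriveMC (is_derive_derive1 dwa) (is_derive_derive1 dc).
move=> /near_eq_is_derive K.
have [] // := K (extend (pullback w)) _.
apply: filterS (near_dom az) => _ [z' az' ->] /=.
by rewrite !extend_val (pullbackE dw az').
Qed.

Lemma pullback_invariant w g z : differential w -> Gamma g ->
  pullback w z = pullback w (mobius g z) * jac g z.
Proof.
move=> dw Gg; have qg : q (mobius g z) = q z by apply/esym/q_orbit; exists g.
have az := chart_atP (q z); rewrite (pullbackE dw az) (@pullbackE w (chart_at (q z)) (mobius g z) dw).
  by rewrite qg -mulrA -dtau_coord_invariant.
by rewrite qg.
Qed.

(** Otherwise q is constant near z, with value p. Translating by the group, q is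
locally constant on the whole fibre of p, so p is an open point; then the image
of a chart at p contains an open point of the complex plane. *)
Lemma coord_derivative_not_zero a z : rs_dom a (q z) ->
  ~ (\forall u \near val z, derive1 (extend (local_coord a)) u = 0).
Proof.
move=> az z0; set p := q z.
have [r r0 rP] := (nbhs_nrmP _ _).1 (filterI z0 (near_dom az)).
have const z' : nrm (val z' - val z) < r -> q z' = p.
  move=> zr; have [_ [z'' az' /val_inj zz]] := rP _ zr; rewrite -zz in az'.
  have K u : nrm (u - val z) < r -> is_derive u 1 (extend (local_coord a)) 0.
    by move=> /rP[u0 [y ay uy]]; rewrite uy in u0 *; rewrite -u0; exact: is_derive_coord.
  have E : rs_chart a (q z') = rs_chart a p.
    by have := derive0_constant K zr; rewrite !extend_val.
  by rewrite -(rs_chartK az') E rs_chartK.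
have op : open [set p].
  apply/q_open; rewrite openE => _ [z1 /= z1p ->].
  have /q_orbit[g Gg z1g] : q z1 = q z by [].
  have dg : \det g = 1 by exact: Gdet.
  have [dm _] := is_derive_mobius dg (valP z1).
  have /continuous_nrmP/(_ _ r0)[d d0 dP] := derivable_continuousC dm.
  have nd : \forall u \near val z1, nrm (u - val z1) < d by apply/nbhs_nrmP; exists d.
  apply: filterS2 nd (im_gt0_near z1) => u /dP ud uH.
  exists (exist _ u uH) => //=.
  have -> : q (exist _ u uH) = q (mobius g (exist _ u uH)) by apply/q_orbit; exists g.
  by apply: const; rewrite z1g !mobius_val.
have cp := rs_param_continuous az.
have n1 : \forall u \near rs_chart a p, rs_param a u = p.
  apply: (cp [set p]); rewrite rs_chartK//; exact: open_nbhs_nbhs.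
have n2 : \forall u \near rs_chart a p, (rs_chart a @` rs_dom a) u.
  by apply: open_nbhs_nbhs; split; [exact: rs_image_open | exists p].
have [e e0 eP] := (nbhs_nrmP _ _).1 (filterI n1 n2).
have nw : nrm (rs_chart a p + (e / 2)%:C - rs_chart a p) < e.
  by rewrite [_ + (e / 2)%:C]addrC addrK nrm_real gtr0_norm ?divr_gt0// ltr_pdivrMr// ltr_pMr// ltr1n.
have [h1 [p' ap' h2]] := eP _ nw.
have pp : p' = p by rewrite -h1 -h2 rs_chartK.
have : nrm (rs_chart a p + (e / 2)%:C - rs_chart a p) = 0 by rewrite -h2 pp subrr nrm0.
rewrite [_ + (e / 2)%:C]addrC addrK nrm_real => /eqP; rewrite normr_eq0 => /eqP e2.
have e20 : 0 < e / 2 by rewrite divr_gt0.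
by rewrite e2 ltxx in e20.
Qed.

End Surface.

(** * Vanishing of invariants of negative weight *)

Section NegativeWeight.
Variables (R : realType) (C : riemannSurface R) (genus : nat) (Gamma : set 'M[R]_2).
Variable q : halfplane R -> C.
Hypothesis Cc : compact [set: C].
Hypothesis genusC : has_genus C genus.
Hypothesis genus_gt1 : (1 < genus)%N.
Hypothesis Gdet : Gamma `<=` [set g | \det g = 1].
Hypothesis qU : uniformization Gamma q.
Local Notation H := (halfplane R).

Lemma hexpE (f : hfun R) n z : (f ^+ n) z = f z ^+ n.
Proof. by elim: n => // n ih; rewrite !exprS -ih. Qed.

(** A nonzero value of f persists nearby, so h vanishes on an open set. *)
Lemma hmul_eq0 (f h : hfun R) (z0 : H) : hol f -> hol h ->
  (forall z, f z * h z = 0) -> f z0 != 0 -> forall z, h z = 0.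
Proof.
move=> hf hh fh f0 z.
have df w : 0 < complex.Im w -> derivable (extend f) w 1 by move=> wH; exact: hol_derivable.
have dh w : 0 < complex.Im w -> derivable (extend h) w 1 by move=> wH; exact: hol_derivable.
rewrite -(extend_val h z); apply: (mul_eq0_half_plane df dh _ (valP z0) _ (valP z)).
  by move=> w wH; rewrite !(extendE _ wH).
by rewrite extend_val.
Qed.

(** For a differential w the function s O^n, with O the pullback of w, is
invariant, hence constant; two independent differentials leave no room for a
nonzero s. *)
Lemma invariant_weight_vanishes (s : hfun R) (n : nat) : (0 < n)%N -> hol s ->
  (forall g z, Gamma g -> s (mobius g z) = s z * u_ g (mobius g z) ^+ n) -> s = 0.
Proof.
move=> n0 hs sG.
have /choice[ch chP] : forall p : C, exists a, rs_dom a p := @rs_cover _ C.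
have [e [ed eb]] := genusC.
pose Om i : hfun R := pullback q ch (e i).
have hOm i : hol (Om i) by exact: (hol_pullback qU chP (ed i)).
have OmG i g z : Gamma g -> Om i z = Om i (mobius g z) * jac g z.
  by move=> Gg; exact: (pullback_invariant Gdet qU chP z (ed i) Gg).
have ujac g z : Gamma g -> u_ g (mobius g z) = jac g z.
  move=> Gg; have dg : \det g = 1 by exact: Gdet.
  rewrite /u_ (dtau_push_tau (det_invmx dg)) invmxK /push mobiusVK//.
have jac0 g z : Gamma g -> jac g z != 0.
  move=> Gg; rewrite /jac expf_neq0// invr_eq0; apply: mobius_den_neq0; last exact: (valP z).
  exact: Gdet.
pose i0 : 'I_genus := Ordinal (ltnW genus_gt1); pose i1 : 'I_genus := Ordinal genus_gt1.
(* Uniqueness of coordinates in the basis of differentials: no basis vector is a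
   multiple of another one. *)
have rep i j (k : Cx R) : i != j ->
    (forall a p, rs_dom a p -> e j a p = k * e i a p) -> False.
  move=> ij E; have [c [_ cU]] := eb (e j) (ed j).
  have c1 : c = delta_mx 0 j.
    apply: cU => a p ap; rewrite (bigD1 j)//= mxE !eqxx mul1r big1 ?addr0// => t tj.
    by rewrite mxE (negbTE tj) mul0r.
  have c2 : c = k *: delta_mx 0 i.
    apply: cU => a p ap; rewrite (bigD1 i)//= !mxE !eqxx mulr1 big1 ?addr0// => [|t ti].
      exact: E.
    by rewrite !mxE (negbTE ti) mulr0 mul0r.
  have := congr1 (fun m : 'rV[Cx R]_genus => m 0 j) (etrans (esym c1) c2).
  rewrite !mxE !eqxx eq_sym (negbTE ij) mulr0 => /eqP.
  by rewrite oner_eq0.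
have qz p : exists z, q z = p by have [h _ _ _] := qU.
pose F := s * Om i0 ^+ n.
have FE z : F z = s z * Om i0 z ^+ n.
  rewrite /F -[(s * _) z]/(s z * (Om i0 ^+ n) z); congr (_ * _).
  exact: hexpE.
have hF : hol F by exact: (hol_mul hs (@hol_exp R _ n (hOm i0))).
have FG : Gamma_invariant Gamma F.
  move=> g z Gg; rewrite (FE (mobius g z)) (FE z) (sG g z Gg) (ujac g z Gg).
  rewrite (OmG i0 g z Gg) [X in _ = _ * X]exprMn.
  by move: (s z) (jac g z ^+ n) (Om i0 (mobius g z) ^+ n) => x y t; ring.
have Fc := invariant_constant Cc qU hF FG.
apply/funext => z0; rewrite -[(0 : hfun R) z0]/(0 : Cx R).
have [//|s0] := eqVneq (s z0) 0; exfalso.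
have Om0 : forall z, Om i0 z != 0.
  have [Fz|Fz] := eqVneq (F z0) 0; last first.
    move=> z; apply: contra_neq Fz => Oz.
    by rewrite (Fc z0 z) FE Oz expr0n gtn_eqF// mulr0.
  (* The product s O_0^n vanishes and s does not, so O_0 = 0. *)
  have Oz z : Om i0 z = 0.
    have OX : forall z, (Om i0 ^+ n) z = 0.
      apply: (hmul_eq0 hs (@hol_exp R _ n (hOm i0)) _ s0) => z'.
      by rewrite -[LHS]/(F z') (Fc z' z0).
    have := OX z; rewrite hexpE => /eqP.
    by rewrite expf_eq0 n0 => /eqP.
  (* If e_0 did not vanish at p, the derivative of the coordinate would vanish
     near a point above p. *)
  exfalso; apply: (rep i1 i0 0) => // a p ap; rewrite mul0r.
  apply/eqP; apply: contraT => ep; have [z zp] := qz p; exfalso.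
  have az : rs_dom a (q z) by rewrite zp.
  apply: (coord_derivative_not_zero Gdet qU az).
  have oD : open (rs_dom a : set C) by exact: rs_dom_open.
  have dwa : derivable (extend (e i0 a \o q)) (val z) 1.
    have [_ _ _ qh] := qU; apply: ((qh _ _ oD).1 _ z az).
    by have [h _] := ed i0; exact: h.
  have e0 : 0 < nrm (e i0 a (q z)) by rewrite zp nrm_gt0.
  have /continuous_nrmP/(_ _ e0)[d d0 dP] := derivable_continuousC dwa.
  have nd : \forall u \near val z, nrm (u - val z) < d by apply/nbhs_nrmP; exists d.
  apply: filterS2 nd (near_dom qU az) => u ud [z' az' uz].
  move: (dP u ud); rewrite uz !extend_val /= => h.
  have := Oz z'; rewrite /Om (pullbackE qU chP (ed i0) az') => /eqP.
  rewrite mulf_eq0 => /orP[/eqP ez|/eqP//].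
  by move: h; rewrite ez sub0r nrmN ltxx.
pose K : hfun R := fun z => Om i1 z / Om i0 z.
have hK : hol K.
  move=> z; have d1 := is_derive_dtau z (hOm i1).
  have n1 : extend (Om i0) (val z) != 0 by rewrite extend_val.
  have d2 := is_derive_invC n1 (is_derive_dtau z (hOm i0)).
  have d3 := is_deriveMC d1 d2.
  have [] // := @is_derive_extend R K (fun w => extend (Om i1) w * (extend (Om i0) w)^-1) z _ _ d3.
  by move=> z'; rewrite !extend_val.
have KG : Gamma_invariant Gamma K.
  move=> g z Gg; rewrite /K (OmG i1 g z Gg) (OmG i0 g z Gg).
  move: (jac g z) (jac0 g z Gg) (Om i1 (mobius g z)) (Om i0 (mobius g z)) => x x0 y t.
  by rewrite -mulf_div divff// mulr1.
have Kc := invariant_constant Cc qU hK KG.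
apply: (rep i0 i1 (K z0)) => // a p ap; have [z zp] := qz p.
have az : rs_dom a (q z) by rewrite zp.
have := Kc z z0; rewrite -zp => <-; rewrite /K.
have O0 := Om0 z; move: O0; rewrite /Om !(pullbackE qU chP (ed _) az) mulf_eq0 negb_or.
move: (dtau _ _) (e i1 a _) (e i0 a _) => x y t /andP[t0 x0].
by rewrite -mulf_div divff// mulr1 divfK.
Qed.

(** A leading term of positive order is an invariant of negative weight, so the
order drops step by step to 0. *)
Lemma invariant_order_le0 a : Ban Gamma a -> order_le a 0.
Proof.
move=> [[N aN] ha aG].
have H n : order_le a (n : nat)%:Z -> order_le a 0.
  elim: n => // n ih an; apply: ih => k nk.
  have [kn|kn] := ltP (n.+1%:Z) k; first exact: an.
  have -> : k = n.+1%:Z by lia.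
  apply: (@invariant_weight_vanishes _ n.+1 _ (ha _)) => // g z Gg.
  have dg : \det g = 1 by exact: Gdet.
  have E : push g (a n.+1) * u_ g ^+ n.+1 = a n.+1 by rewrite -(act_lead dg an) (aG g Gg).
  have := congr1 (@^~ (mobius g z)) E => /esym.
  rewrite -[(_ * _) (mobius g z)]/(a n.+1 (mobius (invmx g) (mobius g z)) *
    (u_ g ^+ n.+1) (mobius g z)).
  by rewrite hexpE mobiusVK.
apply: (H (absz N)) => k kN; apply: aN; lia.
Qed.

End NegativeWeight.

(** * The isomorphism of algebras *)

Theorem proposition4p1 (R : realType) (C : riemannSurface R) (genus : nat)
    (Gamma : set 'M[R]_2) (q : halfplane R -> C) (l : nat -> nat -> rat) :
  compact [set: C] -> connected [set: C] ->
  has_genus C genus -> (1 < genus)%N ->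
  discrete_subgroup_SL2 Gamma -> uniformization Gamma q ->
  cmz_coefficients R l ->
  (forall f h, Aalg Gamma f -> Aalg Gamma h -> Aalg Gamma (mu l f h)) /\
  [/\ set_bij (Aalg Gamma) (Ban Gamma) (cmz_lift l),
      (forall n, cmz_lift l @` Aalg_ge Gamma n = Ban_ge Gamma n),
      (forall (c : Cx R) f h, Aalg Gamma f -> Aalg Gamma h ->
         cmz_lift l (c *: f + h) = c *: cmz_lift l f + cmz_lift l h),
      cmz_lift l (@forms_one R) = @psido_one (hfun R) &
      (forall f h, Aalg Gamma f -> Aalg Gamma h ->
         cmz_lift l (mu l f h) = psido_mul (@dtau R) (cmz_lift l f) (cmz_lift l h))].
Proof.
move=> Cc _ genusC genus_gt1 [Gdet _ _ _ _] qU lP.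
have neg a : Ban Gamma a -> order_le a 0.
  exact: (invariant_order_le0 Cc genusC genus_gt1 Gdet qU).
split; first by move=> f h; exact: mu_Aalg.
split.
- split.
  + by move=> f; exact: lift_Ban.
  + by move=> f h _ _; exact: (lift_inj lP).
  + move=> a Ba; have [f Af <-] := lift_onto lP Gdet Ba (neg a Ba).
    by exists f.
- move=> n; apply/seteqP; split=> [_ [f [Af f0] <-]|a [Ba an]].
    by split; [exact: lift_Ban | exact/(order_liftP lP)].
  have [f Af fa] := lift_onto lP Gdet Ba (neg a Ba); exists f => //; split => //.
  by apply/(order_liftP lP); rewrite fa.
- by move=> c f h [hf _] [hh _]; exact: lift_linear.
- exact: lift_one.
- by move=> f h [hf _] [hh _]; have [] := mu_lift lP hf hh.
Qed.
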